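(* Let $E$ be a complex Banach space such that $E'$ has the bounded approximation property, and let $r,q,s,p$ be exponents satisfying the standing assumptions of the context. Let $E'$ be separable. Then every convolution operator on $\mathcal{H}_{\widetilde{N}b,((r,q);(s,p))}(E)$ which is not a scalar multiple of the identity is hypercyclic.
   Context: Exponents: $r,q\in(1,\infty)$, $s,p\in[1,\infty)$, $r\le q$, $s'\le p'$ (where $\frac1t+\frac1{t'}=1$), and $1\le\frac1q+\frac n{p'}$ for every $n\in\mathbb{N}$ (equivalently for $n=1$). $\mathcal{P}(^{n}E)$ is the space of continuous $n$-homogeneous polynomials $E\to\mathbb{C}$ with the sup norm on the unit ball, $\mathcal{P}(^{0}E)=\mathbb{C}$; $\varphi^{n}(x)=\varphi(x)^{n}$ for $\varphi\in E'$. Lorentz sequences: for a Banach space $X$ and a bounded sequence $x$ in $X$, $a_{X,n}(x)=\inf\{\|x-u\|_{\infty}: u\in c_{00}(X),\ u \text{ has fewer than } n \text{ nonzero terms}\}$ ($c_{00}(X)$: finitely nonzero sequences). For $0<u,v<\infty$, $\ell_{(u,v)}(X)$ is the space of bounded sequences $x$ with $\|x\|_{(u,v)}=\|(n^{1/u-1/v}a_{X,n}(x))_{n}\|_{\ell_v}<\infty$; $\ell_{(u,v)}=\ell_{(u,v)}(\mathbb{C})$. $\ell^{w}_{(u,v)}(X)$ is the space of sequences $(x_j)$ in $X$ with $(\varphi(x_j))_j\in\ell_{(u,v)}$ for all $\varphi\in X'$, with $\|(x_j)\|_{w,(u,v)}=\sup_{\|\varphi\|\le1}\|(\varphi(x_j))_j\|_{(u,v)}$.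 Lorentz nuclear polynomials ($n\in\mathbb{N}$): $\mathcal{P}_{N,((r,q);(s,p))}(^{n}E)$ is the space of $P=\sum_{j}\lambda_{j}\varphi_{j}^{n}y_{j}$ with $(\lambda_j)\in\ell_{(r,q)}$, $(\varphi_j)\in\ell^{w}_{(s',p')}(E')$, $(y_j)\in\ell_{\infty}$, with quasi-norm $\|P\|_{N}=\inf\|(\lambda_j)\|_{(r,q)}\|(\varphi_j)\|_{w,(s',p')}^{n}\|(y_j)\|_{\infty}$ over all such representations; $\|P\|\le\|P\|_N$. Lorentz summing polynomials: $\mathcal{P}_{as((r',q');(s',p'))}(^{n}E')$ is the space of $Q\in\mathcal{P}(^{n}E')$ with $(Q(\varphi_j))_j\in\ell_{(r',q')}$ whenever $(\varphi_j)\in\ell^{w}_{(s',p')}(E')$. Since $E'$ has the bounded approximation property, a known theorem says that the Borel transform $\mathcal{B}(T)(\varphi)=T(\varphi^{n})$ is a topological isomorphism from $\mathcal{P}_{N,((r,q);(s,p))}(^{n}E)'$ onto $\mathcal{P}_{as((r',q');(s',p'))}(^{n}E')$. Lorentz quasi-nuclear polynomials: put $\langle P,Q\rangle=\mathcal{B}^{-1}(Q)(P)$, let $U=\{P:\|P\|_{N}\le1\}$, $U^{\circ}=\{Q\in\mathcal{P}_{as((r',q');(s',p'))}(^{n}E'):|\langle P,Q\rangle|\le1\ \forall P\in U\}$, $U^{\circ\circ}=\{P\in\mathcal{P}_{N,((r,q);(s,p))}(^{n}E):|\langle P,Q\rangle|\le1\ \forall Q\in U^{\circ}\}$. The gauge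 $p_{U^{\circ\circ}}(P)=\inf\{\delta>0:P\in\delta U^{\circ\circ}\}$ is a norm with $\|P\|\le p_{U^{\circ\circ}}(P)\le\|P\|_N$, and $(\mathcal{P}_{\widetilde{N},((r,q);(s,p))}(^{n}E),\|\cdot\|_{\widetilde{N}})$ is the completion of $(\mathcal{P}_{N,((r,q);(s,p))}(^{n}E),p_{U^{\circ\circ}})$, regarded by the paper as a subspace of $\mathcal{P}(^{n}E)$ through the continuous extension of the inclusion. For $n=0$ it is $\mathbb{C}$ with the modulus. $\mathcal{H}_{\widetilde{N}b,((r,q);(s,p))}(E)$ is the space of entire $f\colon E\to\mathbb{C}$, $f=\sum_m\frac1{m!}\hat{d}^{m}f(0)$ (Taylor series at $0$, $\hat{d}^mf(0)\in\mathcal{P}(^{m}E)$), such that $\hat{d}^{m}f(0)\in\mathcal{P}_{\widetilde{N},((r,q);(s,p))}(^{m}E)$ for all $m\in\mathbb{N}_{0}$ and $\lim_{m}(\frac1{m!}\|\hat{d}^{m}f(0)\|_{\widetilde{N}})^{1/m}=0$. It is a Fréchet space with the seminorms $\|f\|_{\rho}=\sum_{m=0}^{\infty}\frac{\rho^{m}}{m!}\|\hat{d}^{m}f(0)\|_{\widetilde{N}}$, $\rho>0$. A convolution operator on $\mathcal{H}=\mathcal{H}_{\widetilde{N}b,((r,q);(s,p))}(E)$ is a continuous linear $L\colon\mathcal{H}\to\mathcal{H}$ with $L(\tau_{a}f)=\tau_{a}(Lf)$ for all $a\in E$, $f\in\mathcal{H}$, where $\tau_{a}f(x)=f(x-a)$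 (and $\tau_a f\in\mathcal{H}$). A map $g\colon X\to X$ on a topological space is hypercyclic if $\{x,g(x),g^{2}(x),\dots\}$ is dense in $X$ for some $x\in X$. *)

(* Defs.v *)
From HB Require Import structures.
From mathcomp Require Import all_boot all_order all_algebra.
From mathcomp Require Import complex.
From mathcomp Require Import all_classical all_reals all_analysis.

Set Implicit Arguments.
Unset Strict Implicit.
Unset Printing Implicit Defensive.

Import Order.TTheory GRing.Theory Num.Theory.
Import numFieldNormedType.Exports.

Local Open Scope classical_set_scope.
Local Open Scope ring_scope.
Local Open Scope complex_scope.

HB.instance Definition _ (R : realType) := NormedModule.copy R[i] R[i]^o.

(* In a normed module over [R[i]] the norm [`|x|] is a nonnegative real element
   of [R[i]]; [nrm x] is the same number in [R]. *)
Definition nrm (R : realType) (V : normedModType R[i]) (x : V) : R :=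
  complex.Re `|x|.

Section NrmTheory.
Context {R : realType} {V : normedModType R[i]}.
Implicit Types x y : V.

Lemma nrmE x : (nrm x)%:C = `|x|.
Proof.
by rewrite /nrm; have := normr_ge0 x; case: `|x| => a b /=;
  rewrite lecE /= => /andP[/eqP -> _].
Qed.

Lemma nrm_ge0 x : 0 <= nrm x.
Proof. by have := normr_ge0 x; rewrite -nrmE lecR. Qed.

Lemma nrm_le x y : (nrm x <= nrm y) = (`|x| <= `|y|).
Proof. by rewrite -lecR !nrmE. Qed.

Lemma nrmD x y : nrm (x + y) <= nrm x + nrm y.
Proof. by rewrite -lecR rmorphD /= !nrmE ler_normD. Qed.

Lemma nrmZ (a : R[i]) x : nrm (a *: x) = nrm a * nrm x.
Proof.
by apply: (@complexI R); rewrite rmorphM /= !nrmE normrZ.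
Qed.

Lemma nrm0 : nrm (0 : V) = 0.
Proof. by apply: (@complexI R); rewrite nrmE normr0. Qed.

Lemma nrm_eq0 x : nrm x = 0 -> x = 0.
Proof.
by move=> x0; apply/eqP; rewrite -normr_eq0 -nrmE x0.
Qed.

End NrmTheory.

Section Dual.
Context {R : realType} (V : normedModType R[i]).

Definition continuous_functional : {pred V -> R[i]} :=
  [pred f | `[< linear f /\ continuous f >]].

Record dual := Dual {
  dual_fun :> V -> R[i];
  dual_funP : dual_fun \in continuous_functional }.

HB.instance Definition _ := [isSub for dual_fun].
HB.instance Definition _ := [Choice of dual by <:].

Lemma continuous_functional_submod : submod_closed continuous_functional.
Proof.
split=> [|a f g /asboolP[lf cf] /asboolP[lg cg]]; apply/asboolP; split.
- by move=> a x y; rewrite /= scaler0 addr0.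
- exact: cst_continuous.
- move=> b x y; rewrite !fctE lf lg.
  by rewrite !scalerDr !scalerA (mulrC a b) addrACA.
- move=> x; apply: cvgD; last exact: cg.
  by apply: cvgZl_tmp; exact: cf.
Qed.

HB.instance Definition _ := GRing.isSubmodClosed.Build _ _
  continuous_functional continuous_functional_submod.
HB.instance Definition _ := [SubChoice_isSubLmodule of dual by <:].

Lemma dual_linear (f : dual) : linear f.
Proof. by have /asboolP[] := dual_funP f. Qed.

Lemma dual_continuous (f : dual) : continuous f.
Proof. by have /asboolP[] := dual_funP f. Qed.

Definition dual_norm (f : dual) : R :=
  sup [set nrm (f x) | x in [set x : V | nrm x <= 1]].

Lemma dual_bounded (f : dual) : exists M : R, forall x, nrm (f x) <= M * nrm x.
Proof.
pose L := GRing.isLinear.Build _ _ _ _ (f : V -> R[i]) (dual_linear f).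
pose g : {linear V -> R[i]} := HB.pack (f : V -> R[i]) L.
have /linear_boundedP : bounded_near g (nbhs (0 : V)).
  by apply/linear_bounded_continuous; exact: dual_continuous.
move=> /pinfty_ex_gt0[M M0 gM].
exists (complex.Re M) => x; rewrite -lecR rmorphM /= !nrmE.
suff -> : (complex.Re M)%:C = M by exact: gM.
by case: M M0 {gM} => a b; rewrite ltcE /= => /andP[/eqP ->].
Qed.

Lemma dual_has_sup (f : dual) :
  has_sup [set nrm (f x) | x in [set x : V | nrm x <= 1]].
Proof.
split; first by exists (nrm (f 0)), 0 => //=; rewrite nrm0 ler01.
have [M fM] := dual_bounded f; exists `|M| => _ [x /= x1 <-].
apply: (le_trans (fM x)); apply: (le_trans (ler_wpM2r (nrm_ge0 x) (ler_norm M))).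
by rewrite ler_piMr.
Qed.

Lemma dual_norm_ub (f : dual) (x : V) : nrm x <= 1 -> nrm (f x) <= dual_norm f.
Proof. by move=> x1; apply: sup_upper_bound (dual_has_sup f) _ _; exists x. Qed.

Lemma dual_norm_le (f : dual) M :
  (forall x, nrm x <= 1 -> nrm (f x) <= M) -> dual_norm f <= M.
Proof.
move=> fM; apply: ge_sup; first exact: (dual_has_sup f).1.
by move=> _ [x /= x1 <-]; exact: fM.
Qed.

Definition dual_normC (f : dual) : R[i] := (dual_norm f)%:C.

Lemma dual_normD f g : dual_normC (f + g) <= dual_normC f + dual_normC g.
Proof.
rewrite -rmorphD lecR; apply: dual_norm_le => x x1.
by apply: (le_trans (nrmD _ _)); apply: lerD; exact: dual_norm_ub.
Qed.

Lemma dual_normZ (a : R[i]) f : dual_normC (a *: f) = `|a| * dual_normC f.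
Proof.
rewrite -nrmE -rmorphM; congr (_%:C).
have leZ b g : dual_norm (b *: g) <= nrm b * dual_norm g.
  apply: dual_norm_le => x x1; rewrite (_ : (b *: g) x = b *: g x)// nrmZ.
  by rewrite ler_wpM2l ?nrm_ge0// dual_norm_ub.
apply/eqP; rewrite eq_le leZ /=.
have [->|a0] := eqVneq a 0.
  rewrite nrm0 mul0r; apply: (le_trans (nrm_ge0 ((0 *: f) 0))).
  by apply: dual_norm_ub; rewrite nrm0 ler01.
have na0 : 0 < nrm a.
  rewrite lt_neqAle nrm_ge0 andbT eq_sym; apply: contra a0 => /eqP.
  by move=> /nrm_eq0 ->.
have aV : nrm a^-1 = (nrm a)^-1.
  by apply: (@complexI R); rewrite fmorphV /= !nrmE normfV.
have := leZ a^-1 (a *: f); rewrite scalerA mulVf// scale1r aV.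
by rewrite ler_pdivlMl.
Qed.

Lemma dual_norm0_eq0 f : dual_normC f = 0 -> f = 0.
Proof.
move=> /(@complexI R) f0; apply/val_inj/funext => x /=.
have [M fM] := dual_bounded f.
have [->|x0] := eqVneq x 0.
  by apply: nrm_eq0; apply/eqP; rewrite eq_le nrm_ge0 andbT;
    have := fM 0; rewrite nrm0 mulr0.
set c := `|x|.
have c0 : c != 0 by rewrite normr_eq0.
have : nrm (f (c^-1 *: x)) <= 0.
  rewrite -f0; apply: dual_norm_ub.
  by rewrite -lecR nrmE normrZ normfV normr_id mulVf.
have -> : f (c^-1 *: x) = c^-1 *: f x.
  have f00 : f 0 = 0.
    by have := dual_linear f 1 0 0; rewrite !scale1r addr0 => /esym/eqP;
      rewrite -subr_eq0 addrK => /eqP.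
  by have := dual_linear f c^-1 x 0; rewrite addr0 f00 addr0.
move=> h; have /nrm_eq0/eqP : nrm (c^-1 *: f x) = 0.
  by apply/eqP; rewrite eq_le h nrm_ge0.
by rewrite scaler_eq0 invr_eq0 (negbTE c0) /= => /eqP.
Qed.

HB.instance Definition _ := Lmodule_isNormed.Build R[i] dual
  dual_normD dual_normZ dual_norm0_eq0.

End Dual.

Definition separable (T : topologicalType) : Prop :=
  exists2 D : set T, countable D & dense D.

Definition hypercyclic (T : topologicalType) (g : T -> T) : Prop :=
  exists x : T, dense (range (fun k => iter k g x)).

Definition finite_rank (K : numFieldType) (V W : lmodType K) (T : V -> W) :
    Prop :=
  exists (m : nat) (w : 'I_m -> W), forall x, exists c : 'I_m -> K,
    T x = \sum_(i < m) c i *: w i.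

Definition bounded_approximation_property (R : realType)
    (X : normedModType R[i]) : Prop :=
  exists lam : R, forall (K : set X) (e : R), compact K -> 0 < e ->
    exists T : {linear X -> X},
      [/\ finite_rank T,
          (forall x, nrm (T x) <= lam * nrm x) &
          forall x, K x -> nrm (T x - x) < e].

Section Lorentz.
Context {R : realType}.
Local Open Scope ereal_scope.

Definition seq_norm (X : normedModType R[i]) (x : nat -> X) : \bar R :=
  ereal_sup (range (fun j => (nrm (x j))%:E)).

(* The condition on [t] says that [u] has fewer than [n] nonzero terms. *)
Definition approx_number (X : normedModType R[i]) (n : nat) (x : nat -> X) :
    \bar R :=
  ereal_inf [set seq_norm (fun j => x j - u j)%R | u in
    [set u : nat -> X | exists t : seq nat,
       (size t < n)%N /\ forall j, j \notin t -> u j = 0%R]].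

Definition lorentz_norm (X : normedModType R[i]) (u v : R) (x : nat -> X) :
    \bar R :=
  (\sum_(1 <= n <oo)
     ((n%:R `^ (u^-1 - v^-1))%:E * approx_number n x) `^ v) `^ v^-1.

Definition lorentz (X : normedModType R[i]) (u v : R) : set (nat -> X) :=
  [set x | seq_norm x < +oo /\ lorentz_norm u v x < +oo].

Definition weak_lorentz (X : normedModType R[i]) (u v : R) : set (nat -> X) :=
  [set x | forall phi : dual X, lorentz u v (fun j => phi (x j))].

Definition weak_lorentz_norm (X : normedModType R[i]) (u v : R)
    (x : nat -> X) : \bar R :=
  ereal_sup [set lorentz_norm u v (fun j => phi (x j)) |
    phi in [set phi : dual X | (nrm phi <= 1)%R]].

End Lorentz.

Section Polynomials.
Context {R : realType}.
Implicit Types X : normedModType R[i].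

Definition multilinear X n (A : ('I_n -> X) -> R[i]) : Prop :=
  forall (v : 'I_n -> X) (i : 'I_n) (a : R[i]) (x y : X),
    let put z := fun j => if j == i then z else v j in
    A (put (a *: x + y)) = a * A (put x) + A (put y).

Definition hpoly X (n : nat) : set (X -> R[i]) :=
  [set P | continuous P /\
    exists2 A : ('I_n -> X) -> R[i], multilinear A &
      forall x, P x = A (fun=> x)].

Definition hpoly_norm X (P : X -> R[i]) : \bar R :=
  ereal_sup [set (nrm (P x))%:E | x in [set x : X | nrm x <= 1]].

Definition taylor_at X (f : X -> R[i]) (a : X) (P : nat -> X -> R[i]) : Prop :=
  (forall m, hpoly m (P m)) /\
  exists2 d : R, 0 < d & forall e : R, 0 < e ->
    \forall k \near \oo, forall x, nrm (x - a) < d ->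
      nrm (f x - \sum_(m < k) P m (x - a)) < e.

Definition entire X (f : X -> R[i]) : Prop :=
  forall a, exists P, taylor_at f a P.

(* The differential [d^m f(0)] as an [m]-homogeneous polynomial: [m!] times the
   [m]-th term of the Taylor series at [0], which is unique if it exists. *)
Definition dhat X (m : nat) (f : X -> R[i]) : X -> R[i] :=
  fun x => m`!%:R * xget (fun _ _ => 0) [set P | taylor_at f 0 P] m x.

End Polynomials.

Section LorentzPolynomials.
Context {R : realType}.
Variables (r q s p : R) (E : normedModType R[i]).

(* The conjugate exponents, read off in [R].  [hoelder_conjugate 1 = +oo], but
   [1 <= 1 / q + 1 / p'] with [1 < q] forces [p' < +oo], and then
   [s' <= p' < +oo]; so [s] and [p] differ from [1]. *)
Let r' := fine (hoelder_conjugate r%:E).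
Let q' := fine (hoelder_conjugate q%:E).
Let s' := fine (hoelder_conjugate s%:E).
Let p' := fine (hoelder_conjugate p%:E).

Definition nuclear_rep (n : nat) (P : E -> R[i]) (lam : nat -> R[i])
    (phi : nat -> dual E) (y : nat -> R[i]) : Prop :=
  [/\ lorentz r q lam, weak_lorentz s' p' phi, (seq_norm y < +oo)%E &
      (fun k => hpoly_norm (fun x =>
         P x - \sum_(j < k) lam j * phi j x ^+ n * y j)) @ \oo --> 0%E].

Definition nuclear (n : nat) : set (E -> R[i]) :=
  [set P | hpoly n P /\ exists lam phi y, nuclear_rep n P lam phi y].

Definition nuclear_norm (n : nat) (P : E -> R[i]) : \bar R :=
  ereal_inf [set z | exists lam phi y, nuclear_rep n P lam phi y /\
    z = (lorentz_norm r q lam * weak_lorentz_norm s' p' phi ^+ n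
         * seq_norm y)%E].

Definition as_summing (n : nat) : set (dual E -> R[i]) :=
  [set Q | hpoly n Q /\ forall phi : nat -> dual E, weak_lorentz s' p' phi ->
    lorentz r' q' (fun j => Q (phi j))].

(* Continuous linear functionals on the quasi-normed space [nuclear n], as
   functions on [E -> R[i]] whose values outside [nuclear n] are irrelevant. *)
Definition nuclear_functional (n : nat) : set ((E -> R[i]) -> R[i]) :=
  [set T |
    (forall (a : R[i]) P1 P2, nuclear n P1 -> nuclear n P2 ->
       T (fun x => a * P1 x + P2 x) = a * T P1 + T P2) /\
    (forall P0 (e : R), nuclear n P0 -> 0 < e ->
       exists2 d : R, 0 < d & forall P, nuclear n P ->
         (nuclear_norm n (fun x => P x - P0 x)%R < d%:E)%E ->
         nrm (T P - T P0) < e)].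

Definition borel (n : nat) (T : (E -> R[i]) -> R[i]) : dual E -> R[i] :=
  fun phi => T (fun x => phi x ^+ n).

(* [<P, Q> = borel^-1 Q P].  When [dual E] has the bounded approximation
   property, [borel n] is bijective onto [as_summing n] and the default value
   of [xget] is not used. *)
Definition pairing (n : nat) (P : E -> R[i]) (Q : dual E -> R[i]) : R[i] :=
  xget (fun=> 0) [set T | nuclear_functional n T /\ borel n T = Q] P.

Definition nuclear_ball (n : nat) : set (E -> R[i]) :=
  [set P | nuclear n P /\ (nuclear_norm n P <= 1)%E].

Definition polar (n : nat) : set (dual E -> R[i]) :=
  [set Q | as_summing n Q /\
    forall P, nuclear_ball n P -> nrm (pairing n P Q) <= 1].

Definition bipolar (n : nat) : set (E -> R[i]) :=
  [set P | nuclear n P /\ forall Q, polar n Q -> nrm (pairing n P Q) <= 1].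

Definition bipolar_gauge (n : nat) (P : E -> R[i]) : \bar R :=
  ereal_inf [set d%:E | d in [set d : R | 0 < d /\
    exists2 P0, bipolar n P0 & forall x, P x = d%:C * P0 x]].

(* [Pk] represents an element of the completion of [nuclear n] for
   [bipolar_gauge n] whose image under the extension of the inclusion into
   [hpoly n] is [P]. *)
Definition completion_rep (n : nat) (P : E -> R[i]) (Pk : nat -> E -> R[i]) :
    Prop :=
  [/\ (forall k, nuclear n (Pk k)),
      (forall e : R, 0 < e -> exists N, forall k l, (N <= k)%N -> (N <= l)%N ->
         (bipolar_gauge n (fun x => Pk k x - Pk l x)%R < e%:E)%E) &
      (fun k => hpoly_norm (fun x => Pk k x - P x)) @ \oo --> 0%E].

Definition quasi_nuclear (n : nat) : set (E -> R[i]) :=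
  [set P | hpoly n P /\ (n = 0%N \/ exists Pk, completion_rep n P Pk)].

(* For [0 < n], the norm of an element of the completion is the limit of
   [bipolar_gauge n] along any sequence representing it.  The elements of the
   completion are identified with their images in [hpoly n], so that there is
   only one such limit and the infimum is its value. *)
Definition quasi_nuclear_norm (n : nat) (P : E -> R[i]) : \bar R :=
  if n is 0 then (nrm (P 0))%:E
  else ereal_inf [set l | exists2 Pk, completion_rep n P Pk &
         (fun k => bipolar_gauge n (Pk k)) @ \oo --> l].

Definition HNb_set : set (E -> R[i]) :=
  [set f | [/\ entire f, (forall m, quasi_nuclear m (dhat m f)) &
    (fun m => ((m`!%:R^-1)%:E * quasi_nuclear_norm m (dhat m f))
                `^ m%:R^-1)%E @ \oo --> 0%E]].

Definition HNb_seminorm (rho : R) (f : E -> R[i]) : \bar R :=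
  (\sum_(0 <= m <oo)
     (rho ^+ m / m`!%:R)%:E * quasi_nuclear_norm m (dhat m f))%E.

Record HNb := MkHNb { HNb_fun :> E -> R[i]; HNb_funP : HNb_set HNb_fun }.

HB.instance Definition _ := gen_eqMixin HNb.
HB.instance Definition _ := gen_choiceMixin HNb.

(* The locally convex topology defined by the seminorms [HNb_seminorm rho],
   [0 < rho]. *)
Definition HNb_open (U : set HNb) : Prop :=
  forall f : HNb, U f -> exists (t : seq R) (e : R),
    [/\ (forall rho, rho \in t -> 0 < rho), 0 < e &
        forall g : HNb,
          (forall rho, rho \in t ->
             (HNb_seminorm rho (fun x => g x - f x)%R < e%:E)%E) -> U g].

Lemma HNb_openT : HNb_open setT.
Proof. by move=> f _; exists [::], 1. Qed.

Lemma HNb_openI : setI_closed HNb_open.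
Proof.
move=> A B oA oB f [/oA[t1 [e1 [t1P e1P A1]]] /oB[t2 [e2 [t2P e2P B1]]]].
exists (t1 ++ t2), (Num.min e1 e2); split.
- by move=> rho; rewrite mem_cat => /orP[/t1P|/t2P].
- by rewrite lt_min e1P.
- move=> g fg; split.
  + apply: A1 => rho t1rho; apply: (lt_le_trans (fg rho _)).
      by rewrite mem_cat t1rho.
    by rewrite lee_fin ge_min lexx.
  + apply: B1 => rho t2rho; apply: (lt_le_trans (fg rho _)).
      by rewrite mem_cat t2rho orbT.
    by rewrite lee_fin ge_min lexx orbT.
Qed.

Lemma HNb_open_bigU (I : Type) (F : I -> set HNb) :
  (forall i, HNb_open (F i)) -> HNb_open (\bigcup_i F i).
Proof.
move=> oF f [i _ Fif]; have [t [e [tP eP fF]]] := oF i f Fif.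
by exists t, e; split=> // g /fF Fig; exists i.
Qed.

HB.instance Definition _ := isOpenTopological.Build HNb
  HNb_openT HNb_openI HNb_open_bigU.

(* The vector space operations and translations of [HNb] are those of
   functions, so they are expressed on the underlying functions. *)
Definition HNb_linear (L : HNb -> HNb) : Prop :=
  forall (a : R[i]) (f g h : HNb),
    (forall x, h x = a * f x + g x) -> forall x, L h x = a * L f x + L g x.

Definition HNb_translation_invariant (L : HNb -> HNb) : Prop :=
  forall (a : E) (f g : HNb),
    (forall x, g x = f (x - a)) -> forall x, L g x = L f (x - a).

Definition convolution_operator (L : HNb -> HNb) : Prop :=
  [/\ HNb_linear L, continuous L & HNb_translation_invariant L].

Definition scalar_operator (L : HNb -> HNb) : Prop :=
  exists c : R[i], forall (f : HNb) x, L f x = c * f x.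

End LorentzPolynomials.

(* Main.v *)
From mathcomp Require Import all_boot all_order all_algebra.
From mathcomp Require Import cyclic separable cyclotomic.
Require Import Defs.
From mathcomp Require Import complex.
From mathcomp Require Import all_classical all_reals all_analysis.
From mathcomp Require Import ring lra zify.

(** Every convolution operator [L] multiplies the exponential of a functional [phi] by a
  scalar [symbol L phi], because translating an exponential multiplies it by a scalar
  ([convolution_exp]). The proof shows that both the exponentials with
  [nrm (symbol L phi) < 1] and those with [1 < nrm (symbol L phi)] span dense subspaces.
  The powers of [L] tend to zero on the first subspace, while on the second one [L] has
  a right inverse whose powers tend to zero. This is the criterion of Godefroy and
  Shapiro, and a hypercyclic vector is built as the sum of a series
  ([hypercyclic_step], [orbit_follows]): the term chosen at step [k] is small, it
  approximates the inverse image under a high power of [L] of the [k]-th target, and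
  neither does it spoil the previous targets nor do the previous terms spoil the new
  one. The targets run infinitely often through a countable dense family
  ([countable_exp_sums]), which exists because the dual is separable.

  All the estimates are about finite sums of exponentials. The polynomial [phi ^ m] has
  norm at most [nrm phi ^ m], so the coefficients and the functionals of a sum of
  exponentials bound all its seminorms. The gauge of the bipolar also dominates the sup
  norm ([gaugeR_ball]), because evaluation at a point of the unit ball belongs to the
  polar; hence limits for the seminorms are limits of functions. There the conditions on
  the exponents enter, through a Hoelder inequality for Lorentz sequences and through
  the inclusions between these spaces, together with the finiteness of the weak Lorentz
  norms, which is a consequence of the uniform boundedness principle
  ([weak_lorentz_norm_fin]).

  The main tool is interpolation. The polynomial [(phi + z psi) ^ m] has degree [m] in
  [z], so for [m < M] it is the Lagrange combination of its values at [M] nodes on a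
  circle, while for large [M] the degrees [m >= M] contribute little. Thus the
  exponential of [phi + z psi] is a limit of combinations of exponentials of the nodes
  ([interpolant_lt]). This has three consequences.
  - On complex lines the symbol is a locally uniform limit of polynomials
    ([symbol_poly_approx]), that is, an entire function. If it is not constant, it takes
    values inside and outside the unit disc by Liouville's theorem.
  - The exponentials of the functionals of a set span a dense subspace as soon as the
    set contains a small disc around one point in every complex direction
    ([absorbing_approximable]). The two sets above have this property by continuity.
  - Powers of functionals are Lipschitz functions of the functional
    ([ngauge_power_lipschitz]), so the functionals can be taken in a countable set.

  If the symbol is constant, [L] is a multiple of the identity, since the exponentials
  span a dense subspace ([exp_sum_dense]) and an element of the space with vanishing
  seminorms is zero by the identity theorem ([entire_eq0]). *)

Set Implicit Arguments.
Unset Strict Implicit.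
Unset Printing Implicit Defensive.

Import Order.TTheory GRing.Theory Num.Theory.
Import numFieldNormedType.Exports.

Local Open Scope classical_set_scope.
Local Open Scope ring_scope.
Local Open Scope complex_scope.

(** * Moduli of complex numbers and sequences *)

Section Modulus.
Context {R : realType}.
Implicit Types (a b z : R[i]) (x : R).

Lemma nrmM a b : nrm (a * b) = nrm a * nrm b.
Proof. by apply: (@complexI R); rewrite rmorphM /= !nrmE normrM. Qed.

Lemma nrm1 : nrm (1 : R[i]) = 1.
Proof. by apply: (@complexI R); rewrite nrmE normr1. Qed.

Lemma nrmX a n : nrm (a ^+ n) = nrm a ^+ n.
Proof. by elim: n => [|n IH]; rewrite ?expr0 ?nrm1 // !exprS nrmM IH. Qed.

Lemma nrmV a : nrm a^-1 = (nrm a)^-1.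
Proof. by apply: (@complexI R); rewrite fmorphV /= !nrmE normfV. Qed.

Lemma nrm_real x : nrm (x%:C : R[i]) = `|x|.
Proof.
apply: (@complexI R); rewrite nrmE normc_def /=; congr (_%:C).
by rewrite expr0n addr0 sqrtr_sqr.
Qed.

Lemma nrm_nat n : nrm (n%:R : R[i]) = n%:R.
Proof. by rewrite -(rmorph_nat (real_complex R)) nrm_real normr_nat. Qed.

Lemma Re_le_nrm z : `|complex.Re z| <= nrm z.
Proof. by rewrite -lecR nrmE; exact: normc_ge_Re. Qed.

End Modulus.

Section ModulusInNormedModules.
Context {R : realType} {V : normedModType R[i]}.
Implicit Types x y : V.

Lemma nrmN x : nrm (- x) = nrm x.
Proof. by rewrite /nrm normrN. Qed.

Lemma nrmB x y : nrm (x - y) <= nrm x + nrm y.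
Proof. by rewrite -(nrmN y); exact: nrmD. Qed.

Lemma nrm_distC x y : nrm (x - y) = nrm (y - x).
Proof. by rewrite -nrmN opprB. Qed.

Lemma nrm_sum (I : Type) (s : seq I) (P : pred I) (F : I -> V) :
  nrm (\sum_(i <- s | P i) F i) <= \sum_(i <- s | P i) nrm (F i).
Proof.
elim/big_ind2 : _ => [|x a y b xa yb|//]; first by rewrite nrm0.
by rewrite (le_trans (nrmD _ _))// lerD.
Qed.

Lemma nrm_gt0 x : (0 < nrm x) = (x != 0).
Proof.
rewrite lt0r nrm_ge0 andbT; congr negb; apply/eqP/eqP => [/nrm_eq0//|->].
exact: nrm0.
Qed.

Definition seqlim (u : nat -> V) (l : V) : Prop :=
  forall e, 0 < e -> exists N, forall n, (N <= n)%N -> nrm (u n - l) < e.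

End ModulusInNormedModules.

Section ComplexPlane.
Context {R : realType}.
Implicit Types (z w : R[i]) (x t : R).

Lemma nrm_le_ReIm z : nrm z <= `|complex.Re z| + `|complex.Im z|.
Proof.
rewrite [in leLHS](complexE z) (le_trans (nrmD _ _))// nrmM !nrm_real.
suff -> : nrm ('i%C : R[i]) = 1 by rewrite mul1r.
by apply: (@complexI R); rewrite nrmE normc_def /= expr0n expr1n add0r sqrtr1.
Qed.

Lemma Im_le_nrm z : `|complex.Im z| <= nrm z.
Proof.
rewrite -ler_sqr ?nnegrE ?nrm_ge0//.
rewrite -(@lecR R) !rmorphXn /= nrmE -add_Re2_Im2 -rmorphXn lecR.
by rewrite real_normK ?num_real// lerDr sqr_ge0.
Qed.

Lemma seqlim_complete (u : nat -> R[i]) :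
  (forall e, 0 < e -> exists N, forall m n, (N <= m)%N -> (N <= n)%N ->
     nrm (u m - u n) < e) ->
  exists l, seqlim u l.
Proof.
move=> cu.
have cvgR (v : nat -> R) : (forall m n, `|v m - v n| <= nrm (u m - u n)) ->
    exists l, forall e, 0 < e -> exists N, forall n, (N <= n)%N -> `|v n - l| < e.
  move=> vu.
  have : cvg (v @ \oo).
    apply: cauchy_cvg; apply: cauchy_exP => e e0.
    have [N uN] := cu _ e0; exists (v N); exists N => // n /= Nn.
    by rewrite -ball_normE /ball_/=; apply: le_lt_trans (vu _ _) (uN _ _ _ _).
  move=> /cvg_ex[l vl]; exists l => e e0.
  have /cvgrPdist_lt/(_ e e0)[N _ Nl] := vl.
  by exists N => n Nn; rewrite distrC; exact: Nl.
have [a ua] := cvgR (fun n => complex.Re (u n)) (fun m n =>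
  ltac:(by move: (Re_le_nrm (u m - u n)); case: (u m) (u n) => [? ?] [? ?])).
have [b ub] := cvgR (fun n => complex.Im (u n)) (fun m n =>
  ltac:(by move: (Im_le_nrm (u m - u n)); case: (u m) (u n) => [? ?] [? ?])).
exists (a +i* b) => e e0.
have e2 : 0 < e / 2 by rewrite divr_gt0.
have [N1 N1P] := ua _ e2; have [N2 N2P] := ub _ e2.
exists (maxn N1 N2) => n; rewrite geq_max => /andP[n1 n2].
apply: (le_lt_trans (nrm_le_ReIm _)).
have := N1P _ n1; have := N2P _ n2.
by case: (u n) => c d /=; lra.
Qed.

Lemma seqlim_uniq (V : normedModType R[i]) (u : nat -> V) l l' :
  seqlim u l -> seqlim u l' -> l = l'.
Proof.
move=> ul ul'; apply/eqP; rewrite -subr_eq0; apply/negPn/negP => nl.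
have d0 : 0 < nrm (l - l') / 2 by rewrite divr_gt0// nrm_gt0.
have [N1 N1P] := ul _ d0; have [N2 N2P] := ul' _ d0.
have := N1P _ (leq_maxl N1 N2); have := N2P _ (leq_maxr N1 N2).
set w := u _; have := nrmB (w - l') (w - l).
by rewrite opprB addrC addrA subrK; lra.
Qed.

End ComplexPlane.

(** * Roots of unity and Cauchy's estimate *)

Section RootsOfUnity.
Context {R : realType}.

Lemma prim_root_exists (n : nat) : (0 < n)%N -> {w : R[i] | n.-primitive_root w}.
Proof.
move=> n0.
have [rs def_p] := closed_field_poly_normal ('X^n - 1 : {poly R[i]}).
have lc1 : lead_coef ('X^n - 1 : {poly R[i]}) = 1.
  exact: (monicP (monicXnsubC 1 n0)).
rewrite lc1 scale1r in def_p.
have sz_r : size rs = n.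
  have := size_prod_XsubC rs id; rewrite -def_p size_XnsubC// => -[<-] //.
have rn1 : all n.-unity_root rs.
  by apply/allP => z; rewrite -root_prod_XsubC -def_p.
have urs : uniq rs.
  rewrite -separable_prod_XsubC -def_p.
  by apply/separable_Xn_sub_1; rewrite pnatr_eq0 -lt0n.
by apply/sigW; have [|z zP hz] := hasP (has_prim_root n0 rn1 urs _);
  [rewrite sz_r | exists z].
Qed.

(** The orthogonality relation for the characters of the cyclic group: this is
  what replaces contour integration below. *)
Lemma sum_prim_root (n : nat) (w : R[i]) (k l : nat) : n.-primitive_root w ->
  (k < n)%N -> (l < n)%N ->
  \sum_(j < n) w ^+ (j * k) * (w ^+ (j * l))^-1 = (k == l)%:R * n%:R.
Proof.
move=> wn kn ln.
have n0 : (0 < n)%N by exact: leq_ltn_trans kn.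
have w0 : w != 0 by rewrite (prim_root_eq0 wn) -lt0n.
pose u := w ^+ k / w ^+ l.
under eq_bigr => j _ do rewrite !(mulnC j) !exprM -exprVn -exprMn -/u.
have un : u ^+ n = 1.
  by rewrite exprMn exprVn -!exprM !(mulnC _ n) !exprM (prim_expr_order wn) !expr1n divr1.
have [kl|kl] := eqVneq k l.
  by rewrite /u kl divff ?expf_neq0//; under eq_bigr do rewrite expr1n;
    rewrite sumr_const card_ord mul1r.
rewrite mul0r; apply/eqP.
have u1 : u - 1 != 0.
  rewrite subr_eq0; apply: contra kl => /eqP u1.
  have : w ^+ k == w ^+ l by rewrite -[w ^+ l]mul1r -u1 divfK// expf_neq0.
  by rewrite (eq_prim_root_expr wn) !modn_small.
by have := subrX1 u n; rewrite un subrr => /esym/eqP; rewrite mulf_eq0 (negbTE u1).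
Qed.

Lemma nrm_prim_root (n : nat) (w : R[i]) (j : nat) : n.-primitive_root w ->
  nrm (w ^+ j) = 1.
Proof.
move=> wn; have n0 := prim_order_gt0 wn.
have : nrm w ^+ n = 1 by rewrite -nrmX (prim_expr_order wn) nrm1.
rewrite nrmX => /eqP; rewrite pexpr_eq1 ?nrm_ge0// => /eqP ->.
by rewrite expr1n.
Qed.

(** The coefficient is the mean of the values at the roots of unity, twisted by a
  character. *)
Lemma poly_cauchy (p : {poly R[i]}) (B : R) (k : nat) :
  (forall z, nrm z <= 1 -> nrm p.[z] <= B) -> nrm p`_k <= B.
Proof.
move=> pB.
have B0 : 0 <= B.
  by apply: le_trans (nrm_ge0 (p.[0] : R[i])) (pB _ _); rewrite nrm0 ler01.
have [kn|kn] := ltnP k (size p); last by rewrite nth_default// nrm0.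
set n := size p in kn; have n0 : (0 < n)%N by exact: leq_ltn_trans kn.
have [w wn] := prim_root_exists n0.
have E : n%:R * p`_k = \sum_(j < n) p.[w ^+ j] * (w ^+ (j * k))^-1.
  under eq_bigr => j _ do rewrite horner_coef mulr_suml.
  rewrite exchange_big /=.
  under eq_bigr => l _.
    under eq_bigr => j _ do rewrite -exprM -mulrA.
    rewrite -mulr_sumr (sum_prim_root wn)//; over.
  rewrite (bigD1 (Ordinal kn))//= eqxx mul1r mulrC big1 ?addr0// => l lk.
  by move: lk; rewrite -val_eqE /= => /negbTE ->; rewrite mul0r mulr0.
rewrite -(@ler_pM2l _ n%:R) ?ltr0n//.
rewrite -{1}nrm_nat -nrmM E (le_trans (nrm_sum _ _ _))//.
rewrite mulr_natl -[in leRHS](card_ord n) -sumr_const; apply: ler_sum => j _.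
by rewrite nrmM nrmV (nrm_prim_root _ wn) invr1 mulr1 pB// (nrm_prim_root _ wn).
Qed.

End RootsOfUnity.

(** * Liouville's theorem for locally uniform limits of polynomials *)

Section Liouville.
Context {R : realType}.
Implicit Types (z w : R[i]) (p g : {poly R[i]}) (k e : R).

Definition poly_approx_on k (H : R[i] -> R[i]) : Prop :=
  forall e, 0 < e -> exists p : {poly R[i]}, forall z, nrm z <= k -> nrm (H z - p.[z]) <= e.

(** For functions on the plane, being a locally uniform limit of polynomials is the same
  as being entire; in this form everything reduces to polynomials. *)
Definition poly_approx (H : R[i] -> R[i]) : Prop :=
  forall k, 0 < k -> poly_approx_on k H.

Definition bounded_on k (H : R[i] -> R[i]) : Prop :=
  exists B, forall z, nrm z <= k -> nrm (H z) <= B.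

Lemma sum_geometric_le2 (t : R) n : 0 <= t <= 2^-1 -> \sum_(j < n) t ^+ j <= 2.
Proof.
move=> /andP[t0 t2]; have := subrX1 t n.
have tn : 0 <= t ^+ n by exact: exprn_ge0.
have : 0 <= \sum_(j < n) t ^+ j by apply: sumr_ge0 => j _; exact: exprn_ge0.
set S := \sum_(j < n) _ => S0 E.
have : (1 - t) * S <= 1 by lra.
suff : 2^-1 * S <= (1 - t) * S by lra.
by rewrite ler_wpM2r//; lra.
Qed.

Lemma real_complex_eq0 (x : R) : (x%:C == 0 :> R[i]) = (x == 0).
Proof. by rewrite -[0]/(0%:C) (inj_eq (@complexI R)). Qed.

Lemma poly_cauchy_radius p (B k : R) j : 0 < k ->
  (forall z, nrm z <= k -> nrm p.[z] <= B) -> nrm p`_j * k ^+ j <= B.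
Proof.
move=> k0 pB; have [jp|jp] := ltnP j (size p); last first.
  rewrite nth_default// nrm0 mul0r (le_trans (nrm_ge0 (p.[0] : R[i])))// pB//.
  by rewrite nrm0 ltW.
pose q := \poly_(i < size p) (p`_i * k%:C ^+ i).
have -> : nrm p`_j * k ^+ j = nrm q`_j.
  by rewrite coef_poly jp nrmM nrmX nrm_real gtr0_norm.
apply: poly_cauchy => z z1.
have -> : q.[z] = p.[k%:C * z].
  by rewrite horner_poly horner_coef; apply: eq_bigr => i _; rewrite exprMn mulrA.
by rewrite pB// nrmM nrm_real gtr0_norm// ler_piMr// ltW.
Qed.

(** Cauchy's estimate bounds the [j]-th coefficient by [B / k ^ j], and the terms of
  positive degree by a geometric series of ratio [nrm z / k]. *)
Lemma poly_near_const p (B k : R) : 0 < k ->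
  (forall z, nrm z <= k -> nrm p.[z] <= B) ->
  forall z, nrm z <= k / 2 -> nrm (p.[z] - p.[0]) <= 2 * B * (nrm z / k).
Proof.
move=> k0 pB z zk.
have pj j : nrm p`_j <= B / k ^+ j.
  by rewrite ler_pdivlMr ?exprn_gt0//; exact: poly_cauchy_radius.
have [p0|sp] := posnP (size p).
  have B0 : 0 <= B by have := pj 0%N; rewrite expr0 divr1; apply: le_trans (nrm_ge0 _).
  by move/eqP: p0; rewrite size_poly_eq0 => /eqP ->; rewrite !horner0 subrr nrm0
    !mulr_ge0// ?invr_ge0 ?nrm_ge0// ltW.
rewrite !horner_coef -(prednK sp) !big_ord_recl /= !expr0.
rewrite [X in _ - (_ + X)]big1 ?addr0; last first.
  by move=> i _; rewrite /= expr0n mulr0.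
rewrite addrAC subrr add0r (le_trans (nrm_sum _ _ _))//.
set t := nrm z / k.
have t2 : 0 <= t <= 2^-1.
  by rewrite /t divr_ge0 ?nrm_ge0 ?(ltW k0)//= ler_pdivrMr// mulrC.
have B0 : 0 <= B by have := pj 0%N; rewrite expr0 divr1; apply: le_trans (nrm_ge0 _).
apply: (@le_trans _ _ (\sum_(i < (size p).-1) B * t * t ^+ i)).
  apply: ler_sum => i _; rewrite nrmM nrmX -mulrA -exprS /t expr_div_n mulrCA mulrC.
  by have -> : bump 0 i = i.+1 by []; rewrite ler_wpM2l ?exprn_ge0 ?nrm_ge0// pj.
rewrite -mulr_sumr [leRHS](_ : _ = B * t * 2); last by ring.
by rewrite ler_wpM2l ?sum_geometric_le2// mulr_ge0//; case/andP: t2.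
Qed.

(** A polynomial bounded on a large disc is nearly constant near its centre. *)
Lemma liouville (H : R[i] -> R[i]) (B : R) : poly_approx H ->
  (forall z, nrm (H z) <= B) -> forall z, H z = H 0.
Proof.
move=> Hp HB z; apply/eqP; rewrite -subr_eq0; apply/eqP/nrm_eq0/eqP.
rewrite eq_le nrm_ge0 andbT; apply/ler_addgt0Pr => d d0; rewrite add0r.
have B0 : 0 <= B := le_trans (nrm_ge0 _) (HB 0).
pose e := Num.min 1 (d / 4).
have e0 : 0 < e by rewrite lt_min ltr01 divr_gt0.
have e1 : e <= 1 by rewrite ge_min lexx.
have e4 : e <= d / 4 by rewrite ge_min lexx orbT.
pose k := 2 * nrm z + 4 * (B + 1) * nrm z / d + 1.
have z0 := nrm_ge0 z.
have k1 : 0 <= 4 * (B + 1) * nrm z / d by rewrite divr_ge0 ?mulr_ge0 ?addr_ge0// ltW.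
have k0 : 0 < k by rewrite /k; lra.
have [p pP] := Hp k k0 e e0.
have pB w : nrm w <= k -> nrm p.[w] <= B + 1.
  move=> wk; have := pP _ wk; have := HB w.
  have := nrmB (H w) (H w - p.[w]); rewrite opprB addrC subrK; lra.
have zk : nrm z <= k / 2 by rewrite /k; lra.
have := poly_near_const k0 pB zk.
have zd : 2 * (B + 1) * (nrm z / k) <= d / 2.
  rewrite mulrA ler_pdivrMr//.
  have -> : d / 2 * k = d / 2 * (2 * nrm z + 1) + 2 * (B + 1) * nrm z.
    by rewrite /k; field; rewrite gt_eqF.
  by rewrite lerDr mulr_ge0//; lra.
have zk' : nrm z <= k by lra.
have := pP z zk'; have := pP 0; rewrite nrm0 => /(_ (ltW k0)).
have -> : H z - H 0 = (H z - p.[z]) + (p.[z] - p.[0]) - (H 0 - p.[0]) by ring.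
move=> h1 h2 h3; have := nrmB (H z - p.[z] + (p.[z] - p.[0])) (H 0 - p.[0]).
have := nrmD (H z - p.[z]) (p.[z] - p.[0]); lra.
Qed.

Lemma poly_approx_onM k (H G : R[i] -> R[i]) : bounded_on k H -> bounded_on k G ->
  poly_approx_on k H -> poly_approx_on k G ->
  poly_approx_on k (fun z => H z * G z).
Proof.
move=> [B HB] [C GC] Ha Ga e e0.
have [k0|k0] := ltP k 0.
  by exists 0 => z zk; have := le_lt_trans (le_trans (nrm_ge0 z) zk) k0; rewrite ltxx.
have z0k : nrm (0 : R[i]) <= k by rewrite nrm0.
have B0 := le_trans (nrm_ge0 _) (HB _ z0k).
have C0 := le_trans (nrm_ge0 _) (GC _ z0k).
pose d := Num.min 1 (e / (B + C + 1)).
have D0 : 0 < B + C + 1 by lra.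
have d0 : 0 < d by rewrite lt_min ltr01 divr_gt0.
have d1 : d <= 1 by rewrite ge_min lexx.
have de : d * (B + C + 1) <= e by rewrite -ler_pdivlMr// ge_min lexx orbT.
have [p pP] := Ha _ d0; have [g gP] := Ga _ d0.
exists (p * g) => z zk; rewrite hornerM.
have -> : H z * G z - p.[z] * g.[z] =
    (H z - p.[z]) * G z + (H z - (H z - p.[z])) * (G z - g.[z]) by ring.
have := pP z zk; have := gP z zk; have := HB z zk; have := GC z zk => h1 h2 h3 h4.
apply: (le_trans (nrmD _ _)); rewrite !nrmM.
have h5 := nrmB (H z) (H z - p.[z]).
apply: (@le_trans _ _ (d * C + (B + d) * d)).
  by rewrite lerD// ler_pM ?nrm_ge0//; lra.
apply: le_trans de; rewrite !mulrDr !mulrDl mulr1 (mulrC B) addrA (addrC (d * C)).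
by rewrite lerD2l ler_piMr// ltW.
Qed.

Lemma bounded_onM k (H G : R[i] -> R[i]) : bounded_on k H -> bounded_on k G ->
  bounded_on k (fun z => H z * G z).
Proof.
move=> [B HB] [C GC]; exists (B * C) => z zk; rewrite nrmM.
by rewrite ler_pM ?nrm_ge0 ?HB ?GC.
Qed.

Lemma bounded_on_inv_XsubC (k : R) (a : R[i]) : k < nrm a ->
  bounded_on k (fun z => (z - a)^-1).
Proof.
move=> ka; exists ((nrm a - k)^-1) => z zk.
have ak : 0 < nrm a - k by lra.
rewrite nrmV lef_pV2 ?posrE//.
  by have := nrmB z (z - a); rewrite opprB addrC subrK; lra.
by apply: (lt_le_trans ak); have := nrmB z (z - a); rewrite opprB addrC subrK; lra.
Qed.

(** The geometric series of ratio [z / a], whose modulus stays below [k / nrm a] on the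
  disc. *)
Lemma poly_approx_inv_XsubC (k : R) (a : R[i]) : k < nrm a ->
  poly_approx_on k (fun z => (z - a)^-1).
Proof.
move=> ka e e0.
have [k0|k0] := ltP k 0.
  by exists 0 => z zk; have := le_lt_trans (le_trans (nrm_ge0 z) zk) k0; rewrite ltxx.
have [B invB] := bounded_on_inv_XsubC ka.
have na0 : 0 < nrm a by exact: le_lt_trans ka.
have a0 : a != 0 by rewrite -nrm_gt0.
have B0 : 0 <= B by apply: le_trans (nrm_ge0 _) (invB 0 _); rewrite nrm0.
pose t := k / nrm a.
have t1 : `|t| < 1 by rewrite ger0_norm ?divr_ge0 ?nrm_ge0// ltr_pdivrMr// mul1r.
have [N tN] : exists N, t ^+ N * B <= e.
  have B1 : 0 < e / (B + 1) by rewrite divr_gt0//; lra.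
  have /cvgrPdist_lt/(_ _ B1)[N _ /(_ N (leqnn N))] := cvg_expr t1.
  rewrite sub0r normrN ltr_pdivlMr; last by lra.
  move=> h; exists N; apply: ltW; apply: le_lt_trans h.
  have := normr_ge0 (t ^+ N); have := ler_norm (t ^+ N) => h1 h2.
  apply: (@le_trans _ _ (`|t ^+ N| * B)); first by rewrite ler_wpM2r.
  by rewrite ler_wpM2l//; lra.
exists (\poly_(i < N) (- a^-1 ^+ i.+1)) => z zk.
have za0 : z - a != 0.
  by rewrite subr_eq0; apply: contraTneq ka => <-; rewrite -leNgt.
set g := \poly_(i < N) _.
have -> : (z - a)^-1 - g.[z] = (z / a) ^+ N / (z - a).
  apply: (mulfI za0); rewrite mulrBr mulfV// mulrCA mulfV// mulr1.
  have -> : (z - a) * g.[z] = (z / a - 1) * - (\sum_(i < N) (z / a) ^+ i).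
    rewrite horner_poly -sumrN !mulr_sumr; apply: eq_bigr => i _.
    by rewrite expr_div_n exprS exprVn; field; rewrite a0 expf_neq0.
  by rewrite mulrN -subrX1 opprK; ring.
rewrite nrmM nrmX nrmM nrmV; apply: le_trans tN.
rewrite ler_pM ?invr_ge0 ?exprn_ge0 ?divr_ge0 ?nrm_ge0 ?invB//.
by rewrite lerXn2r ?nnegrE ?divr_ge0 ?nrm_ge0// ler_wpM2r// invr_ge0 nrm_ge0.
Qed.

(** The plane being algebraically closed, [p^-1] is a product of simple poles. *)
Lemma poly_approx_inv_poly p (k : R) : 0 <= k ->
  (forall z, nrm z <= k -> p.[z] != 0) -> poly_approx_on k (fun z => p.[z]^-1).
Proof.
move=> k0 pn0; have [rs pE] := closed_field_poly_normal p.
have rsk a : a \in rs -> k < nrm a.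
  move=> ars; rewrite ltNge; apply/negP => ak; have /negP := pn0 _ ak; apply.
  have : root (\prod_(z <- rs) ('X - z%:P)) a by rewrite root_prod_XsubC.
  by move=> /rootP h; rewrite pE hornerZ h mulr0.
have inv_rs (s : seq R[i]) : {subset s <= rs} ->
    poly_approx_on k (fun z => (\prod_(a <- s) ('X - a%:P)).[z]^-1) /\
    bounded_on k (fun z => (\prod_(a <- s) ('X - a%:P)).[z]^-1).
  elim: s => [_|a s IH ars].
    split; last by exists 1 => z _; rewrite big_nil hornerC invr1 nrm1.
    by move=> e e0; exists 1 => z _; rewrite big_nil hornerC invr1 subrr nrm0 ltW.
  have [|ap ab] := IH; first by move=> b bs; apply: ars; rewrite inE bs orbT.
  have ka : k < nrm a by apply/rsk/ars; rewrite inE eqxx.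
  have E : (fun z => (\prod_(a0 <- a :: s) ('X - a0%:P)).[z]^-1) =
      (fun z => (z - a)^-1 * (\prod_(a0 <- s) ('X - a0%:P)).[z]^-1).
    by apply/funext => z; rewrite big_cons hornerM hornerXsubC invfM.
  by rewrite E; split; [apply: poly_approx_onM | apply: bounded_onM] => //;
    [exact: bounded_on_inv_XsubC|exact: poly_approx_inv_XsubC|exact: bounded_on_inv_XsubC].
have [ap ab] := inv_rs rs (fun _ => id).
have E : (fun z => p.[z]^-1) =
    (fun z => (lead_coef p)^-1 * (\prod_(a0 <- rs) ('X - a0%:P)).[z]^-1).
  by apply/funext => z; rewrite [in LHS]pE hornerZ invfM.
rewrite E; apply: poly_approx_onM => //.
  by exists (nrm (lead_coef p)^-1).
by move=> e e0; exists (lead_coef p)^-1%:P => z _; rewrite hornerC subrr nrm0 ltW.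
Qed.

(** A polynomial close enough to [H] on a disc has no zero there, and its inverse is
  close to that of [H]. *)
Lemma poly_approx_inv (H : R[i] -> R[i]) : poly_approx H ->
  (forall z, 1 <= nrm (H z)) -> poly_approx (fun z => (H z)^-1).
Proof.
move=> Hp H1 k k0 e e0.
pose d := Num.min 2^-1 (e / 4).
have d0 : 0 < d by rewrite lt_min invr_gt0 ltr0n divr_gt0.
have d2 : d <= 2^-1 by rewrite ge_min lexx.
have de : d <= e / 4 by rewrite ge_min lexx orbT.
have [p pP] := Hp k k0 d d0.
have p2 z : nrm z <= k -> 2^-1 <= nrm p.[z].
  move=> zk; have := pP _ zk; have := H1 z.
  by have := nrmD (H z - p.[z]) p.[z]; rewrite subrK; lra.
have pn0 z : nrm z <= k -> p.[z] != 0.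
  by move=> zk; rewrite -nrm_gt0; have := p2 _ zk; lra.
have e2 : 0 < e / 2 by lra.
have [g gP] := poly_approx_inv_poly (ltW k0) pn0 e2.
exists g => z zk.
have Hn0 : H z != 0 by rewrite -nrm_gt0; have := H1 z; lra.
have -> : (H z)^-1 - g.[z] = ((H z)^-1 - p.[z]^-1) + (p.[z]^-1 - g.[z]) by ring.
apply: (le_trans (nrmD _ _)); have := gP _ zk.
suff : nrm ((H z)^-1 - p.[z]^-1) <= e / 2 by lra.
have -> : (H z)^-1 - p.[z]^-1 = - (H z - p.[z]) / (H z * p.[z]).
  by field; rewrite Hn0 pn0.
rewrite nrmM nrmV nrmM nrmN ler_pdivrMr; last first.
  by rewrite mulr_gt0// nrm_gt0// pn0.
have := pP _ zk; have := p2 _ zk; have := H1 z => h1 h2 h3.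
have : 2^-1 <= nrm (H z) * nrm p.[z].
  by rewrite -[leLHS]mul1r ler_pM//; lra.
move=> h4; apply: (le_trans h3); apply: (le_trans de).
rewrite [leLHS](_ : _ = e / 2 * 2^-1); last by field.
by rewrite ler_wpM2l//; lra.
Qed.

(** Liouville's theorem for [H], and for its inverse if the modulus never drops
  below [1]. *)
Lemma poly_approx_dichotomy (H : R[i] -> R[i]) u v : poly_approx H ->
  H u <> H v -> (exists z, nrm (H z) < 1) /\ (exists z, 1 < nrm (H z)).
Proof.
move=> Hp uv; split; apply: contrapT => /forallNP h; apply: uv.
  have H1 z : 1 <= nrm (H z) by rewrite leNgt; apply/negP/h.
  have Hi := liouville (poly_approx_inv Hp H1) (B := 1) (fun z =>
    ltac:(rewrite nrmV invf_le1 ?H1//; exact: lt_le_trans ltr01 (H1 z))).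
  by apply: invr_inj; rewrite (Hi u) (Hi v).
have H1 z : nrm (H z) <= 1 by rewrite leNgt; apply/negP/h.
by rewrite (liouville Hp H1 u) (liouville Hp H1 v).
Qed.

End Liouville.

(** * The complex exponential *)

Section Exponential.
Context {R : realType}.
Implicit Types (z w : R[i]) (t : R).

(** The remainder of the real exponential series, in terms of which all the errors
  of exponential sums are expressed. *)
Definition exp_tail t (M : nat) : R := expR t - \sum_(m < M) t ^+ m / m`!%:R.

Lemma exp_tailE t M : exp_tail t M = expR t - series (exp_coeff t) M.
Proof. by rewrite /exp_tail /series/= big_mkord. Qed.

Lemma sum_exp_le_tail t M N : 0 <= t ->
  \sum_(M <= m < N) t ^+ m / m`!%:R <= exp_tail t M.
Proof.
move=> t0; have [MN|NM] := leqP M N; last first.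
  rewrite big_geq ?(ltnW NM)// exp_tailE subr_ge0.
  by apply: nondecreasing_cvgn_le; [exact: nondecreasing_series
    (fun n _ _ => exp_coeff_ge0 n t0)|exact: is_cvg_series_exp_coeff].
rewrite exp_tailE lerBrDl /series/= -big_cat_nat//=.
apply: (@nondecreasing_cvgn_le _ (series (exp_coeff t))).
  exact: nondecreasing_series (fun n _ _ => exp_coeff_ge0 n t0).
exact: is_cvg_series_exp_coeff.
Qed.

Lemma exp_tail_ge0 t M : 0 <= t -> 0 <= exp_tail t M.
Proof. by move=> t0; have := sum_exp_le_tail M M t0; rewrite big_geq. Qed.

Lemma exp_tail_lt t e : 0 < e -> exists N, forall M, (N <= M)%N -> exp_tail t M < e.
Proof.
move=> e0; have /cvgrPdist_lt/(_ e e0)[N _ NP] := is_cvg_series_exp_coeff t.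
by exists N => M /NP; apply: le_lt_trans; rewrite exp_tailE ler_norm.
Qed.

Lemma nrm_exp_sum z t M N : nrm z <= t ->
  nrm (\sum_(M <= m < N) z ^+ m / m`!%:R) <= \sum_(M <= m < N) t ^+ m / m`!%:R.
Proof.
move=> zt; rewrite (le_trans (nrm_sum _ _ _))//; apply: ler_sum => m _.
by rewrite nrmM nrmV nrm_nat nrmX ler_wpM2r ?invr_ge0// lerXn2r ?nnegrE ?nrm_ge0//
  (le_trans (nrm_ge0 z)).
Qed.

Definition cexp z : R[i] :=
  xget 0 [set l | seqlim (fun M => \sum_(m < M) z ^+ m / m`!%:R) l].

Lemma cexp_lim z : seqlim (fun M => \sum_(m < M) z ^+ m / m`!%:R) (cexp z).
Proof.
rewrite /cexp; case: xgetP => [l _ //|noL]; exfalso.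
have [] := seqlim_complete (u := fun M => \sum_(m < M) z ^+ m / m`!%:R).
  move=> e e0; have [N NP] := exp_tail_lt (nrm z) e0.
  have cN m n : (N <= m)%N -> (m <= n)%N ->
      nrm (\sum_(i < m) z ^+ i / i`!%:R - \sum_(i < n) z ^+ i / i`!%:R) < e.
    move=> Nm mn; rewrite nrm_distC -!(big_mkord xpredT (fun i => z ^+ i / i`!%:R)).
    rewrite (big_cat_nat _ mn)//= addrAC subrr add0r.
    apply: le_lt_trans (NP m Nm); apply: le_trans (nrm_exp_sum _ _ (lexx _)) _.
    exact: sum_exp_le_tail (nrm_ge0 z).
  exists N => m n Nm Nn; have [mn|/ltnW nm] := leqP m n; first exact: cN.
  by rewrite nrm_distC; exact: cN.
by move=> l /noL.
Qed.

Lemma seqlim_le (V : normedModType R[i]) (u : nat -> V) l a B : seqlim u l ->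
  (exists N, forall n, (N <= n)%N -> nrm (u n - a) <= B) -> nrm (l - a) <= B.
Proof.
move=> ul [N uB]; apply/ler_addgt0Pr => e e0; have [N' N'P] := ul e e0.
have := N'P _ (leq_maxr N N'); have := uB _ (leq_maxl N N').
set x := u _; have := nrmB (x - a) (x - l); rewrite opprB addrC addrA subrK; lra.
Qed.

Lemma cexp_tail z t M : nrm z <= t ->
  nrm (cexp z - \sum_(m < M) z ^+ m / m`!%:R) <= exp_tail t M.
Proof.
move=> zt; apply: (seqlim_le (cexp_lim z)); exists M => n Mn.
rewrite -!(big_mkord xpredT (fun i => z ^+ i / i`!%:R)).
rewrite (big_cat_nat _ Mn)//= addrAC subrr add0r.
apply: le_trans (nrm_exp_sum _ _ zt) _.
exact: sum_exp_le_tail (le_trans (nrm_ge0 z) zt).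
Qed.

Lemma cexp0 : cexp 0 = 1.
Proof.
apply: (seqlim_uniq (cexp_lim 0)) => e e0; exists 1%N => -[//|n] _.
rewrite big_ord_recl expr0 fact0 divr1 big1 ?addr0 ?subrr ?nrm0// => i _.
by rewrite expr0n mul0r.
Qed.

End Exponential.

Section ExponentialLaw.

(** The binomial theorem, summed over the degrees. *)
Lemma triangular_exp_sum (F : numFieldType) (x y : F) M :
  \sum_(m < M) (x + y) ^+ m / m`!%:R =
  \sum_(i < M) \sum_(j < M | (i + j < M)%N) (x ^+ i / i`!%:R) * (y ^+ j / j`!%:R).
Proof.
have fn0 n : n`!%:R != 0 :> F by rewrite pnatr_eq0 -lt0n fact_gt0.
elim: M => [|M IH]; first by rewrite !big_ord0.
rewrite big_ord_recr /= IH [RHS]big_ord_recr/=.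
have -> : \sum_(j < M.+1 | (M + j < M.+1)%N) x ^+ M / M`!%:R * (y ^+ j / j`!%:R) =
    x ^+ M / M`!%:R * (y ^+ 0 / 0`!%:R).
  rewrite (bigD1 ord0)/=; last by rewrite addn0.
  by rewrite big1 ?addr0// => j /andP[]; rewrite -val_eqE/=; lia.
have -> : \sum_(i < M) \sum_(j < M.+1 | (i + j < M.+1)%N)
      x ^+ i / i`!%:R * (y ^+ j / j`!%:R) =
    \sum_(i < M) (\sum_(j < M | (i + j < M)%N) x ^+ i / i`!%:R * (y ^+ j / j`!%:R)
      + x ^+ i / i`!%:R * (y ^+ (M - i) / (M - i)`!%:R)).
  apply: eq_bigr => i _.
  have iM : (M - i < M.+1)%N by lia.
  rewrite (bigD1 (Ordinal iM))/=; last by have := ltn_ord i; lia.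
  rewrite addrC; congr (_ + _).
  rewrite [RHS](big_ord_widen_cond M.+1 (fun j => i + j < M)%N
    (fun j => x ^+ i / i`!%:R * (y ^+ j / j`!%:R)))//.
  by apply: eq_bigl => j; rewrite -val_eqE/=; have := ltn_ord i; lia.
rewrite big_split/= -addrA; congr (_ + _).
rewrite (addrC x y) exprDn big_ord_recr/= subnn mulrDl; congr (_ + _); last first.
  by rewrite binn mulr1n !expr0 mul1r fact0 divr1 mulr1.
rewrite mulr_suml; apply: eq_bigr => i _.
have iM : (i <= M)%N by exact: ltnW.
have := congr1 (fun n => n%:R : F) (bin_fact iM); rewrite !natrM => <-.
by rewrite -mulr_natl; field; rewrite !fn0 pnatr_eq0 -lt0n bin_gt0.
Qed.

Lemma seqlimM (R : realType) (u v : nat -> R[i]) a b :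
  seqlim u a -> seqlim v b -> seqlim (fun n => u n * v n) (a * b).
Proof.
move=> ua vb e e0.
pose d := Num.min 1 (e / (nrm a + nrm b + 2)).
have D0 : 0 < nrm a + nrm b + 2 by have := nrm_ge0 a; have := nrm_ge0 b; lra.
have d0 : 0 < d by rewrite lt_min ltr01 divr_gt0.
have d1 : d <= 1 by rewrite ge_min lexx.
have de : d * (nrm a + nrm b + 2) <= e by rewrite -ler_pdivlMr// ge_min lexx orbT.
have [N NP] := ua d d0; have [N' NP'] := vb d d0.
exists (maxn N N') => n; rewrite geq_max => /andP[/NP h1 /NP' h2].
have -> : u n * v n - a * b = (u n - a) * (v n - b) + ((u n - a) * b + a * (v n - b)).
  by ring.
apply: (le_lt_trans (nrmD _ _)).
have := nrmD ((u n - a) * b) (a * (v n - b)); rewrite !nrmM => h3.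
have : nrm (u n - a) * nrm (v n - b) <= d * 1.
  by rewrite ler_pM ?nrm_ge0// ?ltW// (lt_le_trans h2).
have : nrm (u n - a) * nrm b <= d * nrm b by rewrite ler_wpM2r ?nrm_ge0// ltW.
have : nrm a * nrm (v n - b) <= d * nrm a by rewrite mulrC ler_wpM2r ?nrm_ge0// ltW.
have := nrm_ge0 a; have := nrm_ge0 b; nra.
Qed.

(** The terms of the product of two partial sums that lie outside the triangle are
  dominated by the corresponding terms for the moduli, for which the law of the real
  exponential shows that they tend to zero. *)
Lemma cexpD (R : realType) (z w : R[i]) : cexp (z + w) = cexp z * cexp w.
Proof.
pose S (F : numFieldType) (x : F) M : F := \sum_(m < M) x ^+ m / m`!%:R.
apply: (seqlim_uniq (u := fun M => S _ z M * S _ w M)); last first.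
  by apply: seqlimM; exact: cexp_lim.
move=> e e0; have e2 : 0 < e / 2 by lra.
have [N1 N1P] := cexp_lim (z + w) e2.
pose v M := S R (nrm z) M * S R (nrm w) M - S R (nrm z + nrm w) M.
have : v @ \oo --> expR (nrm z) * expR (nrm w) - expR (nrm z + nrm w).
  have cS t : S R t @ \oo --> expR t.
    have -> : S R t = series (exp_coeff t).
      by apply/funext => M; rewrite /S /series/= big_mkord.
    exact: is_cvg_series_exp_coeff.
  by apply: cvgB; [apply: cvgM|]; exact: cS.
rewrite expRD subrr => /cvgrPdist_lt/(_ _ e2)[N2 _ N2P].
exists (maxn N1 N2) => M; rewrite geq_max => /andP[/N1P h1 /N2P h2].
have E (F : numFieldType) (x y : F) : S F x M * S F y M - S F (x + y) M =
    \sum_(i < M) \sum_(j < M | ~~ (i + j < M)%N) (x ^+ i / i`!%:R) * (y ^+ j / j`!%:R).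
  rewrite /S triangular_exp_sum mulr_suml -sumrB; apply: eq_bigr => i _.
  by rewrite mulr_sumr (bigID (fun j : 'I_M => (i + j < M)%N))/= addrAC subrr add0r.
have : nrm (S _ z M * S _ w M - S _ (z + w) M) <= v M.
  rewrite E /v E (le_trans (nrm_sum _ _ _))//; apply: ler_sum => i _.
  rewrite (le_trans (nrm_sum _ _ _))//; apply: ler_sum => j _.
  by rewrite !nrmM !nrmV !nrmX !nrm_nat.
move: h2; rewrite sub0r normrN => /(le_lt_trans (ler_norm _)) h2 h3.
have := nrmD (S _ z M * S _ w M - S _ (z + w) M) (S _ (z + w) M - cexp (z + w)).
by rewrite addrA subrK -/(S _ (z + w) M) in h1 *; lra.
Qed.

End ExponentialLaw.

(** * Approximation numbers and Lorentz sequence spaces *)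

Section ApproximationNumbers.
Context {R : realType} {X : normedModType R[i]}.
Implicit Types (x y : nat -> X) (c : R).

Definition bounded_seq x : Prop := exists C : R, forall j, nrm (x j) <= C.

Lemma seq_norm_le x c : (forall j, nrm (x j) <= c) -> (seq_norm x <= c%:E)%E.
Proof. by move=> xc; apply: ge_ereal_sup => _ [j _ <-]; rewrite lee_fin. Qed.

Lemma seq_norm_ge x j : ((nrm (x j))%:E <= seq_norm x)%E.
Proof. by apply: ereal_sup_ubound; exists j. Qed.

Lemma seq_norm_ltyP x : (seq_norm x < +oo)%E <-> bounded_seq x.
Proof.
split=> [xoo|[C xC]]; last exact: le_lt_trans (seq_norm_le xC) (ltry _).
exists (fine (seq_norm x)) => j; rewrite -lee_fin fineK ?seq_norm_ge//.
by rewrite fin_numElt xoo andbT (lt_le_trans _ (seq_norm_ge x 0))// ltNyr.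
Qed.

Definition approx_real n x : R := fine (approx_number n x).

Lemma approx_number_ge0 n x : (0 <= approx_number n x)%E.
Proof.
apply: le_ereal_inf_tmp => _ [u _ <-].
by apply: le_trans (seq_norm_ge _ 0); rewrite lee_fin nrm_ge0.
Qed.

Lemma approx_real_ge0 n x : 0 <= approx_real n x.
Proof. exact/fine_ge0/approx_number_ge0. Qed.

Lemma approx_number_le n x c (t : seq nat) : 0 <= c -> (size t < n)%N ->
  (forall j, j \notin t -> nrm (x j) <= c) -> (approx_number n x <= c%:E)%E.
Proof.
move=> c0 tn xc.
pose u j := if j \in t then x j else 0.
apply: (@le_trans _ _ (seq_norm (fun j => x j - u j))).
  apply: ereal_inf_lbound; exists u => //; exists t; split => // j.
  by rewrite /u => /negbTE ->.
apply: seq_norm_le => j; rewrite /u; case: ifPn => jt.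
  by rewrite subrr nrm0.
by rewrite subr0 xc.
Qed.

Lemma approx_real_le n x c (t : seq nat) : 0 <= c -> (size t < n)%N ->
  (forall j, j \notin t -> nrm (x j) <= c) -> approx_real n x <= c.
Proof.
move=> c0 tn xc; have := approx_number_le c0 tn xc.
rewrite /approx_real; have := approx_number_ge0 n x.
by case: (approx_number n x).
Qed.

Lemma approx_realE n x : bounded_seq x -> (0 < n)%N ->
  approx_number n x = (approx_real n x)%:E.
Proof.
move=> [C xC] n0; rewrite fineK// ge0_fin_numE ?approx_number_ge0//.
apply: le_lt_trans (ltry C); apply: (@approx_number_le n x C [::]) => //.
exact: le_trans (nrm_ge0 _) (xC 0).
Qed.

(** A set of at least [n] terms always keeps one that is not removed. *)
Lemma approx_real_ge n x c (J : seq nat) : bounded_seq x -> (0 < n)%N ->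
  uniq J -> (n <= size J)%N -> (forall j, j \in J -> c <= nrm (x j)) ->
  c <= approx_real n x.
Proof.
move=> bx n0 uJ nJ xJ; rewrite -lee_fin -approx_realE//.
apply: le_ereal_inf_tmp => _ [u [t [tn ut]] <-].
have [j /andP[jJ jt]] : exists j, (j \in J) && (j \notin t).
  apply: contrapT => /forallNP h.
  have : (size J <= size t)%N.
    by apply: uniq_leq_size => // j jJ; apply/negPn/negP => jt; apply: (h j); rewrite jJ.
  by rewrite leqNgt (leq_trans tn nJ).
apply: le_trans (seq_norm_ge _ j); rewrite lee_fin ut// subr0; exact: xJ.
Qed.

Lemma approx_real_lt n x c : bounded_seq x -> (0 < n)%N -> approx_real n x < c ->
  exists t : seq nat, (size t < n)%N /\ forall j, j \notin t -> nrm (x j) < c.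
Proof.
move=> bx n0; rewrite -lte_fin -approx_realE// => /ereal_inf_lt[_ [u [t [tn ut]] <-] h].
exists t; split=> // j jt; rewrite -lte_fin; apply: le_lt_trans h.
by apply: le_trans (seq_norm_ge _ j); rewrite lee_fin ut// subr0.
Qed.

(** If fewer than [n] terms exceeded [c] in norm, removing them would make the
  [n]-th approximation number at most [c]. *)
Lemma approx_real_gt n x c : 0 <= c -> c < approx_real n x ->
  exists J : seq nat, [/\ uniq J, size J = n & forall j, j \in J -> c < nrm (x j)].
Proof.
move=> c0 cx.
suff : forall m, (m <= n)%N -> exists J : seq nat,
    [/\ uniq J, size J = m & forall j, j \in J -> c < nrm (x j)].
  by move=> /(_ n (leqnn n)).
elim=> [_|m IH mn]; first by exists [::].
have [J [uJ sJ xJ]] := IH (ltnW mn).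
have [j /andP[jJ xj]] : exists j, (j \notin J) && (c < nrm (x j)).
  apply: contrapT => /forallNP h; move: cx; rewrite ltNge => /negP; apply.
  apply: (@approx_real_le n x c J) => //; first by rewrite sJ.
  by move=> j jJ; rewrite leNgt; apply/negP => xj; apply: (h j); rewrite jJ.
exists (j :: J); split => /=; rewrite ?jJ ?sJ//.
by move=> i; rewrite inE => /orP[/eqP ->//|/xJ].
Qed.

Lemma approx_real_sup x n C : (forall j, nrm (x j) <= C) -> (0 < n)%N ->
  approx_real n x <= C.
Proof.
move=> xC n0; apply: (@approx_real_le n x C [::]) => //.
exact: le_trans (nrm_ge0 _) (xC 0).
Qed.

End ApproximationNumbers.

Section ComparisonOfApproximationNumbers.
Context {R : realType} {X Y Z : normedModType R[i]}.

Lemma bounded_seq_dom (x : nat -> X) (y : nat -> Y) (c : R) : 0 <= c ->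
  bounded_seq x -> (forall j, nrm (y j) <= c * nrm (x j)) -> bounded_seq y.
Proof.
by move=> c0 [C xC] yx; exists (c * C) => j; rewrite (le_trans (yx j))// ler_wpM2l.
Qed.

Lemma approx_real_dom (x : nat -> X) (y : nat -> Y) (c : R) n : 0 <= c ->
  bounded_seq x -> (0 < n)%N -> (forall j, nrm (y j) <= c * nrm (x j)) ->
  approx_real n y <= c * approx_real n x.
Proof.
move=> c0 bx n0 yx; apply/ler_addgt0Pr => e e0.
have d0 : 0 < e / (c + 1) by rewrite divr_gt0// ltr_wpDl.
have [|t [tm xt]] := @approx_real_lt _ _ n x (approx_real n x + e / (c + 1)) bx n0.
  by rewrite ltrDl.
apply: (@approx_real_le _ _ n y _ t) => //.
  by rewrite addr_ge0 ?(ltW e0)// mulr_ge0// approx_real_ge0.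
move=> j /xt xj; apply: (le_trans (yx j)).
apply: (@le_trans _ _ (c * (approx_real n x + e / (c + 1)))).
  by rewrite ler_wpM2l// ltW.
rewrite mulrDr lerD2l mulrCA ler_piMr ?(ltW e0)// ler_pdivrMr; last lra.
by rewrite mul1r; lra.
Qed.

(** The common form of the quasi-triangle inequality, for sums and for
  interleavings: omitting [k - 1] terms of each of [x] and [y] omits at most
  [2 k - 2 < m] terms of [z]. *)
Lemma approx_real_half (x : nat -> X) (y : nat -> Y) (z : nat -> Z) m :
  bounded_seq x -> bounded_seq y -> (0 < m)%N ->
  (forall s t : seq nat, exists2 w : seq nat, (size w <= size s + size t)%N &
     forall (c d : R), (forall j, j \notin s -> nrm (x j) <= c) ->
       (forall j, j \notin t -> nrm (y j) <= d) ->
       forall j, j \notin w -> nrm (z j) <= c + d) ->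
  approx_real m z <= approx_real (uphalf m) x + approx_real (uphalf m) y.
Proof.
move=> bx b_y m0 H; apply/ler_addgt0Pr => e e0.
have k0 : (0 < uphalf m)%N by case: m m0.
have e2 : 0 < e / 2 by lra.
have [|s [sm xs]] := @approx_real_lt _ _ (uphalf m) x (approx_real (uphalf m) x + e / 2) bx k0.
  by rewrite ltrDl.
have [|t [tm yt]] := @approx_real_lt _ _ (uphalf m) y (approx_real (uphalf m) y + e / 2) b_y k0.
  by rewrite ltrDl.
have [w ws zw] := H s t.
have -> : approx_real (uphalf m) x + approx_real (uphalf m) y + e =
  (approx_real (uphalf m) x + e / 2) + (approx_real (uphalf m) y + e / 2) by lra.
apply: (@approx_real_le _ _ m z _ w).
- by rewrite !addr_ge0 ?approx_real_ge0// ltW.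
- apply: (leq_ltn_trans ws); rewrite -(odd_double_half m) in sm tm *.
  by move: sm tm; rewrite uphalfE -addnn; case: (odd m) m0 => /=; lia.
- by apply: zw => j jn; apply: ltW; [exact: xs|exact: yt].
Qed.

End ComparisonOfApproximationNumbers.

Section LorentzSums.
Context {R : realType}.
Implicit Types (u v c B e : R) (n N : nat).

Lemma nneseries_leP (f : nat -> \bar R) m (B : \bar R) :
  (forall n, (m <= n)%N -> (0 <= f n)%E) ->
  ((\sum_(m <= n <oo) f n <= B)%E <->
   forall N, (\sum_(m <= n < N) f n <= B)%E).
Proof.
move=> f0; split=> [fB N|fB].
  by apply: le_trans fB; apply: nneseries_lim_ge => n mn _; exact: f0.
apply: lime_le; first by apply: is_cvg_nneseries => n mn _; exact: f0.
by apply: nearW => N; exact: fB.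
Qed.

Definition lorentz_weight u v n : R := n%:R `^ (v / u - 1).

Definition lorentz_sum (X : normedModType R[i]) u v (x : nat -> X) N : R :=
  \sum_(1 <= n < N) lorentz_weight u v n * approx_real n x `^ v.

Lemma lorentz_weight_ge0 u v n : 0 <= lorentz_weight u v n.
Proof. exact: powR_ge0. Qed.

Lemma lorentz_weight_ge1 u v n : 0 < u -> u <= v -> (0 < n)%N ->
  1 <= lorentz_weight u v n.
Proof.
move=> u0 uv n0; rewrite -[leLHS](powRr0 (n%:R : R)) ler_powR//.
  by rewrite ler1n.
by rewrite subr_ge0 ler_pdivlMr// mul1r.
Qed.

Lemma lorentz_sum_term_ge0 (X : normedModType R[i]) u v (x : nat -> X) n :
  0 <= lorentz_weight u v n * approx_real n x `^ v.
Proof. by rewrite mulr_ge0// ?lorentz_weight_ge0// powR_ge0. Qed.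

Lemma lorentz_sum_ge0 (X : normedModType R[i]) u v (x : nat -> X) N :
  0 <= lorentz_sum u v x N.
Proof. by apply: sumr_ge0 => n _; exact: lorentz_sum_term_ge0. Qed.

Lemma lorentz_sum_nd (X : normedModType R[i]) u v (x : nat -> X) M N :
  (M <= N)%N -> lorentz_sum u v x M <= lorentz_sum u v x N.
Proof.
move=> MN; have [M1|M1] := leqP M 1.
  by rewrite [leLHS]/lorentz_sum big_geq// lorentz_sum_ge0.
rewrite /lorentz_sum (big_cat_nat _ MN)//=; last exact: ltnW.
by rewrite lerDl sumr_ge0// => n _; exact: lorentz_sum_term_ge0.
Qed.

Section OneSequence.
Context {X : normedModType R[i]}.
Implicit Types x y : nat -> X.

(** The quasi-norms only enter through the boundedness of partial sums, which keeps
  the extended reals out of the estimates. *)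
Lemma lorentz_norm_leP u v x c : bounded_seq x -> 0 < v -> 0 <= c ->
  (lorentz_norm u v x <= c%:E)%E <-> forall N, lorentz_sum u v x N <= c `^ v.
Proof.
move=> bx v0 c0.
pose f n := (((n%:R `^ (u^-1 - v^-1))%:E * approx_number n x) `^ v)%E.
have fE n : (0 < n)%N -> f n = (lorentz_weight u v n * approx_real n x `^ v)%:E.
  move=> n0; rewrite /f approx_realE// -EFinM poweR_EFin powRM ?powR_ge0 ?approx_real_ge0//.
  by rewrite -powRrM mulrBl mulVf ?gt_eqF// (mulrC u^-1).
have f0 n : (1 <= n)%N -> (0 <= f n)%E.
  by move=> n0; rewrite fE// lee_fin lorentz_sum_term_ge0.
have sE N : (\sum_(1 <= n < N) f n)%E = (lorentz_sum u v x N)%:E.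
  by rewrite /lorentz_sum -sumEFin; apply: eq_big_nat => n /andP[n1 _]; exact: fE.
have v0' : 0 <= v^-1 by rewrite invr_ge0 ltW.
have cv : (c `^ v) `^ v^-1 = c by rewrite -powRrM divff ?gt_eqF// powRr1.
rewrite (_ : lorentz_norm u v x = ((\sum_(1 <= n <oo) f n) `^ v^-1)%E)//.
have S0 : (0 <= \sum_(1 <= n <oo) f n)%E by apply: nneseries_ge0 => n n1 _; exact: f0.
have -> : ((\sum_(1 <= n <oo) f n) `^ v^-1 <= c%:E)%E <->
    (\sum_(1 <= n <oo) f n <= (c `^ v)%:E)%E.
  split; last first.
    move=> /(gt0_ler_poweR v0'); rewrite poweR_EFin cv; apply.
      by rewrite in_itv/= S0 leey.
    by rewrite in_itv/= lee_fin powR_ge0 leey.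
  case: (\sum_(1 <= n <oo) f n)%E S0 => [s| |]// s0; last first.
    by rewrite poweRyr ?invr_eq0 ?gt_eqF.
  rewrite poweR_EFin !lee_fin.
  move=> /(ge0_ler_powR (ltW v0)); rewrite !nnegrE powR_ge0 c0 => /(_ erefl erefl).
  by rewrite -powRrM mulVf ?gt_eqF// powRr1.
rewrite (nneseries_leP _ f0); split=> h N; first by rewrite -lee_fin -sE.
by rewrite sE lee_fin.
Qed.

Lemma lorentz_norm_ge0 u v x : (0 <= lorentz_norm u v x)%E.
Proof. exact: poweR_ge0. Qed.

Lemma lorentzP u v x : 0 < v -> lorentz u v x <->
  bounded_seq x /\ exists B, forall N, lorentz_sum u v x N <= B.
Proof.
move=> v0; split=> [[/seq_norm_ltyP bx nx]|[bx [B xB]]].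
  split=> //; exists (fine (lorentz_norm u v x) `^ v) => N.
  move: N; apply/lorentz_norm_leP => //; first exact/fine_ge0/lorentz_norm_ge0.
  by rewrite fineK// ge0_fin_numE// lorentz_norm_ge0.
split; first exact/seq_norm_ltyP.
have B0 : 0 <= B := le_trans (lorentz_sum_ge0 u v x 0) (xB 0).
apply: le_lt_trans (ltry (B `^ v^-1)); apply/lorentz_norm_leP => //.
  exact: powR_ge0.
by move=> N; rewrite -powRrM mulVf ?gt_eqF// powRr1.
Qed.

(** The sequence space lies in [l_v]: the [i]-th largest of finitely many terms
  is at most the [i]-th approximation number. *)
Lemma sum_powR_le_lorentz_sum u v x K : 0 < u -> u <= v -> bounded_seq x ->
  \sum_(j < K) nrm (x j) `^ v <= lorentz_sum u v x K.+1.
Proof.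
move=> u0 uv bx; have v0 : 0 < v := lt_le_trans u0 uv.
pose leT i j := nrm (x j) <= nrm (x i).
pose J := sort leT (iota 0 K).
have tot : total leT by move=> i j; exact: le_total.
have trl : transitive leT by move=> i j k ij ik; exact: le_trans ik ij.
have sJ : size J = K by rewrite size_sort size_iota.
have uJ : uniq J by rewrite sort_uniq iota_uniq.
have stJ : sorted leT J by exact: sort_sorted.
rewrite -(big_mkord xpredT (fun j => nrm (x j) `^ v)) /index_iota subn0.
rewrite -(perm_big _ (permEl (perm_sort leT (iota 0 K)))) -/J (big_nth 0%N) sJ.
rewrite /lorentz_sum big_add1/= !big_mkord; apply: ler_sum => i _.
rewrite -[leLHS]mul1r ler_pM ?powR_ge0 ?lorentz_weight_ge1//.
apply: ge0_ler_powR; rewrite ?nnegrE ?nrm_ge0 ?approx_real_ge0 ?(ltW v0)//.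
apply: (@approx_real_ge _ _ _ _ _ (take i.+1 J)) => //.
- exact: take_uniq.
- by rewrite size_takel// sJ.
move=> j /(nthP 0%N)[k]; rewrite size_takel ?sJ// => ki <-.
rewrite nth_take//.
apply: (@sorted_leq_nth _ leT trl _ 0%N J stJ k i).
- by move=> a; exact: lexx.
- by rewrite inE sJ; apply: leq_trans ki _.
- by rewrite inE sJ.
- by [].
Qed.

End OneSequence.

(** Every [k] is [uphalf n] for two values of [n]. *)
Lemma sum_uphalf_le (g : nat -> R) M : (forall n, 0 <= g n) ->
  \sum_(1 <= n < M) g (uphalf n) <= 2 * \sum_(1 <= n < M) g n.
Proof.
move=> g0.
have H k : \sum_(1 <= n < k.*2.+1) g (uphalf n) = 2 * \sum_(1 <= n < k.+1) g n.
  elim: k => [|k IH]; first by rewrite !big_geq// mulr0.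
  rewrite doubleS big_nat_recr//= big_nat_recr//= IH (big_nat_recr k.+1)//= mulrDr.
  by rewrite /= doubleK uphalf_double; ring.
have [M0|M0] := posnP M; first by rewrite M0 !big_geq// mulr0.
rewrite -(prednK M0); set m := M.-1.
rewrite -(odd_double_half m); case: (odd m).
+ rewrite add1n big_nat_recr//= H.
  have -> : \sum_(1 <= n < (m./2).*2.+2) g n = \sum_(1 <= n < m./2.+2) g n + \sum_(m./2.+2 <= n < (m./2).*2.+2) g n.
    by rewrite -big_cat_nat//=; rewrite -addnn; lia.
  have -> : \sum_(1 <= n < m./2.+2) g n = \sum_(1 <= n < m./2.+1) g n + g m./2.+1.
    by rewrite big_nat_recr.
  rewrite /= doubleK.
  have : 0 <= \sum_(m./2.+2 <= n < (m./2).*2.+2) g n by apply: sumr_ge0.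
  by have := g0 m./2.+1; rewrite ?add1n; lra.
+ rewrite add0n H ler_wpM2l//.
  rewrite [leRHS](@big_cat_nat _ _ _ m./2.+1)//=; last by rewrite -addnn; lia.
  by rewrite lerDl; apply: sumr_ge0.
Qed.

(** [n <= 2 (uphalf n)], so doubling the indices costs a constant. *)
Lemma lorentz_sum_half (X Y Z : normedModType R[i]) u v (x : nat -> X)
    (y : nat -> Y) (z : nat -> Z) N : 0 < u -> u <= v ->
  (forall m, (0 < m)%N ->
     approx_real m z <= approx_real (uphalf m) x + approx_real (uphalf m) y) ->
  lorentz_sum u v z N <=
    2 * 2 `^ (v / u - 1) * 2 `^ v * (lorentz_sum u v x N + lorentz_sum u v y N).
Proof.
move=> u0 uv zxy; have v0 : 0 < v := lt_le_trans u0 uv.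
have b0 : 0 <= v / u - 1 by rewrite subr_ge0 ler_pdivlMr// mul1r.
pose g n := lorentz_weight u v n * (approx_real n x `^ v + approx_real n y `^ v).
have g0 n : 0 <= g n by rewrite mulr_ge0 ?lorentz_weight_ge0 ?addr_ge0 ?powR_ge0.
have sum_half := @sum_uphalf_le g N g0.
have -> : lorentz_sum u v x N + lorentz_sum u v y N = \sum_(1 <= n < N) g n.
  by rewrite -big_split/=; apply: eq_bigr => n _; rewrite -mulrDr.
apply: (@le_trans _ _ (2 `^ (v / u - 1) * 2 `^ v * \sum_(1 <= n < N) g (uphalf n))); last first.
  set a := 2 `^ _; set b := 2 `^ v.
  have -> : 2 * a * b * (\sum_(1 <= n < N) g n) = a * b * (2 * \sum_(1 <= n < N) g n).
    by ring.
  by rewrite ler_wpM2l// mulr_ge0// powR_ge0.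
rewrite mulr_sumr /lorentz_sum !big_nat; apply: ler_sum => n /andP[n1 _].
have zn := zxy _ n1; set a := approx_real (uphalf n) x in zn *.
rewrite /g -/a; set b := approx_real (uphalf n) y in zn *.
have a0 : 0 <= a by exact: approx_real_ge0.
have b0' : 0 <= b by exact: approx_real_ge0.
rewrite mulrACA; apply: ler_pM; rewrite ?powR_ge0//.
  rewrite -powRM//; apply: ge0_ler_powR; rewrite ?nnegrE ?mulr_ge0//.
  rewrite -natrM ler_nat -[leqLHS](odd_double_half n) uphalf_half -addnn.
  by case: (odd n) => /=; lia.
apply: (@le_trans _ _ ((2 * Num.max a b) `^ v)).
  apply: ge0_ler_powR; rewrite ?nnegrE ?approx_real_ge0 ?(ltW v0)//.
    by rewrite mulr_ge0// le_max a0.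
  by apply: (le_trans zn); rewrite maxEle; case: ifPn => ab; lra.
rewrite powRM ?le_max ?a0// ler_wpM2l ?powR_ge0//.
by rewrite maxEle; case: ifPn => ab; rewrite ?lerDl ?lerDr powR_ge0.
Qed.

Lemma lorentz_sum_dom (X Y : normedModType R[i]) u v (x : nat -> X)
    (y : nat -> Y) c N : 0 < v -> 0 <= c -> bounded_seq x ->
  (forall j, nrm (y j) <= c * nrm (x j)) ->
  lorentz_sum u v y N <= c `^ v * lorentz_sum u v x N.
Proof.
move=> v0 c0 bx yx; rewrite /lorentz_sum mulr_sumr !big_nat.
apply: ler_sum => n /andP[n1 _]; rewrite mulrCA ler_wpM2l ?lorentz_weight_ge0//.
rewrite -powRM ?approx_real_ge0//; apply: ge0_ler_powR; rewrite ?nnegrE ?(ltW v0)//.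
- exact: approx_real_ge0.
- by rewrite mulr_ge0 ?approx_real_ge0.
exact: approx_real_dom.
Qed.

End LorentzSums.

Section LorentzTails.
Context {R : realType}.
Implicit Types (u v c B e : R) (n N : nat).

Lemma bounded_nd_cauchy (S : nat -> R) B e : 0 < e ->
  (forall M N, (M <= N)%N -> S M <= S N) -> (forall N, S N <= B) ->
  exists M, forall N, (M <= N)%N -> S N - S M <= e.
Proof.
move=> e0 Snd SB; pose A := range S.
have hA : has_sup A by split; [exists (S 0%N), 0%N|exists B => _ [N _ <-]].
have [_ [M _ <-] hM] := sup_adherent e0 hA.
exists M => N _; have AN : A (S N) by exists N.
by have := sup_upper_bound hA AN; lra.
Qed.

(** The weights are at least [1], so the approximation numbers cannot stay above [c]. *)
Lemma lorentz_small u v (l : nat -> R[i]) B c : 0 < u -> u <= v -> 0 < c ->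
  bounded_seq l -> (forall N, lorentz_sum u v l N <= B) ->
  exists K, forall j, (K <= j)%N -> nrm (l j) <= c.
Proof.
move=> u0 uv c0 bl lB; have v0 : 0 < v := lt_le_trans u0 uv.
have cv0 : 0 < c `^ v by exact: powR_gt0.
have [n n0 ln] : exists2 n, (0 < n)%N & approx_real n l < c.
  apply: contrapT => H.
  have {}H n : (0 < n)%N -> c <= approx_real n l.
    by move=> n0; rewrite leNgt; apply/negP => h; apply: H; exists n.
  have [M MB] : exists M : nat, B < M%:R * c `^ v.
    exists (Num.truncn (B / c `^ v)).+1; rewrite -ltr_pdivrMr//; exact: truncnS_gt.
  have := lB M.+1; rewrite leNgt => /negP; apply; apply: (lt_le_trans MB).
  rewrite /lorentz_sum big_add1/= big_mkord mulr_natl -[in leLHS](card_ord M) -sumr_const.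
  apply: ler_sum => i _; rewrite -[leLHS]mul1r ler_pM ?lorentz_weight_ge1 ?(ltW cv0)//.
  by apply: ge0_ler_powR; rewrite ?nnegrE ?approx_real_ge0 ?(ltW c0) ?(ltW v0)// H.
have [t [_ tl]] := approx_real_lt bl n0 ln.
exists (\max_(j <- t) j).+1 => j jt; apply/ltW/tl; apply: contraTN jt => jt.
by rewrite -leqNgt; exact: (leq_bigmax_seq (F := id)).
Qed.

(** Dominated convergence: the tails of [l] have smaller approximation numbers
  than [l], and tend to [0] uniformly. *)
Lemma lorentz_tail u v (l : nat -> R[i]) B e : 0 < u -> u <= v -> 0 < e ->
  bounded_seq l -> (forall N, lorentz_sum u v l N <= B) ->
  exists K, forall k, (K <= k)%N -> forall N,
    lorentz_sum u v (fun j => if (j < k)%N then 0 else l j) N <= e.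
Proof.
move=> u0 uv e0 bl lB; have v0 : 0 < v := lt_le_trans u0 uv.
have e2 : 0 < e / 2 by lra.
have [M0 HM0] := bounded_nd_cauchy e2 (@lorentz_sum_nd _ _ u v l) lB.
pose M := maxn 1 M0.
have HM N : (M <= N)%N -> lorentz_sum u v l N - lorentz_sum u v l M <= e / 2.
  move=> MN; apply: le_trans (HM0 N (leq_trans (leq_maxr _ _) MN)).
  by rewrite lerD2l lerN2 lorentz_sum_nd// leq_maxr.
(* Beyond [M] the sum is small for [l] already; before [M] it is small as soon as the
   terms of the tail are at most [c]. *)
pose W := \sum_(1 <= n < M) lorentz_weight u v n.
have W0 : 0 <= W by apply: sumr_ge0 => n _; exact: lorentz_weight_ge0.
pose c := (e / 2 / (W + 1)) `^ v^-1.
have q0 : 0 < e / 2 / (W + 1) by rewrite divr_gt0//; lra.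
have c0 : 0 < c by exact: powR_gt0.
have cv : W * c `^ v <= e / 2.
  rewrite /c -powRrM mulVf ?gt_eqF// powRr1 ?(ltW q0)// mulrCA ler_piMr ?(ltW e2)//.
  by rewrite ler_pdivrMr; lra.
have [K Kl] := lorentz_small u0 uv c0 bl lB.
exists K => k Kk N; set lk := fun j => _.
have lkl j : nrm (lk j) <= 1 * nrm (l j).
  by rewrite mul1r /lk; case: ifP => _; rewrite ?nrm0 ?nrm_ge0.
have lkc j : nrm (lk j) <= c.
  rewrite /lk; case: ltnP => [_|kj]; first by rewrite nrm0 ltW.
  exact: Kl (leq_trans Kk kj).
apply: (@le_trans _ _ (lorentz_sum u v lk (maxn M N))).
  by rewrite lorentz_sum_nd// leq_maxr.
rewrite /lorentz_sum (@big_cat_nat _ _ _ M)//= ?leq_maxl//.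
have -> : e = e / 2 + e / 2 by lra.
apply: lerD.
  apply: le_trans cv; rewrite mulr_suml !big_nat; apply: ler_sum => n /andP[n1 _].
  rewrite ler_wpM2l ?lorentz_weight_ge0//.
  apply: ge0_ler_powR; rewrite ?nnegrE ?approx_real_ge0 ?(ltW v0) ?(ltW c0)//.
  exact: approx_real_sup.
apply: le_trans (HM (maxn M N) (leq_maxl _ _)).
have -> : lorentz_sum u v l (maxn M N) = lorentz_sum u v l M +
    \sum_(M <= n < maxn M N) lorentz_weight u v n * approx_real n l `^ v.
  by rewrite /lorentz_sum (@big_cat_nat _ _ _ M)//= ?leq_maxl.
rewrite [leRHS]addrC.
rewrite addKr.
apply: ler_sum_nat => n /andP[n1 _].
have n0 : (0 < n)%N by apply: leq_trans n1; rewrite leq_maxl.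
apply: ler_wpM2l; first exact: lorentz_weight_ge0.
apply: ge0_ler_powR; rewrite ?nnegrE ?approx_real_ge0 ?(ltW v0)//.
by rewrite -[leRHS]mul1r; apply: approx_real_dom.
Qed.

(** The power is at most [C ^+ n.-1] times the term itself. Since [q' <= r'] and
  [s' <= p'], the weights of the first quasi-norm are at most [1] and those of the
  second one at least [1]; since [p' <= q'], powers of bounded numbers with exponent
  [q'] are controlled by those with exponent [p']. *)
Lemma lorentz_sum_pow (m : nat -> R[i]) (s' p' r' q' B C : R) n N :
  0 < s' -> s' <= p' -> p' <= q' -> q' <= r' -> (0 < n)%N -> 0 < C ->
  (forall j, nrm (m j) <= C) -> (forall N, lorentz_sum s' p' m N <= B) ->
  lorentz_sum r' q' (fun j => m j ^+ n) N <= (C ^+ n.-1) `^ q' * C `^ (q' - p') * B.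
Proof.
move=> s0 sp pq qr n0 C0 mC mB.
have p0 := lt_le_trans s0 sp; have q0 := lt_le_trans p0 pq; have r0 := lt_le_trans q0 qr.
have bm : bounded_seq m by exists C.
have Cn : 0 <= C ^+ n.-1 by rewrite exprn_ge0// ltW.
apply: (@le_trans _ _ ((C ^+ n.-1) `^ q' * lorentz_sum r' q' m N)).
  apply: lorentz_sum_dom => // j; rewrite nrmX -{1}(prednK n0) exprSr.
  rewrite ler_wpM2r ?nrm_ge0// lerXn2r ?nnegrE ?nrm_ge0//; first exact: ltW.
rewrite -mulrA ler_wpM2l ?powR_ge0//; apply: le_trans (ler_wpM2l _ (mB N)); last first.
  exact: powR_ge0.
rewrite /lorentz_sum mulr_sumr !big_nat; apply: ler_sum => k /andP[k1 _].
have a0 := approx_real_ge0 k m.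
have aC : approx_real k m <= C by exact: approx_real_sup.
rewrite mulrCA; apply: ler_pM; rewrite ?powR_ge0//.
  apply: (@le_trans _ _ 1); last exact: lorentz_weight_ge1.
  rewrite -[leRHS](powRr0 (k%:R : R)) ler_powR//; first by rewrite ler1n.
  by rewrite subr_le0 ler_pdivrMr// mul1r.
have [->|an0] := eqVneq (approx_real k m) 0.
  by rewrite !powR0 ?mulr0 ?gt_eqF.
have -> : approx_real k m `^ q' = approx_real k m `^ (q' - p') * approx_real k m `^ p'.
  by rewrite -powRD ?subrK// an0 implybT.
rewrite ler_wpM2r ?powR_ge0//; apply: ge0_ler_powR; rewrite ?nnegrE ?subr_ge0//.
exact: ltW.
Qed.

Definition single (X : normedModType R[i]) (a : X) (j : nat) : X :=
  if j is 0 then a else 0.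

Lemma bounded_single (X : normedModType R[i]) (a : X) : bounded_seq (single a).
Proof. by exists (nrm a) => -[|j] //=; rewrite nrm0 nrm_ge0. Qed.

Lemma lorentz_sum_single (X : normedModType R[i]) u v (a : X) N : 0 < v ->
  lorentz_sum u v (single a) N <= nrm a `^ v.
Proof.
move=> v0; have [N1|N1] := leqP N 1.
  by rewrite /lorentz_sum big_geq// powR_ge0.
rewrite /lorentz_sum big_ltn// -[leRHS]addr0; apply: lerD.
  rewrite /lorentz_weight powR1 mul1r; apply: ge0_ler_powR.
  - exact: ltW.
  - by rewrite nnegrE approx_real_ge0.
  - by rewrite nnegrE nrm_ge0.
  - by apply: approx_real_sup => // -[|j] //=; rewrite nrm0 nrm_ge0.
rewrite big_nat big1// => n /andP[n2 _].
have -> : approx_real n (single a) = 0.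
  apply/eqP; rewrite eq_le approx_real_ge0 andbT.
  by apply: (@approx_real_le _ _ n _ _ [:: 0%N]) => // -[|j]; rewrite ?inE ?nrm0.
by rewrite powR0 ?gt_eqF// mulr0.
Qed.

End LorentzTails.

(** * Dual spaces *)

Section RealTopology.
Context {R : realType}.

Lemma nbhs_nrmP (V : normedModType R[i]) (x : V) (P : set V) :
  nbhs x P <-> exists2 d : R, 0 < d & forall y, nrm (y - x) < d -> P y.
Proof.
split=> [/nbhs_ballP[e /= e0 eP]|[d d0 dP]].
  have [er e1] : e = (complex.Re e)%:C /\ 0 < complex.Re e.
    by case: e e0 {eP} => a b; rewrite ltcE/= => /andP[/eqP -> a0].
  exists (complex.Re e) => // y yx; apply: eP; rewrite -ball_normE /ball_/=.
  by rewrite er -nrmE ltcR nrm_distC.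
apply/nbhs_ballP; exists d%:C => /=; first by rewrite ltcR.
by move=> y; rewrite -ball_normE /ball_/= -nrmE ltcR nrm_distC => /dP.
Qed.

Lemma continuous_nrmP (V W : normedModType R[i]) (f : V -> W) :
  continuous f <-> forall x e, 0 < e ->
    exists2 d : R, 0 < d & forall y, nrm (y - x) < d -> nrm (f y - f x) < e.
Proof.
split=> [cf x e e0|H x].
  have /cf/nbhs_nrmP : nbhs (f x) [set w : W | nrm (w - f x) < e].
    by apply/nbhs_nrmP; exists e.
  by [].
move=> P /nbhs_nrmP[e e0 eP]; have [d d0 dP] := H x e e0.
by apply/nbhs_nrmP; exists d => // y /dP/eP.
Qed.

End RealTopology.

Section DualTheory.
Context {R : realType} {V : normedModType R[i]}.
Implicit Types (f g : dual V) (x y : V) (a : R[i]).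

Lemma dualD f x y : f (x + y) = f x + f y.
Proof. by have := dual_linear f 1 x y; rewrite !scale1r. Qed.

Lemma dual0 f : f 0 = 0.
Proof. by apply: (addrI (f 0)); rewrite -dualD !addr0. Qed.

Lemma dualZ f a x : f (a *: x) = a * f x.
Proof. by have := dual_linear f a x 0; rewrite addr0 dual0 addr0. Qed.

Lemma dual_le f x : nrm (f x) <= nrm f * nrm x.
Proof.
have [->|x0] := eqVneq x 0; first by rewrite dual0 !nrm0 mulr0.
have nx : 0 < nrm x by rewrite nrm_gt0.
have := @dual_norm_ub _ _ f ((nrm x)^-1%:C *: x).
rewrite dualZ nrmZ nrmM nrm_real ger0_norm ?invr_ge0 ?nrm_ge0// mulVf ?gt_eqF//.
by move=> /(_ (lexx _)); rewrite ler_pdivrMl// mulrC.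
Qed.

Lemma dual_nrm_le f M : 0 <= M -> (forall x, nrm (f x) <= M * nrm x) -> nrm f <= M.
Proof.
by move=> M0 fM; apply: dual_norm_le => x x1; rewrite (le_trans (fM x))// ler_piMr.
Qed.

Lemma exists_dual (h : V -> R[i]) (M : R) :
  (forall a x y, h (a *: x + y) = a * h x + h y) ->
  (forall x, nrm (h x) <= M * nrm x) -> exists f : dual V, forall x, f x = h x.
Proof.
move=> lh hM.
suff hP : h \in continuous_functional (V := V) by exists (Dual hP).
apply/asboolP; split; first by move=> a x y; exact: lh.
apply/continuous_nrmP => x e e0.
have M1 : 0 < `|M| + 1 by rewrite ltr_wpDl.
exists (e / (`|M| + 1)); first by rewrite divr_gt0.
move=> y yx.
have -> : h y - h x = h (y - x).
  by have := lh (-1) x y; rewrite scaleN1r mulN1r addrC (addrC (- h x)).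
apply: (le_lt_trans (hM _)); apply: (@le_lt_trans _ _ ((`|M| + 1) * nrm (y - x))).
  by rewrite ler_wpM2r ?nrm_ge0//; have := ler_norm M; lra.
by rewrite mulrC -ltr_pdivlMr.
Qed.

(** Completeness of the dual space, in the form needed for nested balls. *)
Lemma dual_nested (F : nat -> dual V) (r : nat -> R) :
  (forall k m, (k <= m)%N -> nrm (F m - F k) <= r k) ->
  (forall e, 0 < e -> exists k, r k < e) ->
  exists f : dual V, forall k, nrm (f - F k) <= r k.
Proof.
move=> Fr r0.
have rge0 k : 0 <= r k by apply: le_trans (nrm_ge0 _) (Fr k k (leqnn k)).
have Fx x k m : (k <= m)%N -> nrm (F m x - F k x) <= r k * nrm x.
  move=> km; rewrite (_ : F m x - F k x = (F m - F k) x)//.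
  by rewrite (le_trans (dual_le _ _))// ler_wpM2r ?nrm_ge0 ?Fr.
have lim x : exists l, seqlim (fun k => F k x) l.
  apply: seqlim_complete => e e0.
  have n1 : 0 < nrm x + 1 by have := nrm_ge0 x; lra.
  have d0 : 0 < e / 2 / (nrm x + 1) by rewrite !divr_gt0.
  have [k rk] := r0 _ d0; have {}rk : r k * (nrm x + 1) < e / 2 by rewrite -ltr_pdivlMr.
  have rx : r k * nrm x < e / 2 by apply: le_lt_trans rk; rewrite ler_wpM2l// lerDl.
  exists k => m n km kn; have := Fx x _ _ km; have := Fx x _ _ kn.
  have := nrmB (F m x - F k x) (F n x - F k x); rewrite opprB addrA subrK; lra.
have [h hP] := choice lim.
have hF x k : nrm (h x - F k x) <= r k * nrm x.
  by apply: (seqlim_le (hP x)); exists k => n kn; exact: Fx.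
have [f fh] : exists f : dual V, forall x, f x = h x.
  apply: (@exists_dual h (r 0%N + nrm (F 0%N))).
    move=> a x y; apply: (seqlim_uniq (hP _)) => e e0.
    have n1 : 0 < nrm a + 1 by have := nrm_ge0 a; lra.
    have [N1 N1P] := hP x (e / 2 / (nrm a + 1)) (ltac:(by rewrite !divr_gt0)).
    have [N2 N2P] := hP y (e / 2) (ltac:(by rewrite divr_gt0)).
    exists (maxn N1 N2) => n; rewrite geq_max => /andP[/N1P h1 /N2P h2].
    rewrite dualD dualZ.
    have -> : a * F n x + F n y - (a * h x + h y) = a * (F n x - h x) + (F n y - h y).
      by ring.
    apply: (le_lt_trans (nrmD _ _)); rewrite nrmM.
    have : nrm a * nrm (F n x - h x) <= (nrm a + 1) * nrm (F n x - h x).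
      by rewrite ler_wpM2r ?nrm_ge0//; lra.
    by move: h1; rewrite ltr_pdivlMr// mulrC; lra.
  move=> x; have := hF x 0%N; have := dual_le (F 0%N) x.
  have := nrmD (h x - F 0%N x) (F 0%N x); rewrite subrK mulrDl; lra.
exists f => k; apply: dual_nrm_le => // x.
by rewrite (_ : (f - F k) x = f x - F k x)// fh.
Qed.

End DualTheory.

Section Evaluation.
Context {R : realType} (E : normedModType R[i]).

Lemma exists_eval (x : E) : exists ev : dual (dual E),
  (forall f, ev f = f x) /\ nrm ev <= nrm x.
Proof.
have [||ev evE] := @exists_dual R (dual E) (fun f => f x) (nrm x).
- by [].
- by move=> f; rewrite mulrC dual_le.
exists ev; split=> //; apply: dual_nrm_le; first exact: nrm_ge0.
by move=> f; rewrite evE mulrC dual_le.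
Qed.

End Evaluation.

(** * Finiteness of the weak Lorentz norms *)

Section BanachSteinhaus.
Context {R : realType} {X : normedModType R[i]}.
Variables (u v : R) (x : nat -> X).
Hypotheses (u0 : 0 < u) (uv : u <= v) (wx : weak_lorentz u v x).
Implicit Types f g : dual X.

Let v0 : 0 < v := lt_le_trans u0 uv.
Let S f N := lorentz_sum u v (fun j => f (x j)) N.

Let bounded_app f : bounded_seq (fun j => f (x j)).
Proof. by have /(lorentzP _ _ v0)[] := wx f. Qed.

(** An approximation number that exceeds a bound is witnessed by finitely many terms,
  and a nearby functional changes these by little. *)
Lemma approx_real_lsc f N : exists2 d : R, 0 < d & forall g, nrm (g - f) <= d ->
  forall n, (0 < n < N)%N ->
  approx_real n (fun j => f (x j)) <= 2 * approx_real n (fun j => g (x j)).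
Proof.
elim: N => [|N [d d0 dP]]; first by exists 1 => // g _ n; rewrite ltn0 andbF.
set a := approx_real N (fun j => f (x j)).
have [a0|a0] := leP a 0.
  exists d => // g gf n /andP[n0]; rewrite ltnS leq_eqVlt => /predU1P[->|nN].
    by rewrite (le_trans a0)// mulr_ge0// approx_real_ge0.
  by apply: dP => //; rewrite n0.
have [||J [uJ sJ xJ]] := @approx_real_gt _ _ N (fun j => f (x j)) (3 / 4 * a).
- by rewrite mulr_ge0// ltW.
- by rewrite -/a; lra.
pose T := \sum_(j <- J) nrm (x j).
have T0 : 0 <= T by apply: sumr_ge0 => j _; exact: nrm_ge0.
exists (Num.min d (a / 4 / (T + 1))).
  by rewrite lt_min d0 !divr_gt0//; lra.
move=> g; rewrite le_min => /andP[gd gT] n /andP[n0].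
rewrite ltnS leq_eqVlt => /predU1P[->|nN]; last by apply: dP => //; rewrite n0.
have N0 : (0 < N)%N.
  rewrite lt0n; apply/eqP => N0; move: sJ; rewrite N0 => /size0nil J0.
  move: a0; rewrite /a N0 /approx_real /approx_number.
  rewrite (_ : [set _ | _ in _] = set0) ?ereal_inf0 ?ltxx//.
  by rewrite -subset0 => z [w [t [//]]].
rewrite -/a -ler_pdivrMl//; apply: (@approx_real_ge _ _ _ _ _ J) => //.
  by rewrite sJ.
move=> j jJ; have xT : nrm (x j) <= T.
  rewrite /T (big_rem j)//= lerDl; apply: sumr_ge0 => i _; exact: nrm_ge0.
have : nrm (g (x j) - f (x j)) <= a / 4.
  rewrite (_ : _ - _ = (g - f) (x j))//; apply: (le_trans (dual_le _ _)).
  have -> : a / 4 = a / 4 / (T + 1) * (T + 1) by rewrite divfK// gt_eqF//; lra.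
  by rewrite ler_pM ?nrm_ge0//; lra.
have := xJ j jJ; have := nrmB (g (x j)) (g (x j) - f (x j)).
rewrite opprB addrC subrK; lra.
Qed.

Lemma lorentz_sum_lsc f N : exists2 d : R, 0 < d & forall g, nrm (g - f) <= d ->
  S f N <= 2 `^ v * S g N.
Proof.
have [d d0 dP] := approx_real_lsc f N; exists d => // g gf.
rewrite /S /lorentz_sum mulr_sumr; apply: ler_sum_nat => n nN.
rewrite mulrCA ler_wpM2l ?lorentz_weight_ge0// -powRM ?approx_real_ge0//.
apply: ge0_ler_powR; rewrite ?nnegrE ?approx_real_ge0 ?(ltW v0) ?mulr_ge0 ?approx_real_ge0//.
exact: dP.
Qed.

(** Baire's argument: otherwise semicontinuity would provide nested balls, each with a
  partial sum that is large on the whole ball, and at their common point the sums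
  would be unbounded. *)
Lemma lorentz_sum_bounded_ball : exists f r M, 0 < r /\
  forall g, nrm (g - f) <= r -> forall N, S g N <= M.
Proof.
apply: contrapT => H.
have {}H f (r M : R) : 0 < r -> exists g, nrm (g - f) <= r /\ exists N, M < S g N.
  move=> r0; apply: contrapT => /forallNP h; apply: H; exists f, r, M; split=> // g gf N.
  by rewrite leNgt; apply/negP => SN; apply: (h g); split=> //; exists N.
pose Q (a b : dual X * R) (k : nat) := 0 < a.2 ->
  [/\ 0 < b.2, nrm (b.1 - a.1) + b.2 <= a.2, b.2 <= k.+1%:R^-1 &
    exists N, forall g, nrm (g - b.1) <= b.2 -> k%:R <= S g N].
have step (ak : (dual X * R) * nat) : exists b, Q ak.1 b ak.2.
  case: ak => [[f r] k]; rewrite /Q/=; have [r0|r0] := leP r 0.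
    by exists (f, r) => //; rewrite ltNge r0.
  have r2 : 0 < r / 2 by lra.
  have [g [gf [N gN]]] := H f (r / 2) (2 `^ v * k%:R) r2.
  have [d d0 dP] := lorentz_sum_lsc g N.
  exists (g, Num.min (r / 2) (Num.min d k.+1%:R^-1)) => _ /=; split.
  - by rewrite !lt_min r2 d0 invr_gt0 ltr0n.
  - have : Num.min (r / 2) (Num.min d k.+1%:R^-1) <= r / 2 by rewrite ge_min lexx.
    by lra.
  - by rewrite !ge_min lexx !orbT.
  - exists N => h; rewrite !le_min => /and3P[_ hd _].
    have := dP h hd => h1; have := lt_le_trans gN h1.
    have p0 : 0 < 2 `^ v :> R by exact: powR_gt0.
    by move=> h2; apply/ltW; rewrite -(ltr_pM2l p0); exact: h2.
have [F FP] := choice step.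
pose fix A k := if k is k'.+1 then F (A k', k') else ((0 : dual X), 1 : R).
have A0 k : 0 < (A k).2.
  by elim: k => [|k IH] /=; [exact: ltr01|case: (FP (A k, k) IH)].
have AS k : Q (A k) (A k.+1) k by exact: (FP (A k, k)).
have Acc k m : (k <= m)%N -> nrm ((A m).1 - (A k).1) + (A m).2 <= (A k).2.
  elim: m => [|m IH]; first by rewrite leqn0 => /eqP ->; rewrite subrr nrm0 add0r.
  rewrite leq_eqVlt => /predU1P[->|]; first by rewrite subrr nrm0 add0r.
  rewrite ltnS => /IH; have [_ + _ _] := AS m (A0 m).
  have := nrmD ((A m.+1).1 - (A m).1) ((A m).1 - (A k).1).
  rewrite addrA subrK; lra.
have [||f fP] := @dual_nested _ _ (fun k => (A k).1) (fun k => (A k).2).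
- by move=> k m /Acc; have := A0 m; lra.
- move=> e e0; exists (Num.truncn e^-1).+1.
  have [_ _ + _] := AS (Num.truncn e^-1) (A0 _); move=> /le_lt_trans; apply.
  by rewrite -[ltRHS]invrK ltf_pV2 ?posrE ?invr_gt0 ?ltr0n// truncnS_gt.
have /(lorentzP _ _ v0)[_ [B fB]] := wx f.
have [_ _ _ [N /(_ f (fP _))]] := AS (Num.truncn B).+1 (A0 _).
rewrite leNgt => /negP; apply; apply: (le_lt_trans (fB N)).
exact: truncnS_gt.
Qed.

(** The ball around [f0] is moved to the origin by the quasi-triangle inequality. *)
Lemma weak_lorentz_bounded : exists2 M : R, 0 <= M &
  forall f, nrm f <= 1 -> forall N, S f N <= M.
Proof.
have [f0 [r [M [r0 fM]]]] := lorentz_sum_bounded_ball.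
pose C := 2 * 2 `^ (v / u - 1) * 2 `^ v * (M + M).
have M0 : 0 <= M.
  by apply: le_trans (lorentz_sum_ge0 _ _ _ 0) (fM f0 _ 0%N); rewrite subrr nrm0 ltW.
exists (r^-1 `^ v * C).
  by rewrite !mulr_ge0 ?powR_ge0 ?addr_ge0.
move=> f f1 N.
pose g : dual X := r%:C *: f.
pose h : dual X := f0 + g.
have bg := bounded_app g.
apply: (@le_trans _ _ (r^-1 `^ v * S g N)).
  apply: lorentz_sum_dom => //; first by rewrite invr_ge0 ltW.
  move=> j; rewrite (_ : g (x j) = r%:C * f (x j))// nrmM nrm_real gtr0_norm//.
  by rewrite mulKf// gt_eqF.
rewrite ler_wpM2l ?powR_ge0//.
apply: (@le_trans _ _ (2 * 2 `^ (v / u - 1) * 2 `^ v * (S h N + S f0 N))); last first.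
  rewrite ler_wpM2l ?mulr_ge0 ?powR_ge0//; apply: lerD; apply: fM.
    rewrite /h addrAC subrr add0r /g nrmZ nrm_real gtr0_norm//.
    by rewrite ler_piMr// ltW.
  by rewrite subrr nrm0 ltW.
apply: lorentz_sum_half => // m m0; apply: approx_real_half => //.
move=> s t; exists (s ++ t); first by rewrite size_cat.
move=> c d hc fd j; rewrite mem_cat negb_or => /andP[js jt].
have -> : g (x j) = h (x j) - f0 (x j).
  by rewrite (_ : h (x j) = f0 (x j) + g (x j))// addrAC subrr add0r.
by rewrite (le_trans (nrmB _ _))// lerD ?hc ?fd.
Qed.

Lemma weak_lorentz_norm_fin : exists2 W : R, 0 <= W &
  weak_lorentz_norm u v x = W%:E.
Proof.
have [M M0 fM] := weak_lorentz_bounded.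
have nM f : nrm f <= 1 -> (lorentz_norm u v (fun j => f (x j)) <= (M `^ v^-1)%:E)%E.
  move=> f1; apply/lorentz_norm_leP => //; first exact: powR_ge0.
  by move=> N; rewrite -powRrM mulVf ?gt_eqF// powRr1// fM.
have W0 : (0 <= weak_lorentz_norm u v x)%E.
  apply: (le_trans (lorentz_norm_ge0 u v (fun j => (0 : dual X) (x j)))).
  by apply: ereal_sup_ubound; exists 0 => //=; rewrite nrm0 ler01.
exists (fine (weak_lorentz_norm u v x)); first exact: fine_ge0.
rewrite fineK// ge0_fin_numE//; apply: le_lt_trans (ltry (M `^ v^-1)).
by apply: ge_ereal_sup => _ [f /= f1 <-]; exact: nM.
Qed.

Lemma weak_lorentz_norm_sum W f : weak_lorentz_norm u v x = W%:E -> nrm f <= 1 ->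
  forall N, S f N <= W `^ v.
Proof.
move=> xW f1; have nW : (lorentz_norm u v (fun j => f (x j)) <= W%:E)%E.
  by rewrite -xW; apply: ereal_sup_ubound; exists f.
by apply/lorentz_norm_leP => //; rewrite -lee_fin (le_trans (lorentz_norm_ge0 _ _ _) nW).
Qed.

End BanachSteinhaus.

(** * Homogeneous polynomials *)

Section HomogeneousPolynomials.
Context {R : realType} {X : normedModType R[i]}.
Implicit Types (P Q : X -> R[i]) (x y : X) (a : R[i]).

(** The coordinates are rescaled one at a time. *)
Lemma multilinear_scale n (A : ('I_n -> X) -> R[i]) a x : multilinear A ->
  A (fun=> a *: x) = a ^+ n * A (fun=> x).
Proof.
move=> mA.
pose w k (j : 'I_n) := if (j < k)%N then a *: x else x.
have step k : (k < n)%N -> A (w k.+1) = a * A (w k).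
  move=> kn; have /= H0 := mA (w k) (Ordinal kn) 1 0 0.
  have /= H1 := mA (w k) (Ordinal kn) a x 0.
  move: H0; rewrite mul1r addr0 scaler0.
  set A0 := A (fun j => if _ then 0 else _) => /eqP; rewrite -subr_eq0 opprD addrA subrr.
  rewrite sub0r oppr_eq0 => /eqP A00.
  move: H1; rewrite addr0 -/A0 A00 addr0 => H1.
  have -> : w k.+1 = fun j => if j == Ordinal kn then a *: x else w k j.
    apply/funext => j; rewrite /w -val_eqE/= ltnS leq_eqVlt.
    by case: eqVneq => //= ->.
  rewrite H1; congr (_ * A _); apply/funext => j; rewrite /w -val_eqE/=.
  by case: eqVneq => //= ->; rewrite ltnn.
have : forall k, (k <= n)%N -> A (w k) = a ^+ k * A (w 0%N).
  elim=> [_|k IH kn]; first by rewrite expr0 mul1r.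
  by rewrite step// IH ?(ltnW kn)// mulrA -exprS.
move=> /(_ n (leqnn n)); congr (A _ = _ * A _).
by apply/funext => j; rewrite /w ltn_ord.
Qed.

Lemma hpoly_scale n P a x : hpoly n P -> P (a *: x) = a ^+ n * P x.
Proof. by move=> [_ [A mA PA]]; rewrite !PA (multilinear_scale _ _ mA). Qed.

Lemma hpoly_ball n P c : hpoly n P -> (forall x, nrm x <= 1 -> nrm (P x) <= c) ->
  forall x, nrm (P x) <= c * nrm x ^+ n.
Proof.
move=> hP Pc x.
have c0 : 0 <= c by apply: le_trans (nrm_ge0 (P 0)) (Pc 0 _); rewrite nrm0.
have [->|x0] := eqVneq x 0.
  have := hpoly_scale 0 0 hP; rewrite scale0r nrm0 => P0.
  case: n hP P0 => [|n] hP P0; first by rewrite expr0 mulr1 Pc// nrm0.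
  by rewrite P0 !exprS !mul0r nrm0 mulr0.
have nx : 0 < nrm x by rewrite nrm_gt0.
have nxC : ((nrm x)%:C : R[i]) != 0 by rewrite real_complex_eq0 gt_eqF.
have -> : P x = ((nrm x)%:C) ^+ n * P ((nrm x)%:C^-1 *: x).
  by rewrite -(hpoly_scale _ _ hP) scalerA mulfV// scale1r.
rewrite nrmM nrmX nrm_real ger0_norm ?nrm_ge0// mulrC ler_wpM2r ?exprn_ge0 ?nrm_ge0//.
by rewrite Pc// nrmZ nrmV nrm_real ger0_norm ?nrm_ge0// mulVf// gt_eqF.
Qed.

Lemma hpoly_lin n P Q a : hpoly n P -> hpoly n Q -> hpoly n (fun x => a * P x + Q x).
Proof.
move=> [cP [A mA PA]] [cQ [B mB QB]]; split.
  apply/continuous_nrmP => x e e0.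
  have na : 0 < nrm a + 1 by have := nrm_ge0 a; lra.
  have [d1 d10 d1P] := (continuous_nrmP P).1 cP x (e / 2 / (nrm a + 1))
    (ltac:(by rewrite !divr_gt0)).
  have [d2 d20 d2P] := (continuous_nrmP Q).1 cQ x (e / 2) (ltac:(by rewrite divr_gt0)).
  exists (Num.min d1 d2); first by rewrite lt_min d10.
  move=> y; rewrite lt_min => /andP[/d1P h1 /d2P h2].
  have -> : a * P y + Q y - (a * P x + Q x) = a * (P y - P x) + (Q y - Q x) by ring.
  apply: (le_lt_trans (nrmD _ _)); rewrite nrmM.
  have : nrm a * nrm (P y - P x) <= (nrm a + 1) * nrm (P y - P x).
    by rewrite ler_wpM2r ?nrm_ge0//; lra.
  by move: h1; rewrite ltr_pdivlMr// mulrC; lra.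
exists (fun v => a * A v + B v); last by move=> x; rewrite PA QB.
by move=> v i b x y; have /= -> := mA v i b x y; have /= -> := mB v i b x y; ring.
Qed.

Lemma hpoly0 n : hpoly n (fun _ : X => 0).
Proof.
split; first by move=> x; exact: cvg_cst.
by exists (fun=> 0) => // v i a x y; rewrite mulr0 addr0.
Qed.

Lemma hpoly_ext n P Q : (forall x, P x = Q x) -> hpoly n P -> hpoly n Q.
Proof. by move=> /funext ->. Qed.

Lemma hpoly_pow n (f : dual X) : hpoly n (fun x => f x ^+ n).
Proof.
split.
  have cf := @dual_continuous R X f.
  elim: n => [|n IH]; first by move=> x; exact: cvg_cst.
  apply/continuous_nrmP => x e e0.
  have [d1 d10 d1P] := (continuous_nrmP (f : X -> R[i])).1 cf x 1 ltr01.
  pose K := nrm (f x) + 1 + nrm (f x ^+ n) + 1.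
  have K0 : 0 < K.
    by rewrite /K; have := nrm_ge0 (f x); have := nrm_ge0 (f x ^+ n); lra.
  have eK : 0 < e / 2 / K by rewrite !divr_gt0.
  have [d2 d20 d2P] := (continuous_nrmP (f : X -> R[i])).1 cf x (e / 2 / K) eK.
  have [d3 d30 d3P] := (continuous_nrmP (fun x => f x ^+ n)).1 IH x (e / 2 / K) eK.
  exists (Num.min d1 (Num.min d2 d3)); first by rewrite !lt_min d10 d20.
  move=> y; rewrite !lt_min => /and3P[/d1P h1 /d2P h2 /d3P h3].
  have -> : f y ^+ n.+1 - f x ^+ n.+1 =
      f y * (f y ^+ n - f x ^+ n) + (f y - f x) * f x ^+ n by rewrite !exprS; ring.
  apply: (le_lt_trans (nrmD _ _)); rewrite !nrmM.
  have fy : nrm (f y) <= K.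
    have := nrmD (f y - f x) (f x); rewrite subrK /K; have := nrm_ge0 (f x ^+ n); lra.
  have fx : nrm (f x ^+ n) <= K by rewrite /K; have := nrm_ge0 (f x); lra.
  have : nrm (f y) * nrm (f y ^+ n - f x ^+ n) < e / 2.
    apply: (@le_lt_trans _ _ (K * nrm (f y ^+ n - f x ^+ n))).
      by rewrite ler_wpM2r ?nrm_ge0.
    by rewrite mulrC -ltr_pdivlMr.
  have : nrm (f y - f x) * nrm (f x ^+ n) < e / 2.
    apply: (@le_lt_trans _ _ (nrm (f y - f x) * K)).
      by rewrite ler_wpM2l ?nrm_ge0.
    by rewrite -ltr_pdivlMr.
  by lra.
exists (fun v => \prod_i f (v i)); last by move=> x; rewrite prodr_const card_ord.
move=> v i a x y /=.
have E z : \prod_j f (if j == i then z else v j) = f z * \prod_(j < n | j != i) f (v j).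
  rewrite (bigD1 i)//= eqxx; congr (_ * _).
  by apply: eq_bigr => j /negbTE ->.
by rewrite !E dualD dualZ; ring.
Qed.

Lemma hpoly_norm_cvgP (F : nat -> X -> R[i]) :
  (fun k => hpoly_norm (F k)) @ \oo --> 0%E <->
  forall e, 0 < e -> exists K, forall k, (K <= k)%N ->
    forall x, nrm x <= 1 -> nrm (F k x) <= e.
Proof.
have h0 k : (0 <= hpoly_norm (F k))%E.
  apply: (le_trans (_ : _ <= (nrm (F k 0))%:E)%E); first by rewrite lee_fin nrm_ge0.
  by apply: ereal_sup_ubound; exists 0 => //=; rewrite nrm0.
split=> [/fine_cvgP[[K0 _ K0P]] /cvgrPdist_lt cF e e0|H].
  have [K1 _ K1P] := cF e e0.
  exists (maxn K0 K1) => k; rewrite geq_max => /andP[k0 k1] x x1.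
  have := K1P k k1; rewrite sub0r normrN /= ger0_norm ?fine_ge0// => h.
  rewrite -lee_fin; apply: (@le_trans _ _ (hpoly_norm (F k))).
    by apply: ereal_sup_ubound; exists x.
  by rewrite -[leLHS]fineK ?lee_fin ?ltW// K0P.
have Hk e : 0 < e -> exists K, forall k, (K <= k)%N -> (hpoly_norm (F k) <= e%:E)%E.
  move=> /H[K KP]; exists K => k /KP h.
  by apply: ge_ereal_sup => _ [x /= x1 <-]; rewrite lee_fin h.
apply/fine_cvgP; split.
  have [K KP] := Hk 1 ltr01; exists K => // k /= /KP h.
  by rewrite ge0_fin_numE// (le_lt_trans h)// ltry.
apply/cvgrPdist_lt => e e0; have e2 : 0 < e / 2 by lra.
have [K KP] := Hk _ e2; exists K => // k /= /KP h.
rewrite sub0r normrN ger0_norm ?fine_ge0//.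
have : fine (hpoly_norm (F k)) <= e / 2.
  by rewrite -lee_fin fineK// ge0_fin_numE// (le_lt_trans h)// ltry.
lra.
Qed.

End HomogeneousPolynomials.

Section Interleaving.
Context {R : realType}.

(** Interleaving two sequences is how representations of two polynomials are added. *)
Definition interleave (T : Type) (a b : nat -> T) (j : nat) : T :=
  if odd j then b j./2 else a j./2.

Lemma interleave_comp (T U : Type) (f : T -> U) (a b : nat -> T) :
  (fun j => f (interleave a b j)) = interleave (fun j => f (a j)) (fun j => f (b j)).
Proof. by apply/funext => j; rewrite /interleave; case: odd. Qed.

Lemma sum_interleave (V : nmodType) (a b : nat -> V) k :
  \sum_(j < k) interleave a b j = \sum_(j < uphalf k) a j + \sum_(j < k./2) b j.
Proof.
elim: k => [|k IH]; first by rewrite !big_ord0 addr0.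
rewrite big_ord_recr/= IH /interleave uphalf_half.
case: (odd k); first by rewrite !add1n [X in _ = _ + X]big_ord_recr/= addrA.
by rewrite !add0n [X in _ = X + _]big_ord_recr/= addrAC.
Qed.

Lemma bounded_interleave (X : normedModType R[i]) (a b : nat -> X) :
  bounded_seq a -> bounded_seq b -> bounded_seq (interleave a b).
Proof.
move=> [A aA] [B bB]; exists (Num.max A B) => j; rewrite /interleave le_max.
by case: odd; rewrite ?aA ?bB ?orbT.
Qed.

Lemma lorentz_interleave (X : normedModType R[i]) (u v : R) (a b : nat -> X) :
  0 < u -> u <= v -> lorentz u v a -> lorentz u v b -> lorentz u v (interleave a b).
Proof.
move=> u0 uv; have v0 : 0 < v := lt_le_trans u0 uv.
move=> /(lorentzP _ _ v0)[ba [A aA]] /(lorentzP _ _ v0)[bb [B bB]].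
apply/lorentzP => //; split; first exact: bounded_interleave.
exists (2 * 2 `^ (v / u - 1) * 2 `^ v * (A + B)) => N.
apply: (@le_trans _ _ (2 * 2 `^ (v / u - 1) * 2 `^ v *
  (lorentz_sum u v a N + lorentz_sum u v b N))); last first.
  by rewrite ler_wpM2l ?mulr_ge0 ?powR_ge0// lerD.
apply: lorentz_sum_half => // m m0; apply: approx_real_half => //.
move=> s t; exists (map double s ++ map (fun i => i.*2.+1) t).
  by rewrite size_cat !size_map.
move=> c d ac bd j; rewrite mem_cat negb_or /interleave => /andP[js jt].
have c0 : 0 <= c.
  by apply: le_trans (nrm_ge0 _) (ac (\max_(i <- s) i).+1 _); apply/negP => h;
    have := leq_bigmax_seq (P := xpredT) (F := id) _ h isT; rewrite ltnn.
have d0 : 0 <= d.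
  by apply: le_trans (nrm_ge0 _) (bd (\max_(i <- t) i).+1 _); apply/negP => h;
    have := leq_bigmax_seq (P := xpredT) (F := id) _ h isT; rewrite ltnn.
have := odd_double_half j; case: (odd j) => jE.
  apply: (@le_trans _ _ d); last by rewrite lerDr.
  apply: bd; apply: contra jt => jt; apply/mapP; exists j./2 => //.
apply: (@le_trans _ _ c); last by rewrite lerDl.
by apply: ac; apply: contra js => js; apply/mapP; exists j./2.
Qed.

End Interleaving.

(** * Lorentz nuclear and quasi-nuclear polynomials *)

Section NuclearPolynomials.
Context {R : realType} {E : normedModType R[i]} {r q s p : R}.

Notation "t '^cj'" := (fine (hoelder_conjugate t%:E)) (at level 2, format "t '^cj'").

(** What the hypotheses on the exponents amount to for the conjugates as real numbers. *)
Record exponents_ok : Prop := ExponentsOk {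
  r_gt0 : 0 < r; r_le_q : r <= q; q'_gt0 : 0 < q^cj;
  q_conj : q^-1 + (q^cj)^-1 = 1;
  s'_gt0 : 0 < s^cj; s'_le_p' : s^cj <= p^cj; p'_le_q' : p^cj <= q^cj;
  q'_le_r' : q^cj <= r^cj }.

Hypothesis ok : exponents_ok.

Let q_gt0 : 0 < q := lt_le_trans (r_gt0 ok) (r_le_q ok).
Let p'_gt0 : 0 < p^cj := lt_le_trans (s'_gt0 ok) (s'_le_p' ok).

Implicit Types (P Q : E -> R[i]) (lam y : nat -> R[i]) (phi : nat -> dual E) (n : nat).

Definition rep_sum n lam phi y k (x : E) : R[i] :=
  \sum_(j < k) lam j * phi j x ^+ n * y j.

Definition rep_value n lam phi y : \bar R :=
  (lorentz_norm r q lam * weak_lorentz_norm s^cj p^cj phi ^+ n * seq_norm y)%E.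

Lemma nuclear_repP n P lam phi y : nuclear_rep r q s p n P lam phi y <->
  [/\ lorentz r q lam, weak_lorentz s^cj p^cj phi, bounded_seq y &
      forall e, 0 < e -> exists K, forall k, (K <= k)%N -> forall x, nrm x <= 1 ->
        nrm (P x - rep_sum n lam phi y k x) <= e].
Proof.
by split=> [[? ? /seq_norm_ltyP ? /hpoly_norm_cvgP ?]|[? ? /seq_norm_ltyP ? ?]];
  split=> //; apply/hpoly_norm_cvgP.
Qed.

Lemma nuclear_rep_fin n P lam phi y : nuclear_rep r q s p n P lam phi y ->
  exists A W Y : R, [/\ 0 <= A, 0 <= W & 0 <= Y] /\
  [/\ lorentz_norm r q lam = A%:E, weak_lorentz_norm s^cj p^cj phi = W%:E,
      seq_norm y = Y%:E & rep_value n lam phi y = (A * W ^+ n * Y)%:E].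
Proof.
move=> [[_ la] wphi yb _].
exists (fine (lorentz_norm r q lam)).
have [W W0 WE] := weak_lorentz_norm_fin (s'_gt0 ok) (s'_le_p' ok) wphi.
exists W, (fine (seq_norm y)).
have y0 : (0 <= seq_norm y)%E.
  by apply: le_trans (seq_norm_ge y 0); rewrite lee_fin nrm_ge0.
have lE : lorentz_norm r q lam = (fine (lorentz_norm r q lam))%:E.
  by rewrite fineK// ge0_fin_numE// lorentz_norm_ge0.
have yE : seq_norm y = (fine (seq_norm y))%:E by rewrite fineK// ge0_fin_numE.
do 2!split=> //; rewrite ?fine_ge0 ?lorentz_norm_ge0//.
by rewrite /rep_value lE yE WE -EFin_expe -!EFinM.
Qed.

(** Hoelder's inequality for Lorentz sequences, through the inclusions of the
  two sequence spaces in [l_q] and [l_q']. *)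
Lemma lorentz_hoelder n (lam mu : nat -> R[i]) (A W : R) k :
  (0 < n)%N -> bounded_seq lam -> bounded_seq mu -> 0 <= A -> 0 <= W ->
  (forall N, lorentz_sum r q lam N <= A `^ q) ->
  (forall N, lorentz_sum s^cj p^cj mu N <= W `^ p^cj) ->
  \sum_(j < k) nrm (lam j) * nrm (mu j) ^+ n <= A * W ^+ n.
Proof.
move=> n0 bl bm A0 W0 lA mW.
have lq K : \sum_(j < K) nrm (lam j) `^ q <= A `^ q.
  by apply: le_trans (lA K.+1); apply: sum_powR_le_lorentz_sum (r_gt0 ok) (r_le_q ok) _.
have mp K : \sum_(j < K) nrm (mu j) `^ p^cj <= W `^ p^cj.
  by apply: le_trans (mW K.+1); apply: sum_powR_le_lorentz_sum (s'_gt0 ok) (s'_le_p' ok) _.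
have mleW j : nrm (mu j) <= W.
  have : nrm (mu j) `^ p^cj <= W `^ p^cj.
    apply: le_trans (mp j.+1); rewrite big_ord_recr/= lerDr.
    by apply: sumr_ge0 => i _; exact: powR_ge0.
  rewrite !leNgt; apply: contra => h; apply: gt0_ltr_powR; rewrite ?nnegrE ?nrm_ge0//.
have lleA j : nrm (lam j) <= A.
  have : nrm (lam j) `^ q <= A `^ q.
    apply: le_trans (lq j.+1); rewrite big_ord_recr/= lerDr.
    by apply: sumr_ge0 => i _; exact: powR_ge0.
  rewrite !leNgt; apply: contra => h; apply: gt0_ltr_powR; rewrite ?nnegrE ?nrm_ge0//.
have [A00|A1] := eqVneq A 0.
  rewrite A00 mul0r big1// => j _; have := lleA j; rewrite A00 => h.
  by have /eqP -> : nrm (lam j) == 0; [rewrite eq_le h nrm_ge0|rewrite mul0r].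
have [W00|W1] := eqVneq W 0.
  rewrite W00 expr0n gtn_eqF// mulr0 big1// => j _; have := mleW j; rewrite W00 => h.
  have /eqP -> : nrm (mu j) == 0; first by rewrite eq_le h nrm_ge0.
  by rewrite expr0n gtn_eqF// mulr0.
have Ap : 0 < A by rewrite lt0r A1.
have Wp : 0 < W by rewrite lt0r W1.
pose a j := nrm (lam j) / A; pose b j := nrm (mu j) / W.
have a0 j : 0 <= a j by rewrite divr_ge0 ?nrm_ge0.
have b0 j : 0 <= b j by rewrite divr_ge0 ?nrm_ge0.
have b1 j : b j <= 1 by rewrite ler_pdivrMr// mul1r.
have aq : \sum_(j < k) a j `^ q <= 1.
  under eq_bigr => j _ do rewrite /a powRM ?nrm_ge0 ?invr_ge0//.
  rewrite -mulr_suml -ler_pdivlMr; last by rewrite powR_gt0 ?invr_gt0.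
  by rewrite mul1r -powRN -powR_inv1// -powRrM mulN1r opprK.
have bp : \sum_(j < k) b j `^ p^cj <= 1.
  under eq_bigr => j _ do rewrite /b powRM ?nrm_ge0 ?invr_ge0//.
  rewrite -mulr_suml -ler_pdivlMr; last by rewrite powR_gt0 ?invr_gt0.
  by rewrite mul1r -powRN -powR_inv1// -powRrM mulN1r opprK.
suff : \sum_(j < k) a j * b j ^+ n <= 1.
  move=> h; have AW : 0 < A * W ^+ n by rewrite mulr_gt0// exprn_gt0.
  rewrite -[leRHS]mul1r -ler_pdivrMr// mulr_suml; apply: le_trans h.
  apply: ler_sum => j _; rewrite /a /b expr_div_n mulrACA invfM lexx//.
apply: (@le_trans _ _ (\sum_(j < k) (a j `^ q / q + b j `^ p^cj / q^cj))).
  apply: ler_sum => j _.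
  apply: (le_trans (conjugate_powR (a0 j) (exprn_ge0 n (b0 j)) q_gt0 (q'_gt0 ok) (q_conj ok))).
  rewrite lerD2l ler_wpM2r ?invr_ge0 ?(ltW (q'_gt0 ok))//.
  have [->|bn] := eqVneq (b j) 0.
    by rewrite expr0n gtn_eqF//= powR0 ?powR_ge0// gt_eqF// q'_gt0.
  rewrite -powR_mulrn// -powRrM; apply: ger_powR; first by rewrite b1 lt0r bn b0.
  apply: le_trans (p'_le_q' ok) _; rewrite ler_peMl ?(ltW (q'_gt0 ok))// ler1n//.
rewrite big_split/= -!mulr_suml -(q_conj ok); apply: lerD.
  by rewrite -[leRHS]mul1r ler_wpM2r// invr_ge0 ltW.
by rewrite -[leRHS]mul1r ler_wpM2r// invr_ge0 ltW// q'_gt0.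
Qed.

Lemma weak_eval phi W x : weak_lorentz s^cj p^cj phi ->
  weak_lorentz_norm s^cj p^cj phi = W%:E -> nrm x <= 1 ->
  bounded_seq (fun j => phi j x) /\
  forall N, lorentz_sum s^cj p^cj (fun j => phi j x) N <= W `^ p^cj.
Proof.
move=> wphi WE x1; have [ev [evE ev1]] := exists_eval x.
have E1 : (fun j => phi j x) = (fun j => ev (phi j)) by apply/funext => j; rewrite evE.
rewrite E1; split; first by have /lorentzP-/(_ p'_gt0)[] := wphi ev.
by apply: weak_lorentz_norm_sum (s'_gt0 ok) (s'_le_p' ok) _ _ _ WE (le_trans ev1 x1).
Qed.

Lemma rep_value_ball n P lam phi y c : (0 < n)%N ->
  nuclear_rep r q s p n P lam phi y -> rep_value n lam phi y = c%:E ->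
  forall x, nrm x <= 1 -> nrm (P x) <= c.
Proof.
move=> n0 rP vc x x1.
have [A [W [Y [[A0 W0 Y0] [lA WE YE]]]]] := nuclear_rep_fin rP.
rewrite vc => -[->]; have [ll wphi by_ cP] := (nuclear_repP _ _ _ _ _).1 rP.
have [bm mW] := weak_eval wphi WE x1.
have bl : bounded_seq lam by case/(lorentzP _ _ q_gt0): ll.
have lS : forall N, lorentz_sum r q lam N <= A `^ q.
  by apply/lorentz_norm_leP => //; rewrite lA.
apply/ler_addgt0Pr => e e0; have [K KP] := cP e e0.
have := KP K (leqnn K) x x1.
have : nrm (rep_sum n lam phi y K x) <= A * W ^+ n * Y.
  rewrite (le_trans (nrm_sum _ _ _))//.
  apply: (@le_trans _ _ (\sum_(j < K) nrm (lam j) * nrm (phi j x) ^+ n * Y)).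
    apply: ler_sum => j _; rewrite !nrmM nrmX ler_wpM2l ?mulr_ge0 ?exprn_ge0 ?nrm_ge0//.
    by rewrite -lee_fin -YE seq_norm_ge.
  by rewrite -mulr_suml ler_wpM2r//; exact: (@lorentz_hoelder n lam (fun j => phi j x)).
have := nrmD (P x - rep_sum n lam phi y K x) (rep_sum n lam phi y K x).
rewrite subrK; lra.
Qed.

Lemma nuclear_rep_scale n P lam phi y a : nuclear_rep r q s p n P lam phi y ->
  nuclear_rep r q s p n (fun x => a * P x) lam phi (fun j => a * y j).
Proof.
move=> /nuclear_repP[ll wphi by_ cP]; apply/nuclear_repP; split => //.
  apply: bounded_seq_dom (nrm_ge0 a) by_ _ => j; by rewrite nrmM.
move=> e e0; have na : 0 < nrm a + 1 by have := nrm_ge0 a; lra.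
have [K KP] := cP (e / (nrm a + 1)) (ltac:(by rewrite divr_gt0)).
exists K => k Kk x x1; have := KP k Kk x x1; rewrite ler_pdivlMr// => h.
have -> : a * P x - rep_sum n lam phi (fun j => a * y j) k x =
    a * (P x - rep_sum n lam phi y k x).
  rewrite mulrBr /rep_sum mulr_sumr; congr (_ - _); apply: eq_bigr => j _; ring.
rewrite nrmM; apply: le_trans h; rewrite mulrC ler_wpM2l ?nrm_ge0//; lra.
Qed.

Lemma nuclear_rep_scale_value n lam phi y a :
  (rep_value n lam phi (fun j => (a * y j)%R) =
   (nrm a)%:E * rep_value n lam phi y)%E.
Proof.
rewrite /rep_value [in RHS]muleCA; congr (_ * _)%E.
have sc (b : R[i]) (z : nat -> R[i]) : (seq_norm (fun j => (b * z j)%R) <= (nrm b)%:E * seq_norm z)%E.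
  apply: ge_ereal_sup => _ [j _ <-]; rewrite nrmM EFinM lee_pmul// ?lee_fin ?nrm_ge0//.
  exact: seq_norm_ge.
apply/eqP; rewrite eq_le sc/=.
have [->|a0] := eqVneq a 0.
  rewrite nrm0 mul0e; apply: le_trans (seq_norm_ge _ 0%N).
  by rewrite lee_fin nrm_ge0.
have na : 0 < nrm a by rewrite nrm_gt0.
have := sc a^-1 (fun j => a * y j).
under [X in seq_norm X]eq_fun do rewrite mulKf//.
by rewrite nrmV lee_pdivlMl.
Qed.

Lemma nuclear_scale n P a : nuclear r q s p n P -> nuclear r q s p n (fun x => a * P x).
Proof.
move=> [hP [lam [phi [y rP]]]]; split.
  apply: hpoly_ext (hpoly_lin a hP (hpoly0 n)) => x; exact: addr0.
by exists lam, phi, (fun j => a * y j); exact: nuclear_rep_scale.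
Qed.

Lemma nuclear_add n P Q : nuclear r q s p n P -> nuclear r q s p n Q ->
  nuclear r q s p n (fun x => P x + Q x).
Proof.
move=> [hP [l1 [f1 [y1 /nuclear_repP[L1 W1 B1 C1]]]]].
move=> [hQ [l2 [f2 [y2 /nuclear_repP[L2 W2 B2 C2]]]]]; split.
  apply: hpoly_ext (hpoly_lin 1 hP hQ) => x; by rewrite mul1r.
exists (interleave l1 l2), (interleave f1 f2), (interleave y1 y2).
apply/nuclear_repP; split.
- exact: lorentz_interleave (r_gt0 ok) (r_le_q ok) _ _.
- move=> f; rewrite interleave_comp.
  exact: lorentz_interleave (s'_gt0 ok) (s'_le_p' ok) _ _.
- exact: bounded_interleave.
move=> e e0; have e2 : 0 < e / 2 by lra.
have [K1 H1] := C1 _ e2; have [K2 H2] := C2 _ e2.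
exists (maxn K1 K2).*2.+1 => k Kk x x1.
have k1 : (K1 <= uphalf k)%N.
  have := leq_maxl K1 K2; have := odd_double_half k; rewrite uphalf_half.
  by move: Kk; rewrite -!addnn; case: odd => /=; lia.
have k2 : (K2 <= k./2)%N.
  have := leq_maxr K1 K2; have := odd_double_half k.
  by move: Kk; rewrite -!addnn; case: odd => /=; lia.
have -> : rep_sum n (interleave l1 l2) (interleave f1 f2) (interleave y1 y2) k x =
    rep_sum n l1 f1 y1 (uphalf k) x + rep_sum n l2 f2 y2 k./2 x.
  transitivity (\sum_(j < k) interleave (fun j => l1 j * f1 j x ^+ n * y1 j)
      (fun j => l2 j * f2 j x ^+ n * y2 j) j); last by rewrite sum_interleave.
  by apply: eq_bigr => j _; rewrite /interleave; case: odd.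
have -> : P x + Q x - (rep_sum n l1 f1 y1 (uphalf k) x + rep_sum n l2 f2 y2 k./2 x) =
    (P x - rep_sum n l1 f1 y1 (uphalf k) x) + (Q x - rep_sum n l2 f2 y2 k./2 x) by ring.
have := nrmD (P x - rep_sum n l1 f1 y1 (uphalf k) x) (Q x - rep_sum n l2 f2 y2 k./2 x).
by have := H1 _ k1 x x1; have := H2 _ k2 x x1; lra.
Qed.

Lemma nuclear_lin n P Q a : nuclear r q s p n P -> nuclear r q s p n Q ->
  nuclear r q s p n (fun x => a * P x + Q x).
Proof. by move=> nP nQ; apply: nuclear_add => //; exact: nuclear_scale. Qed.

Lemma nuclear_sub n P Q : nuclear r q s p n P -> nuclear r q s p n Q ->
  nuclear r q s p n (fun x => P x - Q x).
Proof.
move=> nP nQ; rewrite (_ : (fun x => _) = (fun x => -1 * Q x + P x)).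
  exact: nuclear_lin.
by apply/funext => x; rewrite mulN1r addrC.
Qed.

Lemma lorentz_single (X : normedModType R[i]) (u v : R) (a : X) : 0 < v ->
  lorentz u v (single a).
Proof.
move=> v0; apply/lorentzP => //; split; first exact: bounded_single.
by exists (nrm a `^ v) => N; exact: lorentz_sum_single.
Qed.

Lemma dual_single (f : dual E) (g : dual (dual E)) :
  (fun j => g (single f j)) = single (g f).
Proof. by apply/funext => -[|j] //=; rewrite dual0. Qed.

(** A power of a functional is represented by a single term. *)
Lemma nuclear_rep_pow n (f : dual E) : (0 < n)%N ->
  nuclear_rep r q s p n (fun x => f x ^+ n) (single (1 : R[i])) (single f) (single (1 : R[i])) /\
  (rep_value n (single (1%R : R[i])) (single f) (single (1%R : R[i])) <= (nrm f ^+ n)%:E)%E.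
Proof.
move=> n0; have rP : nuclear_rep r q s p n (fun x => f x ^+ n) (single (1 : R[i])) (single f) (single (1 : R[i])).
  apply/nuclear_repP; split.
  - exact: lorentz_single.
  - by move=> g; rewrite dual_single; exact: lorentz_single.
  - exact: bounded_single.
  move=> e e0; exists 1%N => -[//|k] _ x _; rewrite /rep_sum big_ord_recl/=.
  rewrite big1 => [|i _]; last by rewrite mulr0.
  by rewrite mul1r mulr1 addr0 subrr nrm0 ltW.
split=> //; have [A [W [Y [[A0 W0 Y0] [lA WE YE ->]]]]] := nuclear_rep_fin rP.
have A1 : A <= 1.
  rewrite -lee_fin -lA; apply/lorentz_norm_leP => //; first exact: bounded_single.
  by move=> N; rewrite -[X in X `^ _](@nrm1 R); exact: lorentz_sum_single.
have Y1 : Y <= 1.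
  rewrite -lee_fin -YE; apply: seq_norm_le => -[|j] /=; first by rewrite nrm1.
  by rewrite nrm0.
have W1 : W <= nrm f.
  rewrite -lee_fin -WE; apply: ge_ereal_sup => _ [g /= g1 <-]; rewrite dual_single.
  apply: (@le_trans _ _ (nrm (g f))%:E).
    apply/lorentz_norm_leP => //; [exact: bounded_single|exact: nrm_ge0|].
    by move=> N; exact: lorentz_sum_single.
  rewrite lee_fin; apply: (le_trans (dual_le _ _)).
  by rewrite ler_piMl ?nrm_ge0.
rewrite lee_fin -[leRHS]mulr1 ler_pM ?mulr_ge0 ?exprn_ge0//.
by rewrite -[leRHS]mul1r ler_pM ?exprn_ge0// lerXn2r ?nnegrE ?nrm_ge0.
Qed.

Lemma nuclear_pow n (f : dual E) : (0 < n)%N -> nuclear r q s p n (fun x => f x ^+ n).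
Proof.
move=> n0; split; first exact: hpoly_pow.
by exists (single (1 : R[i])), (single f), (single (1 : R[i])); case: (nuclear_rep_pow f n0).
Qed.

Lemma nuclear0 n : (0 < n)%N -> nuclear r q s p n (fun _ : E => 0).
Proof.
move=> n0; rewrite (_ : (fun=> 0) = (fun x => 0 * ((0 : dual E) x ^+ n))).
  exact/nuclear_scale/nuclear_pow.
by apply/funext => x; rewrite mul0r.
Qed.

Lemma nuclear_rep_sum n lam phi y k : (0 < n)%N ->
  nuclear r q s p n (rep_sum n lam phi y k).
Proof.
move=> n0; elim: k => [|k IH].
  rewrite (_ : rep_sum _ _ _ _ _ = fun=> 0); first exact: nuclear0.
  by apply/funext => x; rewrite /rep_sum big_ord0.
rewrite (_ : rep_sum _ _ _ _ _ = fun x => (lam k * y k) * phi k x ^+ n + rep_sum n lam phi y k x).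
  by apply: nuclear_lin => //; exact: nuclear_pow.
by apply/funext => x; rewrite /rep_sum big_ord_recr/=; ring.
Qed.

(** Partial sums converge in the nuclear quasi-norm; this is where the finiteness
  of the weak norm is indispensable. *)
Lemma nuclear_rep_tail n P lam phi y e : (0 < n)%N -> 0 < e ->
  nuclear_rep r q s p n P lam phi y -> exists K, forall k, (K <= k)%N ->
    exists2 l, nuclear_rep r q s p n (fun x => P x - rep_sum n lam phi y k x) l phi y &
      (rep_value n l phi y <= e%:E)%E.
Proof.
move=> n0 e0 rP; have [A [W [Y [[A0 W0 Y0] [lA WE YE _]]]]] := nuclear_rep_fin rP.
have [ll wphi by_ cP] := (nuclear_repP _ _ _ _ _).1 rP.
have [bl [B lB]] := (lorentzP _ _ q_gt0).1 ll.
have D0 : 0 < W ^+ n * Y + 1 by rewrite ltr_wpDl// mulr_ge0// exprn_ge0.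
pose d := e / (W ^+ n * Y + 1).
have d0 : 0 < d by rewrite divr_gt0.
have dq : 0 < d `^ q by exact: powR_gt0.
have [K KP] := lorentz_tail (r_gt0 ok) (r_le_q ok) dq bl lB.
exists K => k Kk; pose l j := if (j < k)%N then 0 else lam j.
have bl' : bounded_seq l.
  apply: (@bounded_seq_dom _ _ _ lam l 1) => // j.
  by rewrite mul1r /l; case: ifP => _ //; rewrite nrm0 nrm_ge0.
have rl : nuclear_rep r q s p n (fun x => P x - rep_sum n lam phi y k x) l phi y.
  apply/nuclear_repP; split.
  - by apply/lorentzP => //; split=> //; exists (d `^ q); exact: KP.
  - exact: wphi.
  - exact: by_.
  move=> c /cP[M MP]; exists (maxn k M) => m; rewrite geq_max => /andP[km Mm] x x1.
  have -> : P x - rep_sum n lam phi y k x - rep_sum n l phi y m x =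
      P x - rep_sum n lam phi y m x.
    have sE l' i : rep_sum n l' phi y i x = \sum_(0 <= j < i) l' j * phi j x ^+ n * y j.
      by rewrite big_mkord.
    have cat l' : rep_sum n l' phi y m x = \sum_(0 <= j < k) l' j * phi j x ^+ n * y j +
        \sum_(k <= j < m) l' j * phi j x ^+ n * y j by rewrite sE (big_cat_nat _ km).
    have l0 : \sum_(0 <= j < k) l j * phi j x ^+ n * y j = 0.
      by rewrite big_nat big1// => j /andP[_ jk]; rewrite /l jk !mul0r.
    rewrite !cat l0 add0r sE.
    have -> : \sum_(k <= j < m) l j * phi j x ^+ n * y j =
        \sum_(k <= j < m) lam j * phi j x ^+ n * y j.
      by apply: eq_big_nat => j /andP[kj _]; rewrite /l ltnNge kj.
    ring.
  exact: MP.
exists l => //; rewrite /rep_value WE YE.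
have lE : (lorentz_norm r q l <= d%:E)%E.
  by apply/lorentz_norm_leP => //; [exact: ltW|exact: KP].
apply: (@le_trans _ _ (d%:E * (W%:E ^+ n) * Y%:E)%E).
  rewrite -!EFin_expe !lee_wpmul2r ?lee_fin ?exprn_ge0//.
rewrite -EFin_expe -!EFinM lee_fin -mulrA /d mulrAC ler_pdivrMr// ler_wpM2l ?(ltW e0)//; lra.
Qed.

Lemma nuclear_norm_le_rep n P lam phi y : nuclear_rep r q s p n P lam phi y ->
  (nuclear_norm r q s p n P <= rep_value n lam phi y)%E.
Proof. by move=> rP; apply: ereal_inf_lbound; exists lam, phi, y. Qed.

Lemma nuclear_norm_ball n P c : (0 < n)%N -> nuclear r q s p n P ->
  (nuclear_norm r q s p n P <= c%:E)%E -> forall x, nrm x <= 1 -> nrm (P x) <= c.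
Proof.
move=> n0 nP Pc x x1; apply/ler_addgt0Pr => e e0.
have : (nuclear_norm r q s p n P < (c + e)%:E)%E.
  by apply: le_lt_trans Pc _; rewrite lte_fin ltrDl.
move=> /ereal_inf_lt[_ [lam [phi [y [rP ->]]]] zc].
have [A [W [Y [_ [_ _ _ vE]]]]] := nuclear_rep_fin rP.
have := rep_value_ball n0 rP vE x1.
by move: zc; rewrite -/(rep_value n lam phi y) vE lte_fin; lra.
Qed.

Notation nuc := (nuclear r q s p).
Notation gauge := (bipolar_gauge r q s p).

Lemma pairing_lin n P1 P2 (Q : dual E -> R[i]) a : nuc n P1 -> nuc n P2 ->
  pairing r q s p n (fun x => a * P1 x + P2 x) Q =
  a * pairing r q s p n P1 Q + pairing r q s p n P2 Q.
Proof.
move=> n1 n2; rewrite /pairing; case: xgetP => [T _ [[lT _] _]|_].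
  exact: lT.
by rewrite mulr0 addr0.
Qed.

Lemma pairing0 n (Q : dual E -> R[i]) : (0 < n)%N ->
  pairing r q s p n (fun _ : E => 0) Q = 0.
Proof.
move=> n0; have := pairing_lin Q 1 (nuclear0 n0) (nuclear0 n0).
have -> : (fun _ : E => 1 * 0 + 0) = (fun _ : E => 0 : R[i]).
  by apply/funext => x; rewrite mulr0 addr0.
by rewrite mul1r; move/eqP; rewrite -subr_eq0 opprD addrA subrr sub0r oppr_eq0 => /eqP.
Qed.

Lemma pairingZ n P (Q : dual E -> R[i]) a : (0 < n)%N -> nuc n P ->
  pairing r q s p n (fun x => a * P x) Q = a * pairing r q s p n P Q.
Proof.
move=> n0 nP; have := pairing_lin Q a nP (nuclear0 n0).
rewrite pairing0// addr0 => <-; congr (pairing _ _ _ _ _ _ _).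
by apply/funext => x; rewrite addr0.
Qed.

(** In this form the gauge is visibly a seminorm: it is a supremum of moduli of linear
  functionals. *)
Lemma bipolar_gaugeP n P c : (0 < n)%N -> nuc n P -> 0 <= c ->
  (gauge n P <= c%:E)%E <->
  forall Q : dual E -> R[i], polar r q s p n Q -> nrm (pairing r q s p n P Q) <= c.
Proof.
move=> n0 nP c0; split=> [Pc Q polQ|H].
  apply/ler_addgt0Pr => e e0.
  have : (gauge n P < (c + e)%:E)%E by apply: le_lt_trans Pc _; rewrite lte_fin ltrDl.
  move=> /ereal_inf_lt[_ [d [d0 [P0 [nP0 P0Q] PE]] <-]]; rewrite lte_fin => /ltW dc.
  apply: le_trans dc; have -> : P = (fun x => d%:C * P0 x) by exact/funext.
  rewrite pairingZ// nrmM nrm_real gtr0_norm// -[leRHS]mulr1 ler_wpM2l ?(ltW d0)//.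
  exact: P0Q.
apply/lee_addgt0Pr => e e0; rewrite -EFinD; apply: ereal_inf_lbound.
have d0 : 0 < c + e by rewrite ltr_wpDl.
have dC : ((c + e)%:C : R[i]) != 0 by rewrite real_complex_eq0 gt_eqF.
exists (c + e) => //; split=> //; exists (fun x => (c + e)%:C^-1 * P x); last first.
  by move=> x; rewrite mulVKf.
split; first exact: nuclear_scale.
move=> Q polQ; rewrite pairingZ// nrmM nrmV nrm_real gtr0_norm// ler_pdivrMl// mulr1.
by apply: le_trans (H Q polQ) _; rewrite lerDl ltW.
Qed.

Lemma bipolar_gauge_ge0 n P : (0 <= gauge n P)%E.
Proof.
by apply: le_ereal_inf_tmp => _ [d [d0 _] <-]; rewrite lee_fin ltW.
Qed.

Lemma bipolar_gauge_le_rep n P lam phi y c : (0 < n)%N -> hpoly n P ->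
  nuclear_rep r q s p n P lam phi y -> (rep_value n lam phi y <= c%:E)%E ->
  (gauge n P <= c%:E)%E.
Proof.
move=> n0 hP rP vc; have nP : nuc n P by split=> //; exists lam, phi, y.
have c0 : 0 <= c.
  have [A [W [Y [[A0 W0 Y0] [_ _ _ vE]]]]] := nuclear_rep_fin rP.
  by rewrite -lee_fin (le_trans _ vc)// vE lee_fin !mulr_ge0// exprn_ge0.
apply/bipolar_gaugeP => // Q [_ polQ]; apply/ler_addgt0Pr => e e0.
have d0 : 0 < c + e by rewrite ltr_wpDl.
have := polQ (fun x => (c + e)%:C^-1 * P x).
rewrite pairingZ// nrmM nrmV nrm_real gtr0_norm// ler_pdivrMl// mulr1; apply.
split; first exact: nuclear_scale.
apply: le_trans (nuclear_norm_le_rep (nuclear_rep_scale _ rP)) _.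
rewrite nuclear_rep_scale_value nrmV nrm_real gtr0_norm//.
rewrite lee_pdivrMl// mule1; apply: (le_trans vc); rewrite lee_fin lerDl ltW//.
Qed.

Definition gaugeR n P : R := fine (gauge n P).

Lemma gaugeE n P : (0 < n)%N -> nuc n P -> gauge n P = (gaugeR n P)%:E.
Proof.
move=> n0 nP; have [hP [lam [phi [y rP]]]] := nP.
have [A [W [Y [_ [_ _ _ vE]]]]] := nuclear_rep_fin rP.
rewrite /gaugeR fineK// ge0_fin_numE ?bipolar_gauge_ge0//.
apply: (@le_lt_trans _ _ (A * W ^+ n * Y)%:E); last exact: ltry.
by apply: bipolar_gauge_le_rep n0 hP rP _; rewrite vE.
Qed.

Lemma gaugeR_ge0 n P : 0 <= gaugeR n P.
Proof. exact/fine_ge0/bipolar_gauge_ge0. Qed.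

Lemma gaugeR_leP n P c : (0 < n)%N -> nuc n P -> 0 <= c -> gaugeR n P <= c <->
  forall Q : dual E -> R[i], polar r q s p n Q -> nrm (pairing r q s p n P Q) <= c.
Proof. by move=> n0 nP c0; rewrite -(bipolar_gaugeP n0 nP c0) gaugeE// lee_fin. Qed.

Lemma gaugeR_lin n P1 P2 a : (0 < n)%N -> nuc n P1 -> nuc n P2 ->
  gaugeR n (fun x => a * P1 x + P2 x) <= nrm a * gaugeR n P1 + gaugeR n P2.
Proof.
move=> n0 n1 n2; have c0 : 0 <= nrm a * gaugeR n P1 + gaugeR n P2.
  by rewrite addr_ge0 ?mulr_ge0 ?nrm_ge0 ?gaugeR_ge0.
apply/gaugeR_leP => // [|Q polQ]; first exact: nuclear_lin.
rewrite pairing_lin//; apply: (le_trans (nrmD _ _)); rewrite nrmM.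
apply: lerD; first by rewrite ler_wpM2l ?nrm_ge0//;
  exact: (gaugeR_leP n0 n1 (gaugeR_ge0 _ _)).1.
exact: (gaugeR_leP n0 n2 (gaugeR_ge0 _ _)).1.
Qed.

Lemma gaugeR0 n : (0 < n)%N -> gaugeR n (fun _ : E => 0) = 0.
Proof.
move=> n0; apply/eqP; rewrite eq_le gaugeR_ge0 andbT.
by apply/gaugeR_leP => // [|Q _]; [exact: nuclear0|rewrite pairing0// nrm0].
Qed.

Lemma gaugeR_pow n (f : dual E) : (0 < n)%N -> gaugeR n (fun x => f x ^+ n) <= nrm f ^+ n.
Proof.
move=> n0; rewrite -lee_fin -gaugeE//; last exact: nuclear_pow.
have [rP vP] := nuclear_rep_pow f n0.
by apply: bipolar_gauge_le_rep n0 _ rP vP; exact: hpoly_pow.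
Qed.

Lemma gaugeR_tail n P lam phi y e : (0 < n)%N -> 0 < e -> hpoly n P ->
  nuclear_rep r q s p n P lam phi y -> exists K, forall k, (K <= k)%N ->
    gaugeR n (fun x => P x - rep_sum n lam phi y k x) <= e.
Proof.
move=> n0 e0 hP rP; have nP : nuc n P by split=> //; exists lam, phi, y.
have [K KP] := nuclear_rep_tail n0 e0 rP; exists K => k Kk.
have [l rl vl] := KP k Kk.
have nS := nuclear_sub nP (nuclear_rep_sum lam phi y k n0).
by rewrite -lee_fin -gaugeE//; apply: bipolar_gauge_le_rep n0 nS.1 rl vl.
Qed.

(** A continuous functional is determined by its Borel transform, since nuclear
  polynomials are limits of combinations of powers. *)
Lemma nuclear_functional_eval n (T : (E -> R[i]) -> R[i]) (x : E) : (0 < n)%N ->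
  nuclear_functional r q s p n T -> (forall f : dual E, T (fun z => f z ^+ n) = f x ^+ n) ->
  forall P, nuc n P -> T P = P x.
Proof.
move=> n0 [lT cT] Tpow P nP; have [hP [lam [phi [y rP]]]] := nP.
have T0 : T (fun=> 0) = 0.
  have := lT 1 _ _ (nuclear0 n0) (nuclear0 n0).
  have -> : (fun _ : E => 1 * 0 + 0) = (fun _ : E => 0 : R[i]).
    by apply/funext => z; rewrite mulr0 addr0.
  rewrite mul1r.
  by move/eqP; rewrite -subr_eq0 opprD addrA subrr sub0r oppr_eq0 => /eqP.
have Tsum k : T (rep_sum n lam phi y k) = rep_sum n lam phi y k x.
  elim: k => [|k IH].
    rewrite (_ : rep_sum _ _ _ _ _ = fun=> 0) ?T0//.
    by apply/funext => z; rewrite /rep_sum big_ord0.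
  have -> : rep_sum n lam phi y k.+1 =
      fun z => (lam k * y k) * phi k z ^+ n + rep_sum n lam phi y k z.
    by apply/funext => z; rewrite /rep_sum big_ord_recr/=; ring.
  by rewrite lT ?IH ?Tpow//; [exact: nuclear_pow|exact: nuclear_rep_sum].
apply: (@seqlim_uniq _ _ (fun k => rep_sum n lam phi y k x)) => e e0.
  have [d d0 dP] := cT P e nP e0.
  have [d2 d2d] : 0 < d / 2 /\ d / 2 < d by split; lra.
  have [K KP] := nuclear_rep_tail n0 d2 rP.
  exists K => k Kk; rewrite -Tsum; apply: dP; first exact: nuclear_rep_sum.
  have [l rl vl] := KP k Kk.
  apply: (@le_lt_trans _ _ (d / 2)%:E); last by rewrite lte_fin.
  apply: le_trans (nuclear_norm_le_rep (lam := l) (phi := phi) (y := fun j => -1 * y j) _) _.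
    rewrite (_ : (fun x => _) = fun z => -1 * (P z - rep_sum n lam phi y k z)).
      exact: nuclear_rep_scale.
    by apply/funext => z; ring.
  by rewrite nuclear_rep_scale_value nrmN nrm1 mul1e.
pose c := (nrm x + 1) ^+ n.
have c0 : 0 < c by rewrite exprn_gt0// ltr_wpDl// nrm_ge0.
have [lamP wphi by_ cP] := (nuclear_repP _ _ _ _ _).1 rP.
have [K KP] := cP (e / 2 / c) (ltac:(by rewrite !divr_gt0)).
exists K => k Kk; rewrite nrm_distC.
have hS := (nuclear_sub nP (nuclear_rep_sum lam phi y k n0)).1.
apply: (le_lt_trans (hpoly_ball hS (KP k Kk) x)).
apply: (@le_lt_trans _ _ (e / 2 / c * c)); last by rewrite divfK ?gt_eqF//; lra.
have ec : 0 <= e / 2 / c by rewrite ltW// !divr_gt0.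
rewrite ler_wpM2l//.
by rewrite /c lerXn2r ?nnegrE ?addr_ge0 ?nrm_ge0// lerDl.
Qed.

(** Evaluation at a point of the unit ball lies in the polar, so the gauge
  dominates the sup norm. *)
Lemma gaugeR_ball n P : (0 < n)%N -> nuc n P ->
  forall x, nrm x <= 1 -> nrm (P x) <= gaugeR n P.
Proof.
move=> n0 nP x x1.
pose Q (f : dual E) := f x ^+ n.
have fT : nuclear_functional r q s p n (fun P0 => P0 x).
  split=> // P0 e nP0 e0; exists e => // P1 nP1 /ereal_inf_lt[_ [lam [phi [y [rP ->]]]] zc].
  have [A [W [Y [_ [_ _ _ vE]]]]] := nuclear_rep_fin rP.
  have := rep_value_ball n0 rP vE x1.
  by move: zc; rewrite -/(rep_value n lam phi y) vE lte_fin; lra.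
have pE P0 : nuc n P0 -> pairing r q s p n P0 Q = P0 x.
  move=> nP0; rewrite /pairing; case: xgetP => [T _ [nT bT]|].
    by apply: nuclear_functional_eval nP0 => // f; exact: (congr1 (fun h => h f) bT).
  by move=> /(_ (fun P0 => P0 x)) []; split.
rewrite -pE//; apply: (gaugeR_leP n0 nP (gaugeR_ge0 _ _)).1 => //.
split; last first.
  by move=> P0 [nP0 P01]; rewrite pE//; exact: (nuclear_norm_ball n0 nP0 P01 x1).
split.
  have [ev [evE _]] := exists_eval x.
  by apply: hpoly_ext (hpoly_pow n ev) => f; rewrite evE.
move=> phi wphi.
have [W W0 WE] := weak_lorentz_norm_fin (s'_gt0 ok) (s'_le_p' ok) wphi.
have [[C bC] mW] := weak_eval wphi WE x1.
have C1 : 0 < `|C| + 1 by rewrite ltr_wpDl.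
have mC j : nrm (phi j x) <= `|C| + 1 by have := bC j; have := ler_norm C; lra.
apply/lorentzP; first exact: (q'_gt0 ok).
split.
  exists ((`|C| + 1) ^+ n) => j; rewrite nrmX lerXn2r ?nnegrE ?nrm_ge0//.
exists (((`|C| + 1) ^+ n.-1) `^ q^cj * (`|C| + 1) `^ (q^cj - p^cj) * W `^ p^cj) => N.
exact: (lorentz_sum_pow N (s'_gt0 ok) (s'_le_p' ok) (p'_le_q' ok) (q'_le_r' ok) n0 C1 mC mW).
Qed.

Notation qnuc := (quasi_nuclear r q s p).
Notation qn := (quasi_nuclear_norm r q s p).

Lemma hpoly0_const P : hpoly 0 P -> forall x, P x = P 0.
Proof. by move=> [_ [A _ PA]] x; rewrite !PA; congr A; apply/funext => -[]. Qed.

Definition qnR n P : R := fine (qn n P).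

(** The degree [0] space being [R[i]] itself, the two norms are extended to it so
  that all degrees can be treated alike. *)
Definition nuc0 n P : Prop := if n is 0 then hpoly 0 P else nuc n P.

Definition ngauge n P : R := if n is 0 then nrm (P 0) else gaugeR n P.

Lemma ngauge_ge0 n P : 0 <= ngauge n P.
Proof. by case: n => [|n]; [exact: nrm_ge0|exact: gaugeR_ge0]. Qed.

Lemma nuc0_hpoly n P : nuc0 n P -> hpoly n P.
Proof. by case: n => [//|n] []. Qed.

Lemma nuc0_lin n P1 P2 a : nuc0 n P1 -> nuc0 n P2 -> nuc0 n (fun x => a * P1 x + P2 x).
Proof. by case: n => [|n]; [exact: hpoly_lin|exact: nuclear_lin]. Qed.

Lemma nuc0_pow n (f : dual E) : nuc0 n (fun x => f x ^+ n).
Proof. by case: n => [|n]; [exact: hpoly_pow|exact: nuclear_pow]. Qed.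

Lemma nuc0_0 n : nuc0 n (fun _ : E => 0).
Proof. by case: n => [|n]; [exact: hpoly0|exact: nuclear0]. Qed.

Lemma ngauge_lin n P1 P2 a : nuc0 n P1 -> nuc0 n P2 ->
  ngauge n (fun x => a * P1 x + P2 x) <= nrm a * ngauge n P1 + ngauge n P2.
Proof.
by case: n => [|n] h1 h2; [rewrite -nrmM; exact: nrmD|exact: gaugeR_lin].
Qed.

Lemma ngauge0 n : ngauge n (fun _ : E => 0) = 0.
Proof. by case: n => [|n]; [exact: nrm0|exact: gaugeR0]. Qed.

Lemma ngauge_pow n (f : dual E) : ngauge n (fun x => f x ^+ n) <= nrm f ^+ n.
Proof.
by case: n => [|n]; [rewrite /ngauge !expr0 nrm1|exact: gaugeR_pow].
Qed.

Lemma ngauge_ball n P x : nuc0 n P -> nrm x <= 1 -> nrm (P x) <= ngauge n P.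
Proof.
by case: n => [|n] h x1; [rewrite (hpoly0_const h)|exact: gaugeR_ball].
Qed.

Lemma nuc0_sub n P1 P2 : nuc0 n P1 -> nuc0 n P2 -> nuc0 n (fun x => P1 x - P2 x).
Proof.
move=> h1 h2; have := nuc0_lin (-1) h2 h1.
by under eq_fun do rewrite mulN1r addrC.
Qed.

Lemma ngauge_add n P1 P2 : nuc0 n P1 -> nuc0 n P2 ->
  ngauge n (fun x => P1 x + P2 x) <= ngauge n P1 + ngauge n P2.
Proof.
move=> h1 h2; have := ngauge_lin 1 h1 h2; rewrite nrm1 mul1r.
by under eq_fun do rewrite mul1r.
Qed.

(** Representatives in the completion, with real gauges and for all degrees alike. *)
Definition qrep n P (Pk : nat -> E -> R[i]) : Prop :=
  [/\ (forall k, nuc0 n (Pk k)),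
      (forall e, 0 < e -> exists N, forall k l, (N <= k)%N -> (N <= l)%N ->
         ngauge n (fun x => Pk k x - Pk l x) < e) &
      (forall e, 0 < e -> exists K, forall k, (K <= k)%N -> forall x, nrm x <= 1 ->
         nrm (Pk k x - P x) <= e)].

Lemma completion_repP n P Pk : (0 < n)%N ->
  completion_rep r q s p n P Pk <-> qrep n P Pk.
Proof.
case: n => [//|n] _.
split=> -[nPk cPk]; [move=> /hpoly_norm_cvgP lPk|move=> lPk]; split=> //.
- move=> e e0; have [N NP] := cPk e e0; exists N => k l Nk Nl.
  by have := NP k l Nk Nl; rewrite gaugeE ?lte_fin//; exact: nuclear_sub.
- move=> e e0; have [N NP] := cPk e e0; exists N => k l Nk Nl.
  have nS : nuc n.+1 (fun x => Pk k x - Pk l x) by apply: nuclear_sub; exact: nPk.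
  by rewrite gaugeE// lte_fin; exact: NP.
- exact/hpoly_norm_cvgP.
Qed.

Lemma qrep_lim n P Pk : qrep n P Pk -> exists l, 0 <= l /\
  forall e, 0 < e -> exists N, forall k, (N <= k)%N -> `|ngauge n (Pk k) - l| < e.
Proof.
move=> [nPk cPk _].
have tri P1 P2 : nuc0 n P1 -> nuc0 n P2 ->
    ngauge n P1 - ngauge n P2 <= ngauge n (fun x => P1 x - P2 x).
  move=> h1 h2; have := ngauge_add (nuc0_sub h1 h2) h2.
  under eq_fun do rewrite subrK; lra.
have : cvg ((fun k => ngauge n (Pk k)) @ \oo).
  apply: cauchy_cvg; apply: cauchy_exP => e e0.
  have [N NP] := cPk e e0; exists (ngauge n (Pk N)); exists N => // k /= Nk.
  rewrite -ball_normE /ball_/= ltr_norml; apply/andP; split.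
    by have := NP k N Nk (leqnn N); have := tri _ _ (nPk k) (nPk N); lra.
  by have := NP N k (leqnn N) Nk; have := tri _ _ (nPk N) (nPk k); lra.
move=> /cvg_ex[l cl]; have clP e : 0 < e ->
    exists N, forall k, (N <= k)%N -> `|ngauge n (Pk k) - l| < e.
  move=> e0; have /cvgrPdist_lt/(_ e e0)[N _ NP] := cl.
  by exists N => k Nk; rewrite distrC; exact: NP.
exists l; split=> //; rewrite leNgt; apply/negP => l0.
have [|N /(_ N (leqnn N))] := clP (- l); first by rewrite oppr_gt0.
have := ngauge_ge0 n (Pk N); have := ler_norm (ngauge n (Pk N) - l); lra.
Qed.

Lemma qrep_qnuc n P Pk : hpoly n P -> qrep n P Pk -> qnuc n P.
Proof.
case: n => [|n] hP rP; first by split=> //; left.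
by split=> //; right; exists Pk; exact/completion_repP.
Qed.

Lemma qnuc_qrep n P : qnuc n P -> exists Pk, qrep n P Pk.
Proof.
case: n => [|n] [hP []] // h.
- exists (fun=> P); split=> // [e e0|e e0].
    by exists 0%N => k l _ _; rewrite /ngauge subrr nrm0.
  by exists 0%N => k _ x _; rewrite subrr nrm0 ltW.
- case: h => Pk _; exists (fun=> P); split=> // [e e0|e e0].
    by exists 0%N => k l _ _; rewrite /ngauge subrr nrm0.
  by exists 0%N => k _ x _; rewrite subrr nrm0 ltW.
- by case: h => Pk /completion_repP h; exists Pk; exact: h.
Qed.

Lemma qn_le n P Pk c : qrep n P Pk ->
  (exists N, forall k, (N <= k)%N -> ngauge n (Pk k) <= c) -> (qn n P <= c%:E)%E.
Proof.
move=> rP [N Nc]; case: n rP Nc => [|n] rP Nc.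
  rewrite lee_fin; have [_ _ lP] := rP.
  apply/ler_addgt0Pr => e e0; have [K KP] := lP e e0.
  have := KP _ (leq_maxr N K) 0; rewrite nrm0 ler01 => /(_ erefl).
  have := Nc _ (leq_maxl N K); rewrite /ngauge.
  set a := Pk _ 0; have := nrmB a (a - P 0); rewrite opprB addrC subrK; lra.
have [l [l0 lP]] := qrep_lim rP.
have lc : l <= c.
  apply/ler_addgt0Pr => e e0; have [K KP] := lP e e0.
  have := KP _ (leq_maxr N K); have := Nc _ (leq_maxl N K).
  by rewrite ltr_norml => h /andP[+ _]; lra.
apply: (@le_trans _ _ l%:E); last by rewrite lee_fin.
apply: ereal_inf_lbound; exists Pk; first exact/completion_repP.
have [nPk _ _] := rP.
rewrite (_ : (fun k => _) = (fun k => (gaugeR n.+1 (Pk k))%:E)); last first.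
  by apply/funext => k; rewrite gaugeE//; exact: nPk.
apply: cvg_EFin; first exact: nearW.
apply/cvgrPdist_lt => e e0; have [K KP] := lP e e0.
by exists K => // k /= Kk; rewrite distrC; exact: KP.
Qed.

Lemma qn_rep n P c : qnuc n P -> (qn n P < c%:E)%E ->
  exists2 Pk, qrep n P Pk & exists N, forall k, (N <= k)%N -> ngauge n (Pk k) < c.
Proof.
case: n => [|n].
  rewrite lte_fin => -[hP _] Pc; exists (fun=> P); last by exists 0%N.
  split=> // [e e0|e e0]; exists 0%N => k; first by move=> l _ _; rewrite /ngauge subrr nrm0.
  by move=> _ x _; rewrite subrr nrm0 ltW.
move=> _ /ereal_inf_lt[z [Pk rPk zl] zc].
have {}rPk : qrep n.+1 P Pk by exact/completion_repP.
exists Pk => //; have [l [l0 lP]] := qrep_lim rPk.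
have zE : z = l%:E.
  apply: (cvg_unique _ zl) => //=.
  have [nPk _ _] := rPk.
  rewrite (_ : (fun k => _) = (fun k => (gaugeR n.+1 (Pk k))%:E)); last first.
    by apply/funext => k; rewrite gaugeE//; exact: nPk.
  apply: cvg_EFin; first exact: nearW.
  apply/cvgrPdist_lt => e e0; have [K KP] := lP e e0.
  by exists K => // k /= Kk; rewrite distrC; exact: KP.
move: zc; rewrite zE lte_fin => lc.
have [|N NP] := lP (c - l); first by rewrite subr_gt0.
by exists N => k /NP; rewrite ltr_norml => /andP[_]; lra.
Qed.

Lemma qn_ge0 n P : (0 <= qn n P)%E.
Proof.
case: n => [|n]; first by rewrite lee_fin nrm_ge0.
apply: le_ereal_inf_tmp => z [Pk _ cz].
have <- := cvg_lim _ cz => //.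
apply: lime_ge; first by apply/cvg_ex; exists z.
by apply: nearW => k; exact: bipolar_gauge_ge0.
Qed.

Lemma qnE n P : qnuc n P -> qn n P = (qnR n P)%:E.
Proof.
move=> qP; rewrite /qnR fineK// ge0_fin_numE ?qn_ge0//.
have [Pk rPk] := qnuc_qrep qP; have [l [_ /(_ _ ltr01)[N NP]]] := qrep_lim rPk.
apply: (@le_lt_trans _ _ (l + 1)%:E); last exact: ltry.
apply: qn_le rPk _; exists N => k /NP; rewrite ltr_norml => /andP[_]; lra.
Qed.

Lemma qnR_ge0 n P : 0 <= qnR n P.
Proof. exact/fine_ge0/qn_ge0. Qed.

Lemma qnR_le n P Pk c : hpoly n P -> qrep n P Pk ->
  (exists N, forall k, (N <= k)%N -> ngauge n (Pk k) <= c) -> qnR n P <= c.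
Proof.
move=> hP rP h; rewrite -lee_fin -qnE; first exact: qn_le rP h.
exact: qrep_qnuc rP.
Qed.

Lemma qnR_rep n P e : qnuc n P -> 0 < e -> exists2 Pk, qrep n P Pk &
  exists N, forall k, (N <= k)%N -> ngauge n (Pk k) < qnR n P + e.
Proof. by move=> qP e0; apply: qn_rep => //; rewrite qnE// lte_fin ltrDl. Qed.

Lemma qrep_lin n P1 P2 F1 F2 a : qrep n P1 F1 -> qrep n P2 F2 ->
  qrep n (fun x => a * P1 x + P2 x) (fun k x => a * F1 k x + F2 k x).
Proof.
move=> [n1 c1 l1] [n2 c2 l2]; have a1 : 0 < nrm a + 1 by have := nrm_ge0 a; lra.
split=> [k|e e0|e e0]; first exact: nuc0_lin.
- have [N1 H1] := c1 (e / 2 / (nrm a + 1)) (ltac:(by rewrite !divr_gt0)).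
  have [N2 H2] := c2 (e / 2) (ltac:(by rewrite divr_gt0)).
  exists (maxn N1 N2) => k l; rewrite !geq_max => /andP[k1 k2] /andP[m1 m2].
  rewrite (_ : (fun x => _) = (fun x => a * (F1 k x - F1 l x) + (F2 k x - F2 l x))); last first.
    by apply/funext => x; ring.
  apply: (le_lt_trans (ngauge_lin _ (nuc0_sub (n1 k) (n1 l)) (nuc0_sub (n2 k) (n2 l)))).
  have := H2 k l k2 m2; have := H1 k l k1 m1; rewrite ltr_pdivlMr// mulrC.
  have := ngauge_ge0 n (fun x => F1 k x - F1 l x); set t := ngauge n _; lra.
have [N1 H1] := l1 (e / 2 / (nrm a + 1)) (ltac:(by rewrite !divr_gt0)).
have [N2 H2] := l2 (e / 2) (ltac:(by rewrite divr_gt0)).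
exists (maxn N1 N2) => k; rewrite !geq_max => /andP[k1 k2] x x1.
have -> : a * F1 k x + F2 k x - (a * P1 x + P2 x) =
    a * (F1 k x - P1 x) + (F2 k x - P2 x) by ring.
apply: (le_trans (nrmD _ _)); rewrite nrmM.
have := H2 k k2 x x1; have := H1 k k1 x x1; rewrite ler_pdivlMr// mulrC.
have := nrm_ge0 (F1 k x - P1 x); lra.
Qed.

Lemma qnuc_lin n P1 P2 a : qnuc n P1 -> qnuc n P2 -> qnuc n (fun x => a * P1 x + P2 x).
Proof.
move=> q1 q2; have [F1 r1] := qnuc_qrep q1; have [F2 r2] := qnuc_qrep q2.
by apply: qrep_qnuc (qrep_lin a r1 r2); exact: hpoly_lin q1.1 q2.1.
Qed.

Lemma qnR_lin n P1 P2 a : qnuc n P1 -> qnuc n P2 ->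
  qnR n (fun x => a * P1 x + P2 x) <= nrm a * qnR n P1 + qnR n P2.
Proof.
move=> q1 q2; have a1 : 0 < nrm a + 1 by have := nrm_ge0 a; lra.
apply/ler_addgt0Pr => e e0.
pose d := e / (nrm a + 1).
have d0 : 0 < d by rewrite divr_gt0.
have de : d * (nrm a + 1) = e by rewrite divfK// gt_eqF.
have [F1 r1 [N1 H1]] := qnR_rep q1 d0; have [F2 r2 [N2 H2]] := qnR_rep q2 d0.
apply: qnR_le (qrep_lin a r1 r2) _; first exact: hpoly_lin q1.1 q2.1.
exists (maxn N1 N2) => k; rewrite geq_max => /andP[/H1 h1 /H2 h2].
have [n1 _ _] := r1; have [n2 _ _] := r2.
apply: (le_trans (ngauge_lin _ (n1 k) (n2 k))).
have : nrm a * ngauge n (F1 k) <= nrm a * (qnR n P1 + d).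
  by rewrite ler_wpM2l ?nrm_ge0// ltW.
rewrite mulrDr; move: de; rewrite mulrDr mulr1 mulrC; lra.
Qed.

Lemma qrep_cst n P : nuc0 n P -> qrep n P (fun=> P).
Proof.
move=> nP; split=> // [e e0|e e0].
  exists 0%N => k l _ _; rewrite (_ : (fun x => _) = (fun=> 0)) ?ngauge0//.
  by apply/funext => x; rewrite subrr.
by exists 0%N => k _ x _; rewrite subrr nrm0 ltW.
Qed.

Lemma nuc0_qnuc n P : nuc0 n P -> qnuc n P.
Proof. by move=> nP; apply: qrep_qnuc (qrep_cst nP); exact: nuc0_hpoly. Qed.

Lemma qnR_le_ngauge n P : nuc0 n P -> qnR n P <= ngauge n P.
Proof.
by move=> nP; apply: qnR_le (nuc0_hpoly nP) (qrep_cst nP) _; exists 0%N.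
Qed.

Lemma qnR0 n : qnR n (fun _ : E => 0) = 0.
Proof.
apply/eqP; rewrite eq_le qnR_ge0 andbT -(ngauge0 n).
exact/qnR_le_ngauge/nuc0_0.
Qed.

Lemma qnuc0 n : qnuc n (fun _ : E => 0).
Proof. exact/nuc0_qnuc/nuc0_0. Qed.

Lemma qnR_add n P1 P2 : qnuc n P1 -> qnuc n P2 ->
  qnR n (fun x => P1 x + P2 x) <= qnR n P1 + qnR n P2.
Proof.
move=> h1 h2; have := qnR_lin 1 h1 h2; rewrite nrm1 mul1r.
by under eq_fun do rewrite mul1r.
Qed.

Lemma qnuc_sub n P1 P2 : qnuc n P1 -> qnuc n P2 -> qnuc n (fun x => P1 x - P2 x).
Proof.
by move=> h1 h2; have := qnuc_lin (-1) h2 h1; under eq_fun do rewrite mulN1r addrC.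
Qed.

Lemma qnR_ball n P x : qnuc n P -> nrm x <= 1 -> nrm (P x) <= qnR n P.
Proof.
move=> qP x1; apply/ler_addgt0Pr => e e0; have e2 : 0 < e / 2 by lra.
have [F [nF _ lF] [N FN]] := qnR_rep qP e2; have [K KP] := lF _ e2.
have := KP _ (leq_maxr N K) x x1; have := FN _ (leq_maxl N K).
have := ngauge_ball (nF (maxn N K)) x1.
set a := F _ x; have := nrmB a (a - P x); rewrite opprB addrC subrK; lra.
Qed.

Lemma qnR_approx n P e : qnuc n P -> 0 < e ->
  exists2 F, nuc0 n F & qnR n (fun x => P x - F x) <= e.
Proof.
move=> qP e0; have [Pk [nP cP lP]] := qnuc_qrep qP.
have [N NP] := cP e e0; exists (Pk N) => //.
have hS : hpoly n (fun x => P x - Pk N x).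
  exact: (qnuc_sub qP (nuc0_qnuc (nP N))).1.
apply: (@qnR_le _ _ (fun k x => Pk k x - Pk N x)) => //; last first.
  by exists N => k Nk; apply/ltW/NP.
split=> [k|d d0|d d0]; first exact: nuc0_sub.
- have [M MP] := cP d d0; exists M => k l Mk Ml.
  rewrite (_ : (fun x => _) = (fun x => Pk k x - Pk l x)); first exact: MP.
  by apply/funext => x; ring.
- have [M MP] := lP d d0; exists M => k Mk x x1.
  have -> : Pk k x - Pk N x - (P x - Pk N x) = Pk k x - P x by ring.
  exact: MP.
Qed.

(** Finite combinations of powers [c phi ^ n], as lists of pairs [(c, phi)]. *)
Definition power_sum (g : seq (R[i] * dual E)) n (x : E) : R[i] :=
  \sum_(cf <- g) cf.1 * cf.2 x ^+ n.

Lemma power_sum_cons cf g n :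
  power_sum (cf :: g) n = fun x => cf.1 * cf.2 x ^+ n + power_sum g n x.
Proof. by apply/funext => x; rewrite /power_sum big_cons. Qed.

Lemma nuc0_power_sum g n : nuc0 n (power_sum g n).
Proof.
elim: g => [|cf g IH].
  rewrite (_ : power_sum _ _ = fun=> 0); first exact: nuc0_0.
  by apply/funext => x; rewrite /power_sum big_nil.
by rewrite power_sum_cons; apply: nuc0_lin => //; exact: nuc0_pow.
Qed.

Lemma ngauge_power_sum g n :
  ngauge n (power_sum g n) <= \sum_(cf <- g) nrm cf.1 * nrm cf.2 ^+ n.
Proof.
elim: g => [|cf g IH].
  rewrite big_nil (_ : power_sum _ _ = fun=> 0) ?ngauge0//.
  by apply/funext => x; rewrite /power_sum big_nil.
rewrite power_sum_cons big_cons.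
apply: (le_trans (ngauge_lin _ (nuc0_pow _ _) (nuc0_power_sum _ _))).
by apply: lerD => //; rewrite ler_wpM2l ?nrm_ge0// ngauge_pow.
Qed.

Lemma qnuc_power_sum g n : qnuc n (power_sum g n).
Proof. exact/nuc0_qnuc/nuc0_power_sum. Qed.

(** The partial sums of a nuclear representation converge for the gauge. *)
Lemma qnR_approx_power_sum n P e : qnuc n P -> 0 < e ->
  exists g, qnR n (fun x => P x - power_sum g n x) <= e.
Proof.
case: n => [|n] qP e0.
  exists [:: (P 0, 0)]; rewrite (_ : (fun x => _) = fun=> 0); first by rewrite qnR0 ltW.
  apply/funext => x; rewrite /power_sum big_cons big_nil expr0 mulr1 addr0.
  by rewrite (hpoly0_const qP.1) subrr.
have e2 : 0 < e / 2 by lra.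
have [F nF FP] := qnR_approx qP e2; have [hF [lam [phi [y rF]]]] := nF.
have [K /(_ K (leqnn K)) KP] := gaugeR_tail (ltn0Sn n) e2 hF rF.
exists [seq (lam j * y j, phi j) | j <- iota 0 K].
have -> : power_sum [seq (lam j * y j, phi j) | j <- iota 0 K] n.+1 =
    rep_sum n.+1 lam phi y K.
  apply/funext => x; rewrite /power_sum /rep_sum big_map -(big_mkord xpredT
    (fun j => lam j * phi j x ^+ n.+1 * y j)) /index_iota subn0.
  by apply: eq_bigr => j _ /=; rewrite mulrAC.
have nS : nuc0 n.+1 (fun x => F x - rep_sum n.+1 lam phi y K x).
  by apply: nuclear_sub => //; exact: nuclear_rep_sum.
rewrite (_ : (fun x => _) = fun x => (P x - F x) + (F x - rep_sum n.+1 lam phi y K x)).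
  apply: (le_trans (qnR_add (qnuc_sub qP (nuc0_qnuc nF)) (nuc0_qnuc nS))).
  by have := qnR_le_ngauge nS; rewrite /ngauge; lra.
by apply/funext => x; ring.
Qed.

End NuclearPolynomials.

(** * Limits of homogeneous polynomials and uniqueness of Taylor series *)

Section Polarization.
Context {R : realType}.

(** Inclusion and exclusion: the left-hand side is the expansion of the product over [i]
  of [1] minus the indicator of [i] not being a value of [f]. *)
Lemma sum_subset_sign m (f : {ffun 'I_m -> 'I_m}) :
  \sum_(S : {set 'I_m}) (-1) ^+ #|~: S| * (\prod_j (f j \in S)%:R) =
  (injectiveb f)%:R :> R[i].
Proof.
pose a (i : 'I_m) : R[i] := - (i \notin codom f)%:R.
have E (S : {set 'I_m}) : (-1) ^+ #|~: S| * (\prod_j (f j \in S)%:R) =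
    \prod_i (if i \in S then 1 else a i).
  have -> : (-1) ^+ #|~: S| = \prod_i (if i \in S then 1 else -1) :> R[i].
    rewrite -prodr_const big_mkcond/=; apply: eq_bigr => i _.
    by rewrite inE; case: (i \in S).
  case: (boolP [forall j, f j \in S]) => [/forallP fS|].
    rewrite [X in _ * X]big1 ?mulr1 => [|j _]; last by rewrite fS.
    apply: eq_bigr => i _; case: ifPn => // iS; rewrite /a.
    case: (boolP (i \in codom f)) => //= /codomP[j ij].
    by move: iS; rewrite ij fS.
  rewrite negb_forall => /existsP[j jS].
  rewrite [X in _ * X](bigD1 j)//= (negbTE jS) mul0r mulr0.
  by rewrite (bigD1 (f j))//= (negbTE jS) /a codom_f/= oppr0 mul0r.
under eq_bigr => S _ do rewrite E.
transitivity (\prod_i (1 + a i)); first by rewrite bigA_distr.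
case: (boolP (injectiveb f)) => [/injectiveP fi|nfi].
  rewrite big1// => i _; rewrite /a.
  by rewrite -(f_invF fi i) codom_f oppr0 addr0.
have [i icf] : exists i, i \notin codom f.
  apply: contrapT => /forallNP H; move: nfi => /negP; apply; apply/injectiveP.
  suff : #|codom f| == #|'I_m| by move=> /image_injP fi x y; exact: fi.
  apply/eqP/eq_card => i; rewrite [RHS]inE; have /negP := H i; rewrite negbK => icf.
  by rewrite icf.
by rewrite (bigD1 i)//= /a icf subrr mul0r.
Qed.

(** Expanding the powers, the signs leave only the terms indexed by permutations. *)
Lemma polarization_identity m (t : 'I_m -> R[i]) :
  \sum_(S : {set 'I_m}) (-1) ^+ #|~: S| * (\sum_(i in S) t i) ^+ m =
  m`!%:R * \prod_i t i.
Proof.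
have E (S : {set 'I_m}) : (\sum_(i in S) t i) ^+ m =
    \sum_(f : {ffun 'I_m -> 'I_m}) (\prod_j (f j \in S)%:R) * \prod_j t (f j).
  have -> : (\sum_(i in S) t i) ^+ m = \prod_(j < m) \sum_i (if i \in S then t i else 0).
    by rewrite prodr_const card_ord big_mkcond.
  rewrite (bigA_distr_bigA (fun (j i : 'I_m) => if i \in S then t i else 0)).
  apply: eq_bigr => f _; rewrite -big_split/=; apply: eq_bigr => j _.
  by case: ifPn => _; rewrite ?mul1r ?mul0r.
transitivity (\sum_(S : {set 'I_m}) \sum_(f : {ffun 'I_m -> 'I_m})
    (-1) ^+ #|~: S| * ((\prod_j (f j \in S)%:R) * \prod_j t (f j))).
  by apply: eq_bigr => S _; rewrite E mulr_sumr.
rewrite exchange_big/=.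
transitivity (\sum_(f : {ffun 'I_m -> 'I_m}) (injectiveb f)%:R * \prod_j t j).
  apply: eq_bigr => f _; under eq_bigr => S _ do rewrite mulrA.
  rewrite -mulr_suml sum_subset_sign.
  case: (boolP (injectiveb f)) => [/injectiveP fi|_]; last by rewrite !mul0r.
  by rewrite !mul1r [RHS](reindex_inj fi).
rewrite -mulr_suml; congr (_ * _); rewrite -natr_sum; congr (_%:R).
rewrite -[RHS]ffactnn -[in RHS](card_ord m) -card_inj_ffuns -sum1_card [RHS]big_mkcond/=.
by apply: eq_bigr => f _; rewrite inE; case: injectiveb.
Qed.

End Polarization.

Section HomogeneousLimits.
Context {R : realType} {X : normedModType R[i]}.

(** The multilinear form is recovered from the limit by polarization. *)
Lemma hpoly_lim m (g : nat -> seq (R[i] * dual X)) (T : X -> R[i]) :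
  (forall t e, 0 < t -> 0 < e -> exists N, forall k, (N <= k)%N ->
     forall x, nrm x <= t -> nrm (T x - \sum_(cf <- g k) cf.1 * cf.2 x ^+ m) <= e) ->
  hpoly m T.
Proof.
move=> gT; pose P k x := \sum_(cf <- g k) cf.1 * cf.2 x ^+ m.
have hP k : hpoly m (P k).
  rewrite /P; elim: (g k) => [|cf s IH].
    by apply: hpoly_ext (hpoly0 m) => x; rewrite big_nil.
  apply: hpoly_ext (hpoly_lin cf.1 (hpoly_pow m cf.2) IH) => x.
  by rewrite big_cons.
have lP x : seqlim (fun k => P k x) (T x).
  move=> e e0; have [|N NP] := gT (nrm x + 1) (e / 2) _ (ltac:(by rewrite divr_gt0)).
    by have := nrm_ge0 x; lra.
  exists N => k Nk; rewrite nrm_distC; apply: le_lt_trans (NP k Nk x _) _; last lra.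
  by rewrite lerDl.
pose A0 k (v : 'I_m -> X) := \sum_(cf <- g k) cf.1 * \prod_i cf.2 (v i).
pose pol (Q : X -> R[i]) (v : 'I_m -> X) :=
  m`!%:R^-1 * \sum_(S : {set 'I_m}) (-1) ^+ #|~: S| * Q (\sum_(i in S) v i).
have mf0 : m`!%:R != 0 :> R[i] by rewrite pnatr_eq0 -lt0n fact_gt0.
have polP k v : pol (P k) v = A0 k v.
  apply: (mulfI mf0); rewrite /pol mulVKf//.
  rewrite /P /A0; under eq_bigr => S _ do rewrite mulr_sumr.
  rewrite exchange_big/= mulr_sumr; apply: eq_bigr => cf _.
  rewrite mulrCA -polarization_identity mulr_sumr; apply: eq_bigr => S _.
  rewrite mulrCA; congr (_ * (_ * _ ^+ _)).
  by elim/big_ind2 : _ => [|x1 x2 y1 y2 <- <-|]//; rewrite ?dual0// dualD.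
have lpol v : seqlim (fun k => A0 k v) (pol T v).
  have lsum (I : Type) (s : seq I) (F : nat -> I -> R[i]) (l : I -> R[i]) :
      (forall i, seqlim (fun k => F k i) (l i)) ->
      seqlim (fun k => \sum_(i <- s) F k i) (\sum_(i <- s) l i).
    move=> Fl; elim: s => [|i s IH] e e0.
      by exists 0%N => k _; rewrite !big_nil subrr nrm0.
    have e2 : 0 < e / 2 by lra.
    have [N1 H1] := Fl i _ e2; have [N2 H2] := IH _ e2.
    exists (maxn N1 N2) => k; rewrite geq_max => /andP[/H1 h1 /H2 h2].
    rewrite !big_cons opprD addrACA; apply: (le_lt_trans (nrmD _ _)); lra.
  have lmul (u : nat -> R[i]) l (a : R[i]) : seqlim u l -> seqlim (fun k => a * u k) (a * l).
    by move=> ul; apply: seqlimM ul => e e0; exists 0%N => k _; rewrite subrr nrm0.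
  rewrite (_ : (fun k => A0 k v) = fun k => pol (P k) v); last first.
    by apply/funext => k; rewrite polP.
  by apply: (lmul); apply: lsum => S; exact: lmul.
split.
  apply/continuous_nrmP => x e e0; have e3 : 0 < e / 4 by lra.
  have [|N NP] := gT (nrm x + 1) (e / 4) _ e3; first by have := nrm_ge0 x; lra.
  have [d d0 dP] := (continuous_nrmP (P N)).1 (hP N).1 x _ e3.
  exists (Num.min 1 d); first by rewrite lt_min ltr01.
  move=> y; rewrite lt_min => /andP[y1 /dP yd].
  have ny : nrm y <= nrm x + 1.
    by have := nrmD (y - x) x; rewrite subrK; lra.
  have nx : nrm x <= nrm x + 1 by lra.
  have := NP N (leqnn N) y ny; have := NP N (leqnn N) x nx.
  rewrite -/(P N x) -/(P N y) => h1 h2.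
  have -> : T y - T x = (T y - P N y) + (P N y - P N x) - (T x - P N x) by ring.
  have := nrmB (T y - P N y + (P N y - P N x)) (T x - P N x).
  have := nrmD (T y - P N y) (P N y - P N x); lra.
exists (pol T); last first.
  move=> x; apply: (seqlim_uniq (lP x)); rewrite (_ : (fun k => P k x) = fun k => A0 k (fun=> x)).
    exact: lpol.
  apply/funext => k; apply: eq_bigr => cf _.
  by rewrite prodr_const card_ord.
move=> v i a x y /=.
have mA0 k : multilinear (A0 k).
  rewrite /A0; move=> w j b z z' /=; rewrite mulr_sumr -big_split/=.
  apply: eq_bigr => cf _.
  have E u : \prod_l cf.2 (if l == j then u else w l) =
      cf.2 u * \prod_(l < m | l != j) cf.2 (w l).
    rewrite (bigD1 j)//= eqxx; congr (_ * _).
    by apply: eq_bigr => l /negbTE ->.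
  by rewrite !E dualD dualZ; ring.
apply: (seqlim_uniq (lpol _)).
rewrite (_ : (fun k => _) = fun k => a * A0 k (fun j => if j == i then x else v j) +
  A0 k (fun j => if j == i then y else v j)); last by apply/funext => k; have /= := mA0 k v i a x y.
move=> e e0; have a1 : 0 < nrm a + 1 by have := nrm_ge0 a; lra.
have [N1 H1] := lpol (fun j => if j == i then x else v j) (e / 2 / (nrm a + 1))
  (ltac:(by rewrite !divr_gt0)).
have [N2 H2] := lpol (fun j => if j == i then y else v j) (e / 2) (ltac:(by rewrite divr_gt0)).
exists (maxn N1 N2) => k; rewrite geq_max => /andP[/H1 + /H2].
set u := A0 k _; set w := A0 k _; set l := pol T _; set l' := pol T _ => h1 h2.
have -> : a * u + w - (a * l + l') = a * (u - l) + (w - l') by ring.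
apply: (le_lt_trans (nrmD _ _)); rewrite nrmM.
by move: h1; rewrite ltr_pdivlMr// mulrC; have := nrm_ge0 (u - l); lra.
Qed.

End HomogeneousLimits.

Section TaylorUniqueness.
Context {R : realType} {X : normedModType R[i]}.
Implicit Types (f g : X -> R[i]) (P Q : nat -> X -> R[i]).

Lemma taylor_lin f g a P Q (b : R[i]) : taylor_at f a P -> taylor_at g a Q ->
  taylor_at (fun x => b * f x + g x) a (fun m x => b * P m x + Q m x).
Proof.
move=> [hP [d d0 fP]] [hQ [d' d0' gQ]]; split; first by move=> m; exact: hpoly_lin.
exists (Num.min d d'); first by rewrite lt_min d0.
move=> e e0; have b1 : 0 < nrm b + 1 by have := nrm_ge0 b; lra.
have [N1 _ H1] := fP (e / 2 / (nrm b + 1)) (ltac:(by rewrite !divr_gt0)).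
have [N2 _ H2] := gQ (e / 2) (ltac:(by rewrite divr_gt0)).
exists (maxn N1 N2) => // k /=; rewrite geq_max => /andP[/H1 h1 /H2 h2] x.
rewrite lt_min => /andP[/h1 + /h2]; set p := \sum_(m < k) P m _; set q := \sum_(m < k) Q m _.
move=> {}h1 {}h2; rewrite big_split/= -mulr_sumr -/p -/q.
have -> : b * f x + g x - (b * p + q) = b * (f x - p) + (g x - q) by ring.
apply: (le_lt_trans (nrmD _ _)); rewrite nrmM.
by move: h1; rewrite ltr_pdivlMr// mulrC; have := nrm_ge0 (f x - p); lra.
Qed.

(** Cauchy's estimate for the partial sums along a complex line. *)
Lemma taylor_zero a P : taylor_at (fun=> 0) a P -> forall m x, P m x = 0.
Proof.
move=> [hP [d d0 fP]] m x.
pose t := d / 2 / (nrm x + 1).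
have x1 : 0 < nrm x + 1 by have := nrm_ge0 x; lra.
have t0 : 0 < t by rewrite !divr_gt0.
have tx : t * nrm x < d.
  have : t * (nrm x + 1) = d / 2 by rewrite divfK// gt_eqF.
  rewrite mulrDr mulr1; lra.
have tC : (t%:C : R[i]) != 0 by rewrite real_complex_eq0 gt_eqF.
suff Ptx : P m (t%:C *: x) = 0.
  have := hpoly_scale t%:C x (hP m); rewrite Ptx => /esym/eqP.
  by rewrite mulf_eq0 expf_eq0 (negbTE tC) andbF => /eqP.
apply/nrm_eq0/eqP; rewrite eq_le nrm_ge0 andbT; apply/ler_addgt0Pr => e e0; rewrite add0r.
have [N _ NP] := fP e e0; pose k := maxn N m.+1.
have /= kP := NP k (leq_maxl _ _).
pose p := \poly_(i < k) P i (t%:C *: x).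
have -> : P m (t%:C *: x) = p`_m by rewrite coef_poly leq_maxr.
apply: poly_cauchy => z z1.
have -> : p.[z] = \sum_(i < k) P i (a + z *: (t%:C *: x) - a).
  rewrite horner_poly; apply: eq_bigr => i _.
  by rewrite addrAC subrr add0r (hpoly_scale z (t%:C *: x) (hP i)) mulrC.
have := kP (a + z *: (t%:C *: x)); rewrite sub0r nrmN => h; apply/ltW/h.
rewrite addrAC subrr add0r !nrmZ nrm_real gtr0_norm//; apply: le_lt_trans tx.
by rewrite ler_piMl// mulr_ge0 ?nrm_ge0// ltW.
Qed.

Lemma taylor_uniq f a P Q : taylor_at f a P -> taylor_at f a Q ->
  forall m x, P m x = Q m x.
Proof.
move=> fP fQ m x; have h := taylor_lin (-1) fP fQ.
have -> : P m x = Q m x - (-1 * P m x + Q m x) by ring.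
rewrite (@taylor_zero a (fun m x => -1 * P m x + Q m x)) ?subr0//.
by rewrite (_ : (fun=> 0) = (fun x => -1 * f x + f x))//; apply/funext => y; ring.
Qed.

Lemma dhatE f P m : taylor_at f 0 P -> dhat m f = fun x => m`!%:R * P m x.
Proof.
move=> fP; apply/funext => x; rewrite /dhat; congr (_ * _).
case: xgetP => [Q _ fQ|/(_ P)//]; exact: taylor_uniq fQ fP m x.
Qed.

Lemma dhat_taylor f : entire f ->
  taylor_at f 0 (fun m x => m`!%:R^-1 * dhat m f x).
Proof.
move=> /(_ 0)[P fP]; rewrite (_ : (fun m x => _) = P)//.
apply/funext => m; apply/funext => x; by rewrite (dhatE m fP) mulKf.
Qed.

Lemma dhat_lin f g (b : R[i]) m : entire f -> entire g ->
  dhat m (fun x => b * f x + g x) = fun x => b * dhat m f x + dhat m g x.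
Proof.
move=> ef eg; rewrite (dhatE m (taylor_lin b (dhat_taylor ef) (dhat_taylor eg))).
by apply/funext => x; field; rewrite pnatr_eq0 -lt0n fact_gt0.
Qed.

Lemma entire_lin f g (b : R[i]) : entire f -> entire g ->
  entire (fun x => b * f x + g x).
Proof.
move=> ef eg a; have [P fP] := ef a; have [Q gQ] := eg a.
by exists (fun m x => b * P m x + Q m x); exact: taylor_lin.
Qed.

End TaylorUniqueness.

(** * Membership in the space of entire functions *)

Section WeightedSums.
Context {R : realType}.

Definition weighted_sum (rho : R) (b : nat -> R) (M : nat) : R :=
  \sum_(m < M) rho ^+ m / m`!%:R * b m.

(** A bound for the sum of the series; stating bounds rather than sums avoids all
  questions of convergence. *)
Definition summable (rho : R) (b : nat -> R) (B : R) : Prop :=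
  forall M, weighted_sum rho b M <= B.

Lemma weight_ge0 (rho : R) m : 0 <= rho -> 0 <= rho ^+ m / m`!%:R.
Proof. by move=> r0; rewrite divr_ge0// exprn_ge0. Qed.

Lemma weighted_sum_le rho (b c : nat -> R) M : 0 <= rho ->
  (forall m, b m <= c m) -> weighted_sum rho b M <= weighted_sum rho c M.
Proof.
by move=> r0 bc; apply: ler_sum => m _; rewrite ler_wpM2l ?weight_ge0.
Qed.

Lemma summable_le rho (b c : nat -> R) B : 0 <= rho ->
  (forall m, b m <= c m) -> summable rho c B -> summable rho b B.
Proof. by move=> r0 bc cB M; apply: le_trans (cB M); exact: weighted_sum_le. Qed.

Lemma weighted_sumD rho (b c : nat -> R) M :
  weighted_sum rho (fun m => b m + c m) M = weighted_sum rho b M + weighted_sum rho c M.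
Proof. by rewrite -big_split/=; apply: eq_bigr => m _; rewrite mulrDr. Qed.

Lemma weighted_sumZ rho (b : nat -> R) a M :
  weighted_sum rho (fun m => a * b m) M = a * weighted_sum rho b M.
Proof. by rewrite mulr_sumr; apply: eq_bigr => m _; rewrite mulrCA. Qed.

Lemma summableD rho (b c : nat -> R) B C : summable rho b B -> summable rho c C ->
  summable rho (fun m => b m + c m) (B + C).
Proof. by move=> bB cC M; rewrite weighted_sumD lerD. Qed.

Lemma summableZ rho (b : nat -> R) a B : 0 <= a -> summable rho b B ->
  summable rho (fun m => a * b m) (a * B).
Proof. by move=> a0 bB M; rewrite weighted_sumZ ler_wpM2l. Qed.

Lemma summable_term rho (b : nat -> R) B m : 0 <= rho -> (forall m, 0 <= b m) ->
  summable rho b B -> rho ^+ m / m`!%:R * b m <= B.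
Proof.
move=> r0 b0 /(_ m.+1); apply: le_trans; rewrite /weighted_sum big_ord_recr/= lerDr.
by apply: sumr_ge0 => i _; rewrite mulr_ge0// weight_ge0.
Qed.

Lemma summable_mono (rho t : R) (b : nat -> R) B : 0 <= t -> t <= rho ->
  (forall m, 0 <= b m) -> summable rho b B -> summable t b B.
Proof.
move=> t0 tr b0 bB M; apply: le_trans (bB M); apply: ler_sum => m _.
rewrite ler_wpM2r// ler_wpM2r ?invr_ge0// lerXn2r ?nnegrE//.
exact: le_trans tr.
Qed.

(** Weighted exponentials with the first [N] terms removed. *)
Lemma summable_exp (rho a C : R) (b : nat -> R) N : 0 <= rho -> 0 <= a -> 0 <= C ->
  (forall m, (m < N)%N -> b m <= 0) ->
  (forall m, (N <= m)%N -> b m <= C * a ^+ m) ->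
  summable rho b (C * exp_tail (rho * a) N).
Proof.
move=> r0 a0 C0 b0 bC M; rewrite /weighted_sum.
rewrite -(big_mkord xpredT (fun m => rho ^+ m / m`!%:R * b m)).
apply: (@le_trans _ _ (\sum_(N <= m < M) C * ((rho * a) ^+ m / m`!%:R))); last first.
  by rewrite -mulr_sumr ler_wpM2l// sum_exp_le_tail// mulr_ge0.
have term m : (N <= m)%N -> rho ^+ m / m`!%:R * b m <= C * ((rho * a) ^+ m / m`!%:R).
  move=> Nm; apply: (@le_trans _ _ (rho ^+ m / m`!%:R * (C * a ^+ m))).
    by rewrite ler_wpM2l ?weight_ge0 ?bC.
  by rewrite exprMn le_eqVlt; apply/orP; left; apply/eqP; ring.
have neg m : (m < N)%N -> rho ^+ m / m`!%:R * b m <= 0.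
  by move=> mN; rewrite mulr_ge0_le0 ?weight_ge0 ?b0.
have [NM|MN] := leqP N M; last first.
  rewrite [leRHS]big_geq ?(ltnW MN)// big_nat; apply: sumr_le0 => m /andP[_ mM].
  by apply/neg/(ltn_trans mM).
rewrite (big_cat_nat _ NM)//= -[leRHS]add0r; apply: lerD.
  by rewrite big_nat; apply: sumr_le0 => m /andP[_]; exact: neg.
by apply: ler_sum_nat => m /andP[Nm _]; exact: term.
Qed.

End WeightedSums.

Section HNbMembership.
Context {R : realType} {E : normedModType R[i]} {r q s p : R}.
Hypothesis ok : @exponents_ok R r q s p.
Notation qnuc := (quasi_nuclear r q s p).
Notation qnorm := (@qnR R E r q s p).
Implicit Types f : E -> R[i].

Lemma HNb_seminorm_leP (rho B : R) f : 0 <= rho ->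
  (forall m, qnuc m (dhat m f)) ->
  (HNb_seminorm r q s p rho f <= B%:E)%E <->
  summable rho (fun m => qnorm m (dhat m f)) B.
Proof.
move=> r0 qf; rewrite /HNb_seminorm nneseries_leP => [|m _]; last first.
  by rewrite mule_ge0 ?lee_fin ?weight_ge0 ?qn_ge0.
have E1 M : (\sum_(0 <= m < M) (rho ^+ m / m`!%:R)%:E *
    quasi_nuclear_norm r q s p m (dhat m f))%E =
    (weighted_sum rho (fun m => qnorm m (dhat m f)) M)%:E.
  rewrite /weighted_sum -(big_mkord xpredT (fun m => rho ^+ m / m`!%:R * qnorm m (dhat m f))).
  rewrite -sumEFin; apply: eq_bigr => m _; by rewrite (qnE ok (qf m)) -EFinM.
by split=> h M; have := h M; rewrite E1 lee_fin.
Qed.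

(** The root condition says that the norms decay faster than any geometric
  sequence, that is, that all the seminorms are finite. *)
Lemma HNb_setP f : HNb_set r q s p f <->
  [/\ entire f, (forall m, qnuc m (dhat m f)) &
      forall rho, 0 < rho -> exists B, summable rho (fun m => qnorm m (dhat m f)) B].
Proof.
have uE m : qnuc m (dhat m f) -> (((m`!%:R^-1)%:E * quasi_nuclear_norm r q s p m (dhat m f))
    `^ m%:R^-1)%E = ((m`!%:R^-1 * qnorm m (dhat m f)) `^ m%:R^-1)%:E.
  by move=> qm; rewrite (qnE ok qm) -EFinM poweR_EFin.
have v0 m : 0 <= m`!%:R^-1 * qnorm m (dhat m f).
  by rewrite mulr_ge0 ?invr_ge0// qnR_ge0.
split=> [[ef qf lf]|[ef qf sf]]; split=> //.
  move=> rho r0; move: lf.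
  rewrite (_ : (fun m => _) = (fun m => ((m`!%:R^-1 * qnorm m (dhat m f)) `^ m%:R^-1)%:E));
    last by apply/funext => m; exact: uE.
  move=> /fine_cvgP[_ /cvgrPdist_lt lf].
  have d0 : 0 < (2 * rho)^-1 by rewrite invr_gt0 mulr_gt0.
  have [N _ NP] := lf _ d0.
  have tail m : (maxn N 1 <= m)%N -> rho ^+ m / m`!%:R * qnorm m (dhat m f) <= 2^-1 ^+ m.
    rewrite geq_max => /andP[Nm m0]; have /= := NP m Nm.
    rewrite sub0r normrN ger0_norm ?powR_ge0// => /ltW h.
    have : (m`!%:R^-1 * qnorm m (dhat m f)) <= ((2 * rho)^-1) ^+ m.
      have mR : 0 < m%:R :> R by rewrite ltr0n.
      have := ge0_ler_powR (ltW mR) _ _ h; rewrite !nnegrE powR_ge0 (ltW d0) => /(_ erefl erefl).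
      by rewrite -powRrM mulVf ?gt_eqF// powRr1// powR_mulrn// ltW.
    rewrite -mulrA => /(ler_wpM2l (exprn_ge0 m (ltW r0))) /le_trans; apply.
    by rewrite -exprMn invfM mulrCA mulfV ?gt_eqF// mulr1.
  pose K := maxn N 1.
  exists (\sum_(m < K) rho ^+ m / m`!%:R * qnorm m (dhat m f) + 2) => M.
  have t0 m : 0 <= rho ^+ m / m`!%:R * qnorm m (dhat m f).
    by rewrite mulr_ge0 ?weight_ge0 ?qnR_ge0// ltW.
  apply: (@le_trans _ _ (weighted_sum rho (fun m => qnorm m (dhat m f)) (maxn K M))).
    rewrite /weighted_sum -!(big_mkord xpredT (fun m => rho ^+ m / m`!%:R * qnorm m (dhat m f))).
    by rewrite [leRHS](big_cat_nat _ (leq_maxr K M))//= lerDl sumr_ge0.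
  rewrite /weighted_sum -!(big_mkord xpredT (fun m => rho ^+ m / m`!%:R * qnorm m (dhat m f))).
  rewrite [leLHS](big_cat_nat _ (leq_maxl K M))//= lerD2l.
  apply: (@le_trans _ _ (\sum_(m < maxn K M) 2^-1 ^+ m)); last first.
    by apply: sum_geometric_le2; rewrite invr_ge0 lexx andbT.
  rewrite -(big_mkord xpredT (fun m => 2^-1 ^+ m)) [leRHS](big_cat_nat _ (leq_maxl K M))//=.
  apply: ler_wpDl; first by apply: sumr_ge0 => m _; rewrite exprn_ge0// invr_ge0.
  by apply: ler_sum_nat => m /andP[Km _]; exact: tail.
rewrite (_ : (fun m => _) = (fun m => ((m`!%:R^-1 * qnorm m (dhat m f)) `^ m%:R^-1)%:E));
  last by apply/funext => m; exact: uE.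
apply: cvg_EFin; first exact: nearW.
apply/cvgrPdist_lt => e e0.
have e2 : 0 < 2 / e by rewrite divr_gt0.
have [B sB] := sf _ e2.
have [N NB] : exists N : nat, B < 2 ^+ N.
  exists (Num.truncn B).+1; apply: (lt_trans (truncnS_gt B)).
  by rewrite -natrX ltr_nat; exact: ltn_expl.
exists (maxn N 1) => // m /=; rewrite geq_max => /andP[Nm m0].
have mR : 0 < m%:R :> R by rewrite ltr0n.
rewrite sub0r normrN ger0_norm ?powR_ge0//.
have q0 m0' : 0 <= qnorm m0' (dhat m0' f) by exact: qnR_ge0.
have := summable_term m (ltW e2) q0 sB.
rewrite expr_div_n -2!mulrA => h.
have em : 0 < e ^+ m by exact: exprn_gt0.
have : m`!%:R^-1 * qnorm m (dhat m f) < e ^+ m.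
  have : 2 ^+ m * (e ^- m * (m`!%:R^-1 * qnorm m (dhat m f))) < 2 ^+ m.
    apply: (le_lt_trans h); apply: (lt_le_trans NB).
    by rewrite ler_eXn2l// ltr1n.
  rewrite gtr_pMr ?exprn_gt0// mulrC => h'.
  by rewrite -[ltRHS]mul1r -ltr_pdivrMr.
move=> h1; have eE : e = (e ^+ m) `^ m%:R^-1.
  by rewrite -powR_mulrn ?(ltW e0)// -powRrM mulfV ?gt_eqF// powRr1 ?(ltW e0).
rewrite [ltRHS]eE; apply: gt0_ltr_powR; rewrite ?nnegrE ?invr_gt0//.
exact: ltW.
Qed.

End HNbMembership.

(** * Exponential sums and their limits *)

Section ExponentialSums.
Context {R : realType} {E : normedModType R[i]}.
Implicit Types (g h : seq (R[i] * dual E)) (x y a : E).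

Definition exp_sum g x : R[i] := \sum_(cf <- g) cf.1 * cexp (cf.2 x).

Definition scale_coef (b : R[i]) g := [seq (b * cf.1, cf.2) | cf : R[i] * dual E <- g].

Definition translate_coef a g := [seq (cf.1 * cexp (cf.2 a), cf.2) | cf : R[i] * dual E <- g].

Lemma power_sum_cat g h m x :
  power_sum (g ++ h) m x = power_sum g m x + power_sum h m x.
Proof. by rewrite /power_sum big_cat. Qed.

Lemma power_sum_scale b g m x : power_sum (scale_coef b g) m x = b * power_sum g m x.
Proof.
by rewrite /power_sum big_map mulr_sumr; apply: eq_bigr => cf _ /=; rewrite mulrA.
Qed.

Lemma power_sum_sub g h m x :
  power_sum (g ++ scale_coef (-1) h) m x = power_sum g m x - power_sum h m x.
Proof. by rewrite power_sum_cat power_sum_scale mulN1r. Qed.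

Lemma power_sumZ g m b x : power_sum g m (b *: x) = b ^+ m * power_sum g m x.
Proof.
rewrite /power_sum mulr_sumr; apply: eq_bigr => cf _.
by rewrite dualZ exprMn mulrCA.
Qed.

Lemma exp_sum_cat g h x : exp_sum (g ++ h) x = exp_sum g x + exp_sum h x.
Proof. by rewrite /exp_sum big_cat. Qed.

Lemma exp_sum_scale b g x : exp_sum (scale_coef b g) x = b * exp_sum g x.
Proof.
by rewrite /exp_sum big_map mulr_sumr; apply: eq_bigr => cf _ /=; rewrite mulrA.
Qed.

Lemma exp_sum_sub g h x :
  exp_sum (g ++ scale_coef (-1) h) x = exp_sum g x - exp_sum h x.
Proof. by rewrite exp_sum_cat exp_sum_scale mulN1r. Qed.

Lemma exp_sum_translate a g y : exp_sum (translate_coef a g) y = exp_sum g (a + y).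
Proof.
by rewrite /exp_sum big_map; apply: eq_bigr => cf _ /=; rewrite dualD cexpD mulrA.
Qed.

Lemma power_sum_translate0 g m x : power_sum (translate_coef 0 g) m x = power_sum g m x.
Proof.
by rewrite /power_sum big_map; apply: eq_bigr => cf _ /=; rewrite dual0 cexp0 mulr1.
Qed.

Lemma translate_sub a g h : translate_coef a (g ++ scale_coef (-1) h) =
  translate_coef a g ++ scale_coef (-1) (translate_coef a h).
Proof.
rewrite /translate_coef /scale_coef map_cat -!map_comp; congr (_ ++ _).
by apply: eq_map => cf /=; rewrite mulrA.
Qed.

Lemma exp_sum_taylor g (t e : R) : 0 <= t -> 0 < e -> exists N, forall M, (N <= M)%N ->
  forall x, nrm x <= t ->
  nrm (exp_sum g x - \sum_(m < M) power_sum g m x / m`!%:R) <= e.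
Proof.
move=> t0; elim: g e => [|cf g IH] e e0.
  exists 0%N => M _ x _; rewrite /exp_sum big_nil big1 ?subrr ?nrm0 ?ltW// => m _.
  by rewrite /power_sum big_nil mul0r.
have e2 : 0 < e / 2 by lra.
have c1 : 0 < nrm cf.1 + 1 by have := nrm_ge0 cf.1; lra.
have [N1 H1] := IH _ e2.
have [N2 H2] := @exp_tail_lt R (nrm cf.2 * t) (e / 2 / (nrm cf.1 + 1))
  (ltac:(by rewrite !divr_gt0)).
exists (maxn N1 N2) => M; rewrite geq_max => /andP[/H1 h1 /H2 h2] x xt.
rewrite /exp_sum big_cons -/(exp_sum g x).
have -> : \sum_(m < M) power_sum (cf :: g) m x / m`!%:R =
    cf.1 * (\sum_(m < M) cf.2 x ^+ m / m`!%:R) + \sum_(m < M) power_sum g m x / m`!%:R.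
  rewrite mulr_sumr -big_split/=; apply: eq_bigr => m _.
  by rewrite power_sum_cons mulrDl mulrA.
set S := \sum_(m < M) cf.2 x ^+ m / _; set T := \sum_(m < M) power_sum g m x / _.
have -> : cf.1 * cexp (cf.2 x) + exp_sum g x - (cf.1 * S + T) =
    cf.1 * (cexp (cf.2 x) - S) + (exp_sum g x - T) by ring.
apply: (le_trans (nrmD _ _)); rewrite nrmM.
have fx : nrm (cf.2 x) <= nrm cf.2 * t.
  by rewrite (le_trans (dual_le _ _))// ler_wpM2l ?nrm_ge0.
have := cexp_tail M fx; rewrite -/S => h3; have := h1 x xt; rewrite -/T.
move: h2; rewrite ltr_pdivlMr// => h2.
have : nrm cf.1 * nrm (cexp (cf.2 x) - S) <= exp_tail (nrm cf.2 * t) M * (nrm cf.1 + 1).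
  by rewrite mulrC ler_pM ?nrm_ge0//; lra.
lra.
Qed.

(** Cauchy's estimate on the complex lines through [a]. *)
Lemma power_sum_cauchy g a (t B : R) : 0 <= t ->
  (forall y, nrm y <= t -> nrm (exp_sum g (a + y)) <= B) ->
  forall m y, nrm y <= t -> nrm (power_sum (translate_coef a g) m y / m`!%:R) <= B.
Proof.
move=> t0 gB m y yt; apply/ler_addgt0Pr => e e0.
have [N NP] := exp_sum_taylor (translate_coef a g) t0 e0.
pose M := maxn N m.+1.
pose p := \poly_(i < M) (power_sum (translate_coef a g) i y / i`!%:R).
have -> : power_sum (translate_coef a g) m y / m`!%:R = p`_m.
  by rewrite coef_poly leq_maxr.
apply: poly_cauchy => z z1.
have zy : nrm (z *: y) <= t.
  by rewrite nrmZ; apply: le_trans yt; rewrite ler_piMl ?nrm_ge0.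
have := NP M (leq_maxl _ _) (z *: y) zy; rewrite exp_sum_translate.
have -> : \sum_(i < M) power_sum (translate_coef a g) i (z *: y) / i`!%:R = p.[z].
  by rewrite horner_poly; apply: eq_bigr => i _; rewrite power_sumZ; ring.
have := gB _ zy; set u := exp_sum _ _.
have := nrmB u (u - p.[z]); rewrite opprB addrC subrK; lra.
Qed.

End ExponentialSums.

Section HNbLimits.
Context {R : realType} {E : normedModType R[i]} {r q s p : R}.
Hypothesis ok : @exponents_ok R r q s p.
Notation qnuc := (quasi_nuclear r q s p).
Notation qnorm := (@qnR R E r q s p).
Notation gnorm := (@ngauge R E r q s p).
Notation gnuc := (@nuc0 R E r q s p).
Implicit Types (g h : seq (R[i] * dual E)) (x y a : E).

(** For sums of powers the gauge is bounded in terms of the coefficients and the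
  functionals alone, and it dominates the quasi-nuclear norm. *)
Definition gauge_summable (rho : R) g B :=
  summable rho (fun m => gnorm m (power_sum g m)) B.

Lemma gauge_summable_exp_sum rho g B x : 0 <= rho -> nrm x <= rho ->
  gauge_summable rho g B -> nrm (exp_sum g x) <= B.
Proof.
move=> r0 xr gB; apply/ler_addgt0Pr => e e0.
have [N /(_ N (leqnn N) x xr)] := exp_sum_taylor g r0 e0.
have : nrm (\sum_(m < N) power_sum g m x / m`!%:R) <= B.
  apply: le_trans (gB N); rewrite (le_trans (nrm_sum _ _ _))//; apply: ler_sum => m _.
  rewrite nrmM nrmV nrm_nat mulrAC ler_wpM2r ?invr_ge0//.
  have nP := nuc0_power_sum ok g m.
  have hx := @hpoly_ball R E m (power_sum g m) (gnorm m (power_sum g m))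
    (nuc0_hpoly nP) (fun y hy => ngauge_ball ok nP hy) x.
  apply: (le_trans hx); rewrite mulrC ler_wpM2r ?ngauge_ge0// lerXn2r ?nnegrE ?nrm_ge0//.
set S := \sum_(m < N) _; set u := exp_sum g x.
have := nrmD (u - S) S; rewrite subrK; lra.
Qed.

Lemma gauge_summable_eq rho g h B :
  (forall m x, power_sum g m x = power_sum h m x) ->
  gauge_summable rho g B -> gauge_summable rho h B.
Proof.
move=> gh; rewrite /gauge_summable (_ : (fun m => gnorm m (power_sum h m)) =
  (fun m => gnorm m (power_sum g m)))//.
by apply/funext => m; congr gnorm; apply/funext => x; rewrite gh.
Qed.

Lemma gauge_summable_cat rho g h B C : 0 <= rho ->
  gauge_summable rho g B -> gauge_summable rho h C ->
  gauge_summable rho (g ++ h) (B + C).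
Proof.
move=> r0 gB hC; apply: summable_le r0 _ (summableD gB hC) => m.
rewrite (_ : power_sum (g ++ h) m = fun x => power_sum g m x + power_sum h m x).
  by apply: (ngauge_add ok); exact: nuc0_power_sum.
by apply/funext => x; rewrite power_sum_cat.
Qed.

Lemma gauge_summable_fin rho g : 0 <= rho -> exists B, gauge_summable rho g B.
Proof.
move=> r0; elim: g => [|cf g [B gB]].
  exists 0 => M; rewrite /weighted_sum big1// => m _.
  rewrite (_ : power_sum [::] m = fun=> 0) ?ngauge0 ?mulr0//.
  by apply/funext => x; rewrite /power_sum big_nil.
exists (nrm cf.1 * exp_tail (rho * nrm cf.2) 0 + B).
rewrite -cat1s; apply: gauge_summable_cat => //.
apply: summable_exp => //; [exact: nrm_ge0|exact: nrm_ge0|].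
move=> m _; apply: (le_trans (ngauge_power_sum ok _ _)).
by rewrite big_seq1.
Qed.

Definition gauge_cauchy (G : nat -> seq (R[i] * dual E)) : Prop :=
  forall rho e : R, 0 < rho -> 0 < e -> exists N, forall k l, (N <= k)%N -> (k <= l)%N ->
    gauge_summable rho (G l ++ scale_coef (-1) (G k)) e.

Lemma ngauge_distC m (P Q : E -> R[i]) : gnuc m P -> gnuc m Q ->
  gnorm m (fun x => P x - Q x) <= gnorm m (fun x => Q x - P x).
Proof.
move=> nP nQ; have := ngauge_lin ok (-1) (nuc0_sub ok nQ nP) (nuc0_0 ok m).
rewrite nrmN nrm1 mul1r ngauge0// addr0; apply: le_trans.
rewrite le_eqVlt; apply/orP; left; apply/eqP; congr gnorm; apply/funext => x; ring.
Qed.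

(** The Taylor expansions of the limit at all points come from Cauchy's estimates for the
  sums, and its differentials at [0] are represented in the completion by theirs. *)
Lemma HNb_limit (G : nat -> seq (R[i] * dual E)) : gauge_cauchy G ->
  exists f : E -> R[i], [/\ HNb_set r q s p f,
    (forall x, seqlim (fun k => exp_sum (G k) x) (f x)),
    (forall m x, seqlim (fun k => power_sum (G k) m x) (dhat m f x)) &
    (forall rho e, 0 < rho -> 0 < e -> exists N, forall k, (N <= k)%N ->
       summable rho (fun m => qnorm m (fun x => dhat m f x - power_sum (G k) m x)) e)].
Proof.
move=> cG.
have A t e : 0 < t -> 0 < e -> exists N, forall k l, (N <= k)%N -> (k <= l)%N ->
    forall x, nrm x <= t -> nrm (exp_sum (G l) x - exp_sum (G k) x) <= e.
  move=> t0 e0; have [N NP] := cG t e t0 e0; exists N => k l Nk kl x xt.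
  by rewrite -exp_sum_sub; exact: gauge_summable_exp_sum (ltW t0) xt (NP k l Nk kl).
have lim (F : nat -> R[i]) : (forall e, 0 < e -> exists N, forall k l, (N <= k)%N ->
    (k <= l)%N -> nrm (F l - F k) <= e) -> exists l, seqlim F l.
  move=> cF; apply: seqlim_complete => e e0.
  have e2 : 0 < e / 2 by lra.
  have [N NP] := cF _ e2; exists N => m n Nm Nn.
  apply: (@le_lt_trans _ _ (e / 2)); last lra.
  have [mn|/ltnW nm] := leqP m n; last exact: NP.
  by rewrite nrm_distC; exact: NP.
have fex x : exists l, seqlim (fun k => exp_sum (G k) x) l.
  apply: lim => e e0.
  have [|N NP] := A (nrm x + 1) e _ e0; first by have := nrm_ge0 x; lra.
  by exists N => k l Nk kl; apply: NP; rewrite ?lerDl.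
have [f fP] := choice fex.
have A' t e : 0 < t -> 0 < e -> exists N, forall k, (N <= k)%N ->
    forall x, nrm x <= t -> nrm (f x - exp_sum (G k) x) <= e.
  move=> t0 e0; have [N NP] := A t e t0 e0; exists N => k Nk x xt.
  by apply: (seqlim_le (fP x)); exists k => l kl; exact: NP.
pose U a k m y := power_sum (translate_coef a (G k)) m y / m`!%:R.
have B a t e : 0 < t -> 0 < e -> exists N, forall k l, (N <= k)%N -> (k <= l)%N ->
    forall m y, nrm y <= t -> nrm (U a l m y - U a k m y) <= e.
  move=> t0 e0; have [|N NP] := A (nrm a + t) e _ e0; first by have := nrm_ge0 a; lra.
  exists N => k l Nk kl m y yt; rewrite /U -mulrBl -power_sum_sub -translate_sub.
  apply: power_sum_cauchy (ltW t0) _ m y yt => z zt; rewrite exp_sum_sub.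
  by apply: NP => //; rewrite (le_trans (nrmD _ _))// lerD2l.
have Tex a : exists T : nat -> E -> R[i], forall t e, 0 < t -> 0 < e ->
    exists N, forall k, (N <= k)%N -> forall m y, nrm y <= t -> nrm (T m y - U a k m y) <= e.
  have Uex (my : nat * E) : exists l, seqlim (fun k => U a k my.1 my.2) l.
    apply: lim => e e0.
    have [|N NP] := B a (nrm my.2 + 1) e _ e0; first by have := nrm_ge0 my.2; lra.
    by exists N => k l Nk kl; apply: NP; rewrite ?lerDl.
  have [T TP] := choice Uex.
  exists (fun m y => T (m, y)) => t e t0 e0; have [N NP] := B a t e t0 e0.
  exists N => k Nk m y yt; apply: (seqlim_le (TP (m, y))).
  by exists k => l kl; exact: NP.
have [T TP] := choice Tex.
have fT a : taylor_at f a (T a).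
  split.
    move=> m; apply: (@hpoly_lim _ _ m (fun k => scale_coef (m`!%:R^-1) (translate_coef a (G k)))).
    move=> t e t0 e0; have [N NP] := TP a t e t0 e0; exists N => k Nk x xt.
    rewrite -/(power_sum (scale_coef (m`!%:R^-1) (translate_coef a (G k))) m x).
    by rewrite power_sum_scale mulrC; exact: NP.
  exists 1 => // e e0.
  have [C [N0 [C0 HC]]] : exists C N0, 0 <= C /\ forall k, (N0 <= k)%N -> forall y, nrm y <= 2 ->
      nrm (exp_sum (G k) (a + y)) <= C.
    have a2 : 0 < nrm a + 2 by have := nrm_ge0 a; lra.
    have [N NP] := A (nrm a + 2) 1 a2 ltr01.
    have [C0 hC0] := gauge_summable_fin (G N) (ltW a2).
    exists (C0 + 1), N; split=> [|k Nk y y2].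
      have := gauge_summable_exp_sum (x := 0) (ltW a2) _ hC0; rewrite nrm0 => /(_ (ltW a2)).
      by have := nrm_ge0 (exp_sum (G N) 0); lra.
    have ay : nrm (a + y) <= nrm a + 2 by rewrite (le_trans (nrmD _ _))// lerD2l.
    have := NP N k (leqnn N) Nk _ ay; have := gauge_summable_exp_sum (ltW a2) ay hC0.
    have := nrmD (exp_sum (G k) (a + y) - exp_sum (G N) (a + y)) (exp_sum (G N) (a + y)).
    rewrite subrK; lra.
  (* The bound [C] on the ball of radius [2] gives geometric decay on the unit ball. *)
  have UC k m y : (N0 <= k)%N -> nrm y <= 1 -> nrm (U a k m y) <= C * 2^-1 ^+ m.
    move=> Nk y1.
    have y2 : nrm ((2%:R : R[i]) *: y) <= 2.
      by rewrite nrmZ nrm_nat -[leRHS]mulr1 ler_wpM2l.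
    have := power_sum_cauchy (t := 2) (ltW (ltr0n R 2)) (HC k Nk) m y2.
    rewrite power_sumZ -mulrA nrmM nrmX nrm_nat -/(U a k m y) => h.
    by rewrite exprVn ler_pdivlMr ?exprn_gt0// mulrC.
  have e8 : 0 < e / 8 by lra.
  have [K0 K0P] : exists K0, forall K, (K0 <= K)%N -> C * (2^-1 ^+ K * 2) <= e / 8.
    have C1 : 0 < e / 8 / (2 * C + 1) by rewrite divr_gt0//; lra.
    have h1 : `|2^-1 : R| < 1 by rewrite ger0_norm ?invr_ge0// invf_lt1// ltr1n.
    have /cvgrPdist_lt/(_ _ C1)[K0 _ KP] := cvg_expr h1.
    exists K0 => K /KP; rewrite sub0r normrN ger0_norm ?exprn_ge0 ?invr_ge0//.
    rewrite ltr_pdivlMr; last lra.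
    have : 0 <= (2^-1 : R) ^+ K by rewrite exprn_ge0 ?invr_ge0.
    set u := 2^-1 ^+ K => u0; rewrite mulrDr mulr1 => h.
    have -> : C * (u * 2) = u * (2 * C) by ring.
    lra.
  exists K0 => // K /= /K0P hK x xa; set y := x - a.
  have y1 : nrm y <= 1 by exact: ltW.
  have xE : x = a + y by rewrite addrC subrK.
  have K1 : 0 < e / 8 / K.+1%:R by rewrite divr_gt0.
  have [N1 H1] := TP a 1 _ ltr01 K1.
  have [|N2 H2] := A' (nrm x + 1) _ _ e8; first by have := nrm_ge0 x; lra.
  pose k := maxn N0 (maxn N1 N2).
  have k0 : (N0 <= k)%N by rewrite leq_maxl.
  have {}H1 := H1 k (leq_trans (leq_maxl _ _) (leq_maxr _ _)).
  have {}H2 := H2 k (leq_trans (leq_maxr _ _) (leq_maxr _ _)) x (ltac:(by rewrite lerDl)).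
  have [N3 H3] := exp_sum_taylor (translate_coef a (G k)) ler01 e8.
  have {}H3 := H3 (maxn K N3) (leq_maxr _ _) y y1.
  rewrite exp_sum_translate -xE in H3.
  have S1 : nrm (\sum_(m < K) T a m y - \sum_(m < K) U a k m y) <= e / 8.
    rewrite -sumrB (le_trans (nrm_sum _ _ _))//.
    apply: (@le_trans _ _ (\sum_(m < K) e / 8 / K.+1%:R)).
      by apply: ler_sum => m _; exact: H1.
    rewrite sumr_const card_ord -[leLHS]mulr_natl.
    have -> : K%:R * (e / 8 / K.+1%:R) = e / 8 * (K%:R / K.+1%:R) by ring.
    rewrite ler_piMr ?(ltW e8)//.
    by rewrite ler_pdivrMr ?mul1r ?ler_nat.
  have S2 : nrm (\sum_(m < maxn K N3) U a k m y - \sum_(m < K) U a k m y) <= e / 8.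
    rewrite -!(big_mkord xpredT (fun m => U a k m y)) (big_cat_nat _ (leq_maxl K N3))//=.
    rewrite addrAC subrr add0r (le_trans (nrm_sum _ _ _))//; apply: le_trans hK.
    apply: (@le_trans _ _ (\sum_(K <= m < maxn K N3) C * 2^-1 ^+ m)).
      by apply: ler_sum => m _; exact: UC.
    rewrite -mulr_sumr ler_wpM2l// -{1}(add0n K) big_addn.
    under eq_bigr do rewrite exprD mulrC.
    rewrite -mulr_sumr ler_wpM2l ?exprn_ge0 ?invr_ge0// big_mkord.
    by apply: sum_geometric_le2; rewrite invr_ge0 lexx andbT.
  move: H3; rewrite -/(\sum_(m < maxn K N3) U a k m y).
  set V := \sum_(m < maxn K N3) _ in S2 *; set Uk := \sum_(m < K) U a k m y in S1 S2.
  set Tk := \sum_(m < K) _ in S1 *; set ek := exp_sum (G k) x in H2 * => H3.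
  have -> : f x - Tk = (f x - ek) + (ek - V) + (V - Uk) - (Tk - Uk) by ring.
  have := nrmB (f x - ek + (ek - V) + (V - Uk)) (Tk - Uk).
  have := nrmD (f x - ek + (ek - V)) (V - Uk).
  have := nrmD (f x - ek) (ek - V); lra.
have ef : entire f by move=> a; exists (T a).
have fn0 m : m`!%:R != 0 :> R[i] by rewrite pnatr_eq0 -lt0n fact_gt0.
have dl t m e : 0 < t -> 0 < e -> exists N, forall k, (N <= k)%N -> forall y, nrm y <= t ->
    nrm (power_sum (G k) m y - dhat m f y) <= e.
  move=> t0 e0; have m0 : 0 < m`!%:R :> R by rewrite ltr0n fact_gt0.
  have em : 0 < e / m`!%:R by rewrite divr_gt0.
  have [N NP] := TP 0 t _ t0 em; exists N => k Nk y yt.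
  have := NP k Nk m y yt; rewrite /U power_sum_translate0 (dhatE m (fT 0)).
  have -> : T 0 m y - power_sum (G k) m y / m`!%:R =
      - (power_sum (G k) m y - m`!%:R * T 0 m y) / m`!%:R by field.
  by rewrite nrmM nrmN nrmV nrm_nat ler_pM2r ?invr_gt0.
have cg m e : 0 < e -> exists N, forall k l, (N <= k)%N -> (N <= l)%N ->
    gnorm m (fun x => power_sum (G k) m x - power_sum (G l) m x) < e.
  move=> e0; have m0 : 0 < m`!%:R :> R by rewrite ltr0n fact_gt0.
  have em : 0 < e / 2 / m`!%:R by rewrite !divr_gt0.
  have [N NP] := cG 1 _ ltr01 em.
  have H k l : (N <= k)%N -> (k <= l)%N ->
      gnorm m (fun x => power_sum (G l) m x - power_sum (G k) m x) <= e / 2.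
    move=> Nk kl; have := summable_term m ler01 (fun i => ngauge_ge0 i _) (NP k l Nk kl).
    rewrite expr1n mul1r mulrC ler_pM2r ?invr_gt0//.
    by rewrite (_ : power_sum (_ ++ _) m = fun x => power_sum (G l) m x - power_sum (G k) m x)//;
      apply/funext => x; rewrite power_sum_sub.
  exists N => k l Nk Nl; apply: (@le_lt_trans _ _ (e / 2)); last lra.
  have [kl|/ltnW lk] := leqP k l; last exact: H.
  by apply: le_trans (H k l Nk kl); apply: ngauge_distC; exact: nuc0_power_sum.
have qr m : @qrep R E r q s p m (dhat m f) (fun k => power_sum (G k) m).
  split=> [k|e e0|e e0]; [exact: (nuc0_power_sum ok)|exact: cg|].
  exact: (dl 1 m e ltr01 e0).
have hd m : hpoly m (dhat m f).
  rewrite (dhatE m (fT 0)); apply: hpoly_ext (hpoly_lin m`!%:R ((fT 0).1 m) (hpoly0 m)) => x.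
  by rewrite addr0.
have qd m : qnuc m (dhat m f) := qrep_qnuc ok (hd m) (qr m).
have qdk m k : qnuc m (fun x => dhat m f x - power_sum (G k) m x).
  by apply: (qnuc_sub ok) => //; exact: qnuc_power_sum.
have ql m e : 0 < e -> exists N, forall k, (N <= k)%N ->
    qnorm m (fun x => dhat m f x - power_sum (G k) m x) <= e.
  move=> e0; have [N NP] := cg m e e0; exists N => k Nk.
  apply: (@qnR_le _ _ _ _ _ _ ok m _ (fun l x => power_sum (G l) m x - power_sum (G k) m x)).
  - exact: (qdk m k).1.
  - have -> : (fun l x => power_sum (G l) m x - power_sum (G k) m x) =
        (fun l x => -1 * power_sum (G k) m x + power_sum (G l) m x).
      by apply/funext => l; apply/funext => x; rewrite mulN1r addrC.
    have -> : (fun x => dhat m f x - power_sum (G k) m x) =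
        (fun x => -1 * power_sum (G k) m x + dhat m f x).
      by apply/funext => x; rewrite mulN1r addrC.
    exact: (qrep_lin ok (-1) (qrep_cst ok (nuc0_power_sum ok (G k) m)) (qr m)).
  - by exists N => l Nl; apply/ltW/NP.
have sm rho e : 0 < rho -> 0 < e -> exists N, forall k, (N <= k)%N ->
    summable rho (fun m => qnorm m (fun x => dhat m f x - power_sum (G k) m x)) e.
  move=> r0 e0; have e2 : 0 < e / 2 by lra.
  have [N NP] := cG rho _ r0 e2; exists N => k Nk M.
  pose W := \sum_(m < M) rho ^+ m / m`!%:R.
  have W0 : 0 <= W by apply: sumr_ge0 => m _; rewrite weight_ge0// ltW.
  have eW : 0 < e / 2 / (W + 1) by rewrite divr_gt0//; lra.
  have [N' N'P] : exists N', forall l, (N' <= l)%N -> forall m, (m < M)%N ->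
      qnorm m (fun x => dhat m f x - power_sum (G l) m x) <= e / 2 / (W + 1).
    elim: (M) => [|M' [N' IH]]; first by exists 0%N.
    have [N2 H2] := ql M' _ eW; exists (maxn N' N2) => l; rewrite geq_max => /andP[l1 l2] m.
    by rewrite ltnS leq_eqVlt => /predU1P[->|]; [exact: H2|exact: IH].
  pose l := maxn k N'.
  have kl : (k <= l)%N by rewrite leq_maxl.
  apply: (@le_trans _ _ (W * (e / 2 / (W + 1)) +
    weighted_sum rho (fun m => gnorm m (power_sum (G l ++ scale_coef (-1) (G k)) m)) M)).
    rewrite /W mulr_suml -big_split/=; apply: ler_sum => m _.
    rewrite -mulrDr ler_wpM2l ?weight_ge0 ?(ltW r0)//.
    apply: (@le_trans _ _ (qnorm m (fun x => dhat m f x - power_sum (G l) m x) +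
      qnorm m (power_sum (G l ++ scale_coef (-1) (G k)) m))).
      rewrite [in leLHS](_ : (fun x => _) = (fun x => (dhat m f x - power_sum (G l) m x) +
        power_sum (G l ++ scale_coef (-1) (G k)) m x)).
        by apply: (qnR_add ok) => //; exact: qnuc_power_sum.
      by apply/funext => x; rewrite power_sum_sub; ring.
    apply: lerD; first by apply: N'P => //; exact: leq_maxr.
    by apply: (qnR_le_ngauge ok); exact: nuc0_power_sum.
  have := NP k l Nk kl M.
  suff : W * (e / 2 / (W + 1)) <= e / 2 by rewrite /gauge_summable; lra.
  by rewrite mulrCA ler_piMr ?(ltW e2)// ler_pdivrMr; lra.
exists f; split=> //; last first.
  move=> m x e e0; have [|N NP] := dl (nrm x + 1) m (e / 2) _ (ltac:(by rewrite divr_gt0)).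
    by have := nrm_ge0 x; lra.
  exists N => k Nk; apply: (@le_lt_trans _ _ (e / 2)); last lra.
  by apply: NP; rewrite ?lerDl.
apply/(HNb_setP ok); split=> // rho r0; have [N NP] := sm rho 1 r0 ltr01.
have [C hC] := gauge_summable_fin (G N) (ltW r0).
exists (1 + C); apply: summable_le (ltW r0) _ (summableD (NP N (leqnn N)) hC) => m.
rewrite [in leLHS](_ : dhat m f = (fun x => (dhat m f x - power_sum (G N) m x) +
  power_sum (G N) m x)); last by apply/funext => x; rewrite subrK.
apply: (le_trans (qnR_add ok (qdk m N) (qnuc_power_sum ok _ _))).
by rewrite lerD2l; apply: (qnR_le_ngauge ok); exact: nuc0_power_sum.
Qed.

End HNbLimits.

(** * The seminorms and their topology *)

Section HNbSpace.
Context {R : realType} {E : normedModType R[i]} {r q s p : R}.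
Hypothesis ok : @exponents_ok R r q s p.
Notation qnuc := (quasi_nuclear r q s p).
Notation qnorm := (@qnR R E r q s p).
Notation gnorm := (@ngauge R E r q s p).
Notation gsum := (@gauge_summable R E r q s p).
Notation space := (HNb r q s p E).
Implicit Types (f : E -> R[i]) (x y a : E).

Definition norm_le (rho : R) f (B : R) := summable rho (fun m => qnorm m (dhat m f)) B.

Lemma norm_le_trans rho f B C : B <= C -> norm_le rho f B -> norm_le rho f C.
Proof. by move=> BC fB M; exact: le_trans (fB M) BC. Qed.

Lemma norm_le_mono (rho t : R) f B : 0 <= t -> t <= rho ->
  norm_le rho f B -> norm_le t f B.
Proof. by move=> t0 tr; apply: summable_mono t0 tr _ => m; exact: qnR_ge0. Qed.

Lemma HNb_lin (f g : E -> R[i]) (b : R[i]) : HNb_set r q s p f -> HNb_set r q s p g ->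
  HNb_set r q s p (fun x => b * f x + g x).
Proof.
move=> /(HNb_setP ok)[ef qf sf] /(HNb_setP ok)[eg qg sg].
apply/(HNb_setP ok); split; first exact: entire_lin.
  by move=> m; rewrite dhat_lin//; exact: (qnuc_lin ok).
move=> rho r0; have [B hB] := sf rho r0; have [C hC] := sg rho r0.
exists (nrm b * B + C).
apply: summable_le (ltW r0) _ (summableD (summableZ (nrm_ge0 b) hB) hC) => m.
by rewrite dhat_lin//; exact: (qnR_lin ok).
Qed.

Lemma norm_le_lin rho (f g : E -> R[i]) (b : R[i]) B C : 0 <= rho ->
  HNb_set r q s p f -> HNb_set r q s p g -> norm_le rho f B -> norm_le rho g C ->
  norm_le rho (fun x => b * f x + g x) (nrm b * B + C).
Proof.
move=> r0 /(HNb_setP ok)[ef qf sf] /(HNb_setP ok)[eg qg sg] hB hC.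
apply: summable_le r0 _ (summableD (summableZ (nrm_ge0 b) hB) hC) => m.
by rewrite dhat_lin//; exact: (qnR_lin ok).
Qed.

Lemma HNb_sub (f g : E -> R[i]) : HNb_set r q s p f -> HNb_set r q s p g ->
  HNb_set r q s p (fun x => f x - g x).
Proof.
move=> hf hg; have := HNb_lin (-1) hg hf.
by under eq_fun do rewrite mulN1r addrC.
Qed.

Lemma norm_le_sub rho (f g : E -> R[i]) B C : 0 <= rho ->
  HNb_set r q s p f -> HNb_set r q s p g -> norm_le rho f B -> norm_le rho g C ->
  norm_le rho (fun x => f x - g x) (B + C).
Proof.
move=> r0 hf hg hB hC; have := norm_le_lin (-1) r0 hg hf hC hB.
by rewrite nrmN nrm1 mul1r addrC; under eq_fun do rewrite mulN1r addrC.
Qed.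

Lemma norm_le_add rho (f g : E -> R[i]) B C : 0 <= rho ->
  HNb_set r q s p f -> HNb_set r q s p g -> norm_le rho f B -> norm_le rho g C ->
  norm_le rho (fun x => f x + g x) (B + C).
Proof.
move=> r0 hf hg hB hC; have := norm_le_lin 1 r0 hf hg hB hC.
by rewrite nrm1 mul1r; under eq_fun do rewrite mul1r.
Qed.

Lemma norm_le_dist rho (f g h' : E -> R[i]) B C : 0 <= rho ->
  HNb_set r q s p f -> HNb_set r q s p g -> HNb_set r q s p h' ->
  norm_le rho (fun x => f x - g x) B -> norm_le rho (fun x => g x - h' x) C ->
  norm_le rho (fun x => f x - h' x) (B + C).
Proof.
move=> r0 hf hg hh hB hC; have := norm_le_add r0 (HNb_sub hf hg) (HNb_sub hg hh) hB hC.
by under eq_fun do rewrite addrA subrK.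
Qed.

Lemma norm_le_distC rho (f g : E -> R[i]) B : 0 <= rho ->
  HNb_set r q s p f -> HNb_set r q s p g ->
  norm_le rho (fun x => f x - g x) B -> norm_le rho (fun x => g x - f x) B.
Proof.
move=> r0 hf hg hB; have h0 := HNb_sub hf hf.
have n0 : norm_le rho (fun x => f x - f x) 0.
  have [ef qf _] := (HNb_setP ok _).1 hf.
  move=> M; rewrite /weighted_sum big1// => m _.
  rewrite (_ : dhat m _ = fun=> 0) ?(qnR0 ok) ?mulr0//.
  have := dhat_lin (-1) m ef ef.
  rewrite (_ : (fun x => -1 * f x + f x) = (fun x => f x - f x)); last first.
    by apply/funext => x; ring.
  by move=> ->; apply/funext => x; ring.
have := norm_le_sub r0 h0 (HNb_sub hf hg) n0 hB; rewrite add0r.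
by rewrite (_ : (fun x => _ - _ - _) = (fun x => g x - f x))//; apply/funext => x; ring.
Qed.

Lemma HNb_seminormP (rho B : R) f : 0 <= rho -> HNb_set r q s p f ->
  (HNb_seminorm r q s p rho f <= B%:E)%E <-> norm_le rho f B.
Proof. by move=> r0 /(HNb_setP ok)[_ qf _]; exact: HNb_seminorm_leP. Qed.

Lemma norm_le_zero f rho : 0 <= rho -> HNb_set r q s p f -> (forall x, f x = 0) ->
  norm_le rho f 0.
Proof.
move=> r0 hf f0; have [ef qf _] := (HNb_setP ok _).1 hf.
move=> M; rewrite /weighted_sum big1// => m _.
rewrite (_ : dhat m _ = fun=> 0) ?(qnR0 ok) ?mulr0//.
have := dhat_lin (-1) m ef ef.
rewrite (_ : (fun x => -1 * f x + f x) = f); last first.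
  by apply/funext => x; rewrite f0; ring.
by move=> ->; apply/funext => x; ring.
Qed.

Lemma HNb_exp_sum (g : seq (R[i] * dual E)) : HNb_set r q s p (exp_sum g) /\
  forall m, dhat m (exp_sum g) = power_sum g m.
Proof.
have cg : @gauge_cauchy R E r q s p (fun=> g).
  move=> rho e r0 e0; exists 0%N => k l _ _ M; rewrite /weighted_sum big1 ?ltW// => m _.
  rewrite (_ : power_sum _ m = fun=> 0) ?ngauge0 ?mulr0//.
  by apply/funext => x; rewrite power_sum_sub subrr.
have cst (u : R[i]) : seqlim (fun=> u) u by move=> e e0; exists 0%N => k _; rewrite subrr nrm0.
have [f [hf lf df _]] := HNb_limit ok cg.
have fE : f = exp_sum g by apply/funext => x; exact: seqlim_uniq (lf x) (cst _).
rewrite -fE; split=> // m; apply/funext => x.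
exact: seqlim_uniq (df m x) (cst _).
Qed.

Definition exp_elt (g : seq (R[i] * dual E)) : space := MkHNb (HNb_exp_sum g).1.

Lemma norm_le_exp_sum rho (g : seq (R[i] * dual E)) B : 0 <= rho -> gsum rho g B -> norm_le rho (exp_sum g) B.
Proof.
move=> r0; apply: summable_le r0 _ => m.
rewrite (HNb_exp_sum g).2; apply: (qnR_le_ngauge ok); exact: nuc0_power_sum.
Qed.

Lemma norm_le_limit (G : nat -> seq (R[i] * dual E)) : @gauge_cauchy R E r q s p G ->
  exists f : space, forall rho e, 0 < rho -> 0 < e -> exists N, forall k, (N <= k)%N ->
    norm_le rho (fun x => f x - exp_sum (G k) x) e.
Proof.
move=> cG; have [f [hf _ _ sf]] := HNb_limit ok cG.
exists (MkHNb hf) => rho e r0 e0; have [N NP] := sf rho e r0 e0; exists N => k Nk.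
apply: summable_le (ltW r0) _ (NP k Nk) => m /=.
have [ef _ _] := (HNb_setP ok _).1 hf; have [he hd] := HNb_exp_sum (G k).
have [ee _ _] := (HNb_setP ok _).1 he.
rewrite (_ : (fun x => f x - _) = (fun x => -1 * exp_sum (G k) x + f x)); last first.
  by apply/funext => x; ring.
rewrite dhat_lin// hd le_eqVlt; apply/orP; left; apply/eqP; congr qnorm.
by apply/funext => x; ring.
Qed.

Lemma norm_le_at0 f B rho : 0 <= rho -> HNb_set r q s p f -> norm_le rho f B ->
  nrm (f 0) <= B.
Proof.
move=> r0 hf hB; have [ef qf _] := (HNb_setP ok _).1 hf.
have := summable_term 0 r0 (fun m => qnR_ge0 m _) hB.
rewrite expr0 fact0 divr1 mul1r; apply: le_trans.
have -> : f 0 = dhat 0 f 0.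
  have [_ [d d0 fP]] := dhat_taylor ef.
  have h0 : dhat 0 f 0 = dhat 0 f 0 by [].
  apply/eqP; rewrite -subr_eq0; apply/eqP/nrm_eq0/eqP; rewrite eq_le nrm_ge0 andbT.
  apply/ler_addgt0Pr => e e0; rewrite add0r.
  have [N _ /(_ N.+1 (leqnSn N) 0)] := fP e e0.
  rewrite subrr nrm0 => /(_ d0)/ltW; rewrite big_ord_recl/= fact0 invr1 mul1r.
  rewrite big1 ?addr0// => i _.
  have := hpoly_scale 0 0 (qf i.+1).1; rewrite scale0r exprS !mul0r => h.
  by rewrite [dhat _ _ _]h mulr0.
by apply: (qnR_ball ok) => //; rewrite nrm0.
Qed.

(** This turns continuity for the topology of the space into estimates. *)
Lemma HNb_ball_open (f0 : space) (rho e : R) : 0 < rho ->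
  open [set f : space | (HNb_seminorm r q s p rho (fun x => f x - f0 x)%R < e%:E)%E].
Proof.
move=> r0.
suff : HNb_open [set f : space | (HNb_seminorm r q s p rho (fun x => f x - f0 x)%R < e%:E)%E] by [].
move=> f /= fe; have hf := HNb_funP f; have hf0 := HNb_funP f0.
have [b bE] : exists b, HNb_seminorm r q s p rho (fun x => f x - f0 x)%R = b%:E.
  exists (fine (HNb_seminorm r q s p rho (fun x => f x - f0 x)%R)).
  rewrite fineK// ge0_fin_numE ?(lt_trans fe) ?ltry//.
  rewrite /HNb_seminorm; apply: nneseries_ge0 => m _ _.
  by rewrite mule_ge0 ?qn_ge0// lee_fin weight_ge0// ltW.
have be : b < e by rewrite -lte_fin -bE.
have fb : norm_le rho (fun x => f x - f0 x) b.
  by apply: (HNb_seminormP _ (ltW r0) (HNb_sub hf hf0)).1; rewrite bE.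
have e2 : 0 < (e - b) / 2 by lra.
exists [:: rho], ((e - b) / 2); split; [by move=> t; rewrite inE => /eqP ->|exact: e2|].
move=> g /(_ rho (mem_head _ _))/ltW gf; have hg := HNb_funP g.
have gn : norm_le rho (fun x => g x - f x) ((e - b) / 2).
  by apply: (HNb_seminormP _ (ltW r0) (HNb_sub hg hf)).1.
apply: (@le_lt_trans _ _ ((e - b) / 2 + b)%:E); last by rewrite lte_fin; lra.
apply: (HNb_seminormP _ (ltW r0) (HNb_sub hg hf0)).2.
exact: norm_le_dist (ltW r0) hg hf hf0 gn fb.
Qed.

Lemma HNb_ext (f g : space) : (forall x, f x = g x) -> f = g.
Proof.
case: f g => [f hf] [g hg] /= /funext fg; move: hf hg; rewrite fg => hf hg.
by congr MkHNb; exact: Prop_irrelevance.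
Qed.

End HNbSpace.

(** * Interpolation of exponentials on a complex line *)

Section Interpolation.
Context {R : realType}.
Implicit Types (w b z : R[i]).

(** The value at [z] of the Lagrange basis polynomial of the node [b * w ^+ j]
  among the [M] nodes on a circle, when [w] is a primitive root of unity. *)
Definition node_coef (M : nat) w b z (j : nat) : R[i] :=
  M%:R^-1 * \sum_(k < M) (w ^+ (j * k))^-1 * (z / b) ^+ k.

Lemma node_coef_power M w b z m : M.-primitive_root w -> b != 0 -> (m < M)%N ->
  \sum_(j < M) node_coef M w b z j * (b * w ^+ j) ^+ m = z ^+ m.
Proof.
move=> wM b0 mM; have M0 : M%:R != 0 :> R[i] by rewrite pnatr_eq0; case: M mM {wM}.
transitivity (M%:R^-1 * b ^+ m *
  \sum_(k < M) (z / b) ^+ k * \sum_(j < M) w ^+ (j * m) * (w ^+ (j * k))^-1).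
  rewrite (eq_bigr (fun j : 'I_M => \sum_(k < M)
      M%:R^-1 * b ^+ m * ((z / b) ^+ k * (w ^+ (j * m) * (w ^+ (j * k))^-1)))).
    by rewrite exchange_big/= mulr_sumr; apply: eq_bigr => k _; rewrite !mulr_sumr.
  move=> j _; rewrite /node_coef mulr_sumr mulr_suml; apply: eq_bigr => k _.
  by rewrite [(b * _) ^+ m]exprMn -exprM; ring.
rewrite (bigD1 (Ordinal mM))//= (sum_prim_root wM)// eqxx mul1r big1 ?addr0.
  by rewrite expr_div_n; field; rewrite expf_neq0.
move=> k km; rewrite (sum_prim_root wM)//.
by rewrite (_ : (m == k) = false) ?mul0r ?mulr0//; apply/negP => /eqP mk;
  move/eqP: km; apply; exact: val_inj.
Qed.

Lemma nrm_node_coef M w b z (kappa : R) j : M.-primitive_root w -> 1 <= kappa ->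
  nrm (z / b) <= kappa -> nrm (node_coef M w b z j) <= kappa ^+ M.
Proof.
move=> wM k1 zk; have M0 : (0 < M)%N by exact: prim_order_gt0 wM.
have MR : 0 < M%:R :> R by rewrite ltr0n.
have k0 : 0 <= kappa by lra.
rewrite /node_coef nrmM nrmV nrm_nat ler_pdivrMl//.
apply: (le_trans (nrm_sum _ _ _)); apply: (@le_trans _ _ (\sum_(k < M) kappa ^+ M)).
  apply: ler_sum => k _; rewrite nrmM nrmV (nrm_prim_root _ wM) invr1 mul1r nrmX.
  apply: (@le_trans _ _ (kappa ^+ k)); first by rewrite lerXn2r ?nnegrE ?nrm_ge0.
  by rewrite ler_weXn2l// ltnW.
by rewrite sumr_const card_ord mulr_natl.
Qed.

End Interpolation.

Section InterpolationOfExponentials.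
Context {R : realType} {E : normedModType R[i]} {r q s p : R}.
Hypothesis ok : @exponents_ok R r q s p.
Notation gsum := (@gauge_summable R E r q s p).
Implicit Types (w b z : R[i]) (phi psi : dual E).

Definition interpolant M w b z phi psi : seq (R[i] * dual E) :=
  [seq (node_coef M w b z j, phi + (b * w ^+ j) *: psi) | j <- index_iota 0 M].

Lemma power_sum_interpolant M w b z phi psi m x : M.-primitive_root w -> b != 0 ->
  (m < M)%N -> power_sum (interpolant M w b z phi psi) m x = (phi x + z * psi x) ^+ m.
Proof.
move=> wM b0 mM; rewrite /power_sum big_map big_mkord/=.
rewrite (eq_bigr (fun j : 'I_M => \sum_(i < m.+1)
    phi x ^+ (m - i) * psi x ^+ i *+ 'C(m, i) * (node_coef M w b z j * (b * w ^+ j) ^+ i))).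
  rewrite exchange_big/= exprDn; apply: eq_bigr => i _.
  have iM : (i < M)%N by apply: leq_trans mM; exact: ltn_ord.
  rewrite -mulr_sumr (node_coef_power _ wM b0 iM).
  by rewrite mulrnAl exprMn; congr (_ *+ _); ring.
move=> j _; transitivity (node_coef M w b z j * (phi x + b * w ^+ j * psi x) ^+ m) => //.
rewrite exprDn mulr_sumr; apply: eq_bigr => i _.
by rewrite exprMn mulrnAr mulrnAl; congr (_ *+ _); ring.
Qed.

Lemma ngauge_interpolant M w b z phi psi (kappa A : R) m : M.-primitive_root w ->
  1 <= kappa -> nrm (z / b) <= kappa -> nrm phi + nrm b * nrm psi <= A ->
  \sum_(cf <- interpolant M w b z phi psi) nrm cf.1 * nrm cf.2 ^+ m
    <= (2 * kappa) ^+ M * A ^+ m.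
Proof.
move=> wM k1 zk hA; rewrite big_map big_mkord/=.
have A0 : 0 <= A by apply: le_trans hA; rewrite addr_ge0 ?mulr_ge0 ?nrm_ge0.
apply: (@le_trans _ _ (\sum_(j < M) kappa ^+ M * A ^+ m)).
  apply: ler_sum => j _; apply: ler_pM; rewrite ?exprn_ge0 ?nrm_ge0//.
    exact: nrm_node_coef.
  rewrite lerXn2r ?nnegrE ?nrm_ge0//; apply: le_trans hA.
  by rewrite (le_trans (nrmD _ _))// lerD2l nrmZ nrmM (nrm_prim_root _ wM) mulr1 lexx.
rewrite sumr_const card_ord -[leLHS]mulr_natl mulrA ler_wpM2r ?exprn_ge0//.
rewrite exprMn ler_wpM2r ?exprn_ge0//; first lra.
by rewrite -natrX ler_nat ltnW// ltn_expl.
Qed.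

(** Interpolation at the nodes [b * w ^+ j] reproduces polynomials of degree less than
  [M], so only the terms of degree at least [M] contribute to the error, and these
  grow geometrically. *)
Lemma gauge_summable_interpolant M w b z phi psi (kappa A rho : R) :
  M.-primitive_root w -> b != 0 -> 0 <= rho -> 1 <= kappa -> nrm (z / b) <= kappa ->
  nrm phi + nrm b * nrm psi <= A -> nrm phi + nrm z * nrm psi <= A ->
  gsum rho (interpolant M w b z phi psi ++ scale_coef (-1) [:: (1, phi + z *: psi)])
    (2 * exp_tail (rho * (2 * kappa * A)) M).
Proof.
move=> wM b0 r0 k1 zk hA hz.
have A0 : 0 <= A by apply: le_trans hA; rewrite addr_ge0 ?mulr_ge0 ?nrm_ge0.
have k20 : 0 <= 2 * kappa by lra.
apply: summable_exp => // [|m mM|m Mm]; first by rewrite mulr_ge0.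
  rewrite (_ : power_sum _ m = fun=> 0) ?ngauge0//; apply/funext => x.
  rewrite power_sum_sub power_sum_interpolant// /power_sum big_seq1/= mul1r.
  by rewrite subrr.
apply: (le_trans (ngauge_power_sum ok _ _)); rewrite big_cat/= big_seq1/=.
rewrite mulr1 nrmN nrm1 mul1r mulr_natl mulr2n; apply: lerD.
  apply: (le_trans (ngauge_interpolant _ wM k1 zk hA)).
  rewrite [leRHS]exprMn ler_wpM2r ?exprn_ge0// ler_weXn2l//; lra.
apply: (@le_trans _ _ (A ^+ m)).
  rewrite lerXn2r ?nnegrE ?nrm_ge0//; apply: le_trans hz.
  by rewrite (le_trans (nrmD _ _))// lerD2l nrmZ.
rewrite [leRHS]exprMn ler_peMl ?exprn_ge0// exprn_ege1//; lra.
Qed.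

(** The nodes stay on one circle, so the same constants serve for all [z] in the disc. *)
Lemma interpolant_lt b phi psi (k rho e : R) : b != 0 -> 0 <= k -> 0 <= rho -> 0 < e ->
  exists N, forall M w z, (N <= M)%N -> M.-primitive_root w -> nrm z <= k ->
    gsum rho (interpolant M w b z phi psi ++ scale_coef (-1) [:: (1, phi + z *: psi)]) e.
Proof.
move=> b0 k0 r0 e0.
have nb : 0 < nrm b by rewrite nrm_gt0.
pose kappa := 1 + k / nrm b; pose A := nrm phi + (nrm b + k) * nrm psi.
have e2 : 0 < e / 2 by lra.
have kb : 0 <= k / nrm b by rewrite divr_ge0 ?nrm_ge0.
have [N NP] := @exp_tail_lt R (rho * (2 * kappa * A)) _ e2.
exists N => M w z /NP hM wM zk.
have h : 2 * exp_tail (rho * (2 * kappa * A)) M <= e by lra.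
move=> n; apply: le_trans h; apply: gauge_summable_interpolant => //.
- by rewrite lerDl.
- rewrite nrmM nrmV; apply: (@le_trans _ _ (k / nrm b)); first by rewrite ler_pM2r ?invr_gt0.
  by rewrite lerDr.
- by rewrite /A lerD2l ler_wpM2r ?nrm_ge0// lerDl.
- rewrite /A lerD2l ler_wpM2r ?nrm_ge0//; have := nrm_ge0 b; lra.
Qed.

End InterpolationOfExponentials.

(** * Convolution operators on exponentials *)

Section ContinuityOfApproximableFunctions.
Context {R : realType}.

Lemma poly_approx_continuous (H : R[i] -> R[i]) (e : R) : poly_approx H -> 0 < e ->
  exists2 t : R, 0 < t & forall z, nrm z <= t -> nrm (H z - H 0) <= e.
Proof.
move=> Hp e0; have e4 : 0 < e / 4 by lra.
have [P hP] := Hp 1 ltr01 _ e4.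
pose B := \sum_(i < size P) nrm P`_i.
have B0 : 0 <= B by apply: sumr_ge0 => i _; exact: nrm_ge0.
have PB z : nrm z <= 1 -> nrm P.[z] <= B.
  move=> z1; rewrite horner_coef (le_trans (nrm_sum _ _ _))//; apply: ler_sum => i _.
  by rewrite nrmM nrmX ler_piMr ?nrm_ge0// exprn_ile1 ?nrm_ge0.
have t0 : 0 < Num.min (1 / 2) (e / (4 * B + 4)).
  by rewrite lt_min !divr_gt0//; lra.
exists (Num.min (1 / 2) (e / (4 * B + 4))) => // z; rewrite le_min => /andP[z2 ze].
have := poly_near_const ltr01 PB z2; rewrite divr1 => h.
have h2 : 2 * B * nrm z <= e / 2.
  move: ze; rewrite ler_pdivlMr; last lra.
  by have := nrm_ge0 z; nra.
have := hP z (ltac:(lra)); have := hP 0 (ltac:(by rewrite nrm0)).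
have := nrmD (H z - P.[z]) (P.[z] - P.[0]); rewrite addrA subrK.
have := nrmD (H z - P.[0]) (P.[0] - H 0); rewrite addrA subrK (nrm_distC P.[0]); lra.
Qed.

End ContinuityOfApproximableFunctions.

Section OperatorsOnExponentials.
Context {R : realType} {E : normedModType R[i]} {r q s p : R}.
Hypothesis ok : @exponents_ok R r q s p.
Notation gsum := (@gauge_summable R E r q s p).
Notation space := (HNb r q s p E).
Notation norm_le := (@norm_le R E r q s p).
Notation exp_elt := (exp_elt ok).
Implicit Types (T L : space -> space).

Lemma HNb_linear0 T x : HNb_linear T -> T (exp_elt [::]) x = 0.
Proof.
move=> lT; have z0 y : exp_elt [::] y = 0 by rewrite /= /exp_sum big_nil.
have := lT 1 (exp_elt [::]) (exp_elt [::]) (exp_elt [::]) (fun y => ltac:(by rewrite z0 mulr0 addr0)) x.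
by rewrite mul1r => h; apply: (addrI (T (exp_elt [::]) x)); rewrite -h addr0.
Qed.

Lemma HNb_linear_sub T (f g h : space) : HNb_linear T ->
  (forall x, h x = f x - g x) -> forall x, T h x = T f x - T g x.
Proof.
move=> lT hE x; rewrite (lT (-1) g f h) ?mulN1r 1?addrC// => y.
by rewrite hE mulN1r addrC.
Qed.

(** The seminorms increase with their radius, so a neighbourhood of zero contains a
  ball for a single one. *)
Lemma HNb_continuous_bounded T : HNb_linear T -> continuous T ->
  forall rho e : R, 0 < rho -> 0 < e -> exists rho' d : R, [/\ 0 < rho', 0 < d &
    forall f : space, norm_le rho' f d -> norm_le rho (T f) e].
Proof.
move=> lT cT rho e r0 e0; pose z : space := exp_elt [::].
have z0 y : z y = 0 by rewrite /z/= /exp_sum big_nil.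
have subz (f : space) : (fun x => f x - z x) = f.
  by apply/funext => x; rewrite z0 subr0.
pose U := [set f : space | (HNb_seminorm r q s p rho (fun x => f x - z x)%R < e%:E)%E].
have oU : open (T @^-1` U) by move/continuousP: cT; apply; exact: HNb_ball_open.
have {}oU : HNb_open (T @^-1` U) by [].
have Uz : (T @^-1` U) z.
  rewrite /U/= subz; apply: (@le_lt_trans _ _ 0%E); last by rewrite lte_fin.
  apply: (HNb_seminormP ok 0 (ltW r0) (HNb_funP _)).2.
  by apply: norm_le_zero => //; [exact: ltW|exact: HNb_funP|move=> x; exact: HNb_linear0].
have [t [d [tP d0 dP]]] := oU z Uz.
exists (1 + \sum_(u <- t) `|u|), (d / 2); split.
- by rewrite ltr_pwDl// sumr_ge0.
- by lra.
move=> f fd.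
have /= := dP f; rewrite subz => h; apply: (HNb_seminormP ok e (ltW r0) (HNb_funP _)).1.
apply: ltW; suff : U (T f) by rewrite /U/= subz.
apply: h => u ut; have u0 := tP u ut.
apply: (@le_lt_trans _ _ (d / 2)%:E); last by rewrite lte_fin; lra.
apply: (HNb_seminormP ok _ (ltW u0) (HNb_funP _)).2.
apply: norm_le_mono (ltW u0) _ fd.
apply: (le_trans (ler_norm u)); rewrite (big_rem u)//= addrCA lerDl addr_ge0// sumr_ge0//.
Qed.

Lemma HNb_linear_iter T n : HNb_linear T -> HNb_linear (iter n T).
Proof. by move=> lT; elim: n => [|n IH] //= a f g h hE; apply: lT; exact: IH. Qed.

Lemma continuous_iter T n : continuous T -> continuous (iter n T).
Proof.
move=> cT; elim: n => [|n IH] f; first exact: cvg_id.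
exact: (continuous_comp (IH f) (cT _)).
Qed.

Definition mult_coef (h : dual E -> R[i]) (g : seq (R[i] * dual E)) :=
  [seq (cf.1 * h cf.2, cf.2) | cf : R[i] * dual E <- g].

(** The function by which an operator multiplies the exponentials. *)
Definition symbol T (phi : dual E) : R[i] := T (exp_elt [:: (1, phi)]) 0.

Section Convolution.
Variable L : space -> space.
Hypothesis cL : convolution_operator L.

(** Translating an exponential multiplies it by a scalar, so its image is determined by
  the value at [0]. *)
Lemma convolution_exp phi x : L (exp_elt [:: (1, phi)]) x = symbol L phi * cexp (phi x).
Proof.
have [lL _ tL] := cL.
pose h := exp_elt [:: (cexp (phi x), phi)].
have e1 y : exp_elt [:: (1, phi)] y = cexp (phi y) by rewrite /= /exp_sum big_seq1 mul1r.
have hE y : h y = cexp (phi x) * cexp (phi y) by rewrite /h/= /exp_sum big_seq1.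
have -> : L (exp_elt [:: (1, phi)]) x = L h 0.
  have hx y : h y = exp_elt [:: (1, phi)] (y - - x).
    by rewrite [LHS]hE [RHS]e1 opprK dualD cexpD mulrC.
  by rewrite (tL (- x) _ h hx 0) sub0r opprK.
rewrite (lL (cexp (phi x)) (exp_elt [:: (1, phi)]) (exp_elt [::])); last first.
  by move=> y; rewrite e1 hE /= /exp_sum big_nil addr0.
by rewrite (HNb_linear0 _ lL) addr0 mulrC.
Qed.

Lemma convolution_exp_sum g : L (exp_elt g) = exp_elt (mult_coef (symbol L) g).
Proof.
have [lL _ _] := cL; apply: HNb_ext; elim: g => [|[c phi] g IH] x.
  by rewrite HNb_linear0// /= /exp_sum big_nil.
rewrite (lL c (exp_elt [:: (1, phi)]) (exp_elt g)); last first.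
  by move=> y; rewrite /= /exp_sum big_cons big_seq1 mul1r.
by rewrite IH convolution_exp /= /exp_sum big_cons/= mulrA.
Qed.

Lemma iter_convolution_exp_sum n g :
  iter n L (exp_elt g) = exp_elt (mult_coef (fun phi => symbol L phi ^+ n) g).
Proof.
elim: n => [|n IH]/=.
  by congr exp_elt; rewrite /mult_coef -[LHS]map_id; apply: eq_map => -[c phi]; rewrite mulr1.
rewrite IH convolution_exp_sum /mult_coef -map_comp; congr exp_elt.
by apply: eq_map => cf /=; rewrite exprSr mulrA.
Qed.

Lemma convolution_exp_sum0 g : L (exp_elt g) 0 = \sum_(cf <- g) cf.1 * symbol L cf.2.
Proof.
rewrite convolution_exp_sum -[LHS]/(exp_sum _ 0) /exp_sum big_map.
by apply: eq_bigr => cf _; rewrite dual0 cexp0 mulr1.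
Qed.

(** The exponentials on a line are limits of their interpolants, whose images depend
  polynomially on the parameter. *)
Lemma symbol_poly_approx phi psi : poly_approx (fun z => symbol L (phi + z *: psi)).
Proof.
have [lL conL _] := cL; move=> k k0 e e0.
have [rho [d [r0 d0 hd]]] := HNb_continuous_bounded lL conL ltr01 e0.
have [N NP] := interpolant_lt ok phi psi (oner_neq0 _) (ltW k0) (ltW r0) d0.
have [w wM] := @prim_root_exists R N.+1 (ltn0Sn N).
pose a i := N.+1%:R^-1 * \sum_(j < N.+1) (w ^+ (j * i))^-1 * symbol L (phi + w ^+ j *: psi).
exists (\poly_(i < N.+1) a i) => z zk.
have /(norm_le_exp_sum ok (ltW r0)) h := NP N.+1 w z (leqnSn N) wM zk.
have {h} := norm_le_at0 ok ler01 (HNb_funP _) (hd (exp_elt _) h).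
rewrite convolution_exp_sum0 big_cat/= big_seq1/= mulr1 mulN1r nrm_distC.
congr (nrm (_ - _) <= _).
rewrite horner_poly big_map big_mkord/=.
under [RHS]eq_bigr do rewrite /a mulr_sumr mulr_suml.
rewrite exchange_big/=; apply: eq_bigr => j _.
rewrite mul1r /node_coef mulr_sumr mulr_suml; apply: eq_bigr => i _.
by rewrite divr1; ring.
Qed.

End Convolution.

End OperatorsOnExponentials.

(** * The identity theorem *)

Section IdentityTheorem.
Context {R : realType}.
Implicit Types (F : R[i] -> R[i]).

Lemma bounded_on_poly (P : {poly R[i]}) (k : R) : 0 <= k -> bounded_on k (fun z => P.[z]).
Proof.
move=> k0; exists (\sum_(i < size P) nrm P`_i * k ^+ i) => z zk.
rewrite horner_coef (le_trans (nrm_sum _ _ _))//; apply: ler_sum => i _.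
by rewrite nrmM nrmX ler_wpM2l ?nrm_ge0// lerXn2r ?nnegrE ?nrm_ge0.
Qed.

(** If the approximating polynomials are small near [0], their coefficients of low
  degree are small by Cauchy's estimate, while those of high degree contribute
  little because the polynomials are bounded on the large disc. *)
Lemma poly_approx_vanish F (k d : R) : 0 < d -> d <= k -> poly_approx_on k F ->
  (forall z, nrm z <= d -> F z = 0) -> forall z, nrm z <= k / 4 -> F z = 0.
Proof.
move=> d0 dk Fp Fd z zk; have k0 : 0 < k by lra.
apply/nrm_eq0/eqP; rewrite eq_le nrm_ge0 andbT; apply/ler_addgt0Pr => e e0; rewrite add0r.
have [P1 hP1] := Fp 1 ltr01; have [B0 PB0] := bounded_on_poly P1 (ltW k0).
(* Within a quarter of the radius, one factor [2^-1 ^+ j] makes the terms of high degree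
   small and another one makes their series converge. *)
pose B := `|B0| + 2; pose c := 2 * (k / d); pose a := e / 4.
have a0 : 0 < a by rewrite divr_gt0.
have B_gt0 : 0 < B by rewrite ltr_wpDl.
have c0 : 1 <= c.
  have : 1 <= k / d by rewrite ler_pdivlMr// mul1r.
  rewrite /c; lra.
have [J hJ] : exists J, B * 2^-1 ^+ J <= a.
  have h1 : `|2^-1 : R| < 1 by rewrite ger0_norm ?invr_ge0// invf_lt1// ltr1n.
  have aB : 0 < a / B by rewrite divr_gt0.
  have /cvgrPdist_lt/(_ _ aB)[N _ /(_ N (leqnn N))] := cvg_expr h1.
  rewrite sub0r normrN ger0_norm ?exprn_ge0 ?invr_ge0// ltr_pdivlMr// => h.
  by exists N; rewrite mulrC ltW.
have cJ : 0 < c ^+ J by rewrite exprn_gt0//; lra.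
pose n0 := Num.min 1 (Num.min (e / 4) (a / c ^+ J)).
have n0_gt0 : 0 < n0 by rewrite !lt_min ltr01 !divr_gt0.
have [P hP] := Fp n0 n0_gt0.
have n1 : n0 <= 1 by rewrite ge_min lexx.
have n2 : n0 <= e / 4 by rewrite !ge_min lexx orbT.
have n3 : n0 * c ^+ J <= a by rewrite -ler_pdivlMr// !ge_min lexx !orbT.
have PB x : nrm x <= k -> nrm P.[x] <= B.
  move=> xk; have := hP x xk; have := hP1 x xk; have := PB0 x xk.
  have := nrmD (P.[x] - F x) (F x - P1.[x] + P1.[x]); rewrite subrK subrK.
  have := nrmD (F x - P1.[x]) P1.[x]; rewrite subrK (nrm_distC P.[x]).
  have := ler_norm B0; rewrite /B; lra.
have Pd x : nrm x <= d -> nrm P.[x] <= n0.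
  by move=> xd; have := hP x (le_trans xd dk); rewrite Fd// sub0r nrmN.
have coef_le j : nrm (P`_j * z ^+ j) <= a * 2^-1 ^+ j.
  have zj : nrm (z ^+ j) <= (k / 4) ^+ j by rewrite nrmX lerXn2r ?nnegrE ?nrm_ge0//; lra.
  rewrite nrmM; have [jJ|Jj] := ltnP j J.
    have h := poly_cauchy_radius j d0 Pd; rewrite -ler_pdivlMr ?exprn_gt0// in h.
    apply: (le_trans (ler_pM (nrm_ge0 _) (nrm_ge0 _) h zj)).
    have -> : n0 / d ^+ j * (k / 4) ^+ j = n0 * (2^-1 * (k / d) * 2^-1) ^+ j.
      by rewrite -mulrA -exprVn -exprMn; congr (_ * _ ^+ _); field; rewrite gt_eqF.
    rewrite exprMn mulrA ler_wpM2r ?exprn_ge0 ?invr_ge0//; apply: le_trans n3.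
    rewrite ler_wpM2l ?(ltW n0_gt0)//.
    have kd : 0 <= k / d by rewrite divr_ge0 ?ltW.
    apply: (@le_trans _ _ (c ^+ j)); last by rewrite ler_weXn2l// ltnW.
    by rewrite lerXn2r ?nnegrE ?mulr_ge0 ?invr_ge0// /c; lra.
  have h := poly_cauchy_radius j k0 PB; rewrite -ler_pdivlMr ?exprn_gt0// in h.
  apply: (le_trans (ler_pM (nrm_ge0 _) (nrm_ge0 _) h zj)).
  have -> : B / k ^+ j * (k / 4) ^+ j = B * (2^-1 * 2^-1) ^+ j.
    by rewrite -mulrA -exprVn -exprMn; congr (_ * _ ^+ _); field; rewrite gt_eqF.
  rewrite exprMn mulrA ler_wpM2r ?exprn_ge0 ?invr_ge0//; apply: le_trans hJ.
  rewrite ler_wpM2l ?(ltW B_gt0)// ler_wiXn2l ?invr_ge0// invf_le1// ler1n//.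
have Pz : nrm P.[z] <= 2 * a.
  rewrite horner_coef (le_trans (nrm_sum _ _ _))//.
  apply: (@le_trans _ _ (\sum_(j < size P) a * 2^-1 ^+ j)); first exact: ler_sum.
  rewrite -mulr_sumr mulrC ler_wpM2r ?(ltW a0)//.
  by apply: sum_geometric_le2; rewrite invr_ge0 lexx andbT.
have := hP z (ltac:(lra)); have := nrmD (F z - P.[z]) P.[z]; rewrite subrK.
rewrite /a in Pz; lra.
Qed.

(** The set of points near which [F] vanishes is open, and it is also closed because the
  radius in [poly_approx_vanish] only depends on the disc of approximation. *)
Lemma identity_segment F :
  (forall z0, exists2 k, 0 < k & poly_approx_on k (fun z => F (z0 + z))) ->
  (exists2 d : R, 0 < d & forall z, nrm z <= d -> F z = 0) -> F 1 = 0.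
Proof.
move=> Fp [d0 d0_gt0 Fd0].
pose vanish (u : R) := exists2 d : R, 0 < d & forall z, nrm z <= d -> F (u%:C + z) = 0.
pose A := [set u : R | u <= 1 /\ forall v, 0 <= v -> v <= u -> vanish v].
have A0 : A 0.
  split=> // v v0 v0'; have -> : v = 0 by lra.
  by exists d0 => // z /Fd0; rewrite add0r.
have supA : has_sup A by split; [exists 0|exists 1 => u []].
have [k k0 Fk] := Fp (sup A)%:C.
have T0 : 0 <= sup A by apply: sup_upper_bound.
have k32 : 0 < k / 32 by rewrite divr_gt0.
have [u Au uT] := sup_adherent k32 supA.
have u_le : u <= sup A by apply: sup_upper_bound.
have [v [v0 v_le vu vk]] : exists v, [/\ 0 <= v, v <= 1, vanish v & `|v - sup A| < k / 32].
  have [u0|u0] := leP 0 u.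
    by exists u; split; [|exact: Au.1|apply: Au.2|rewrite ltr_norml; lra].
  by exists 0; split; [| |apply: A0.2|rewrite sub0r normrN ger0_norm//; lra].
have [d d_gt0 Fd] := vu.
have Fv : poly_approx_on (k / 2) (fun z => F (v%:C + z)).
  move=> e e0; have [P hP] := Fk e e0; exists (P \Po ('X + (v - sup A)%:C%:P)) => z zk.
  rewrite horner_comp hornerD hornerX hornerC.
  have -> : v%:C + z = (sup A)%:C + (z + (v - sup A)%:C).
    by rewrite rmorphB/=; ring.
  apply: hP; have := nrmD z (v - sup A)%:C; rewrite nrm_real; lra.
have Fz z : nrm z <= k / 8 -> F (v%:C + z) = 0.
  move=> zk; apply: (@poly_approx_vanish (fun z => F (v%:C + z)) (k / 2) (Num.min d (k / 2))) => //.
  - by rewrite lt_min d_gt0 divr_gt0.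
  - by rewrite ge_min lexx orbT.
  - by move=> y; rewrite le_min => /andP[yd _]; exact: Fd.
  - lra.
have near_v w : `|w - v| <= k / 16 -> vanish w.
  move=> wv; exists (k / 16); first by rewrite divr_gt0.
  move=> z zk; have -> : w%:C + z = v%:C + ((w - v)%:C + z) by rewrite rmorphB/=; ring.
  by apply: Fz; have := nrmD (w - v)%:C z; rewrite nrm_real; lra.
have [v1|v1] := leP (v + k / 16) 1; last first.
  have [d1 d1_gt0 /(_ 0)] := near_v 1 (ltac:(rewrite ger0_norm; lra)).
  by rewrite nrm0 addr0 (ltW d1_gt0) => ->.
have : v + k / 16 <= sup A.
  apply: sup_upper_bound => //; split=> // w w0 wv; have [wu|uw] := leP w u.
    exact: Au.2.
  have [wv'|wv'] := leP (v - k / 16) w.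
    by apply: near_v; rewrite ler_norml; lra.
  by exfalso; move: vk; rewrite ltr_norml; lra.
by move=> h; exfalso; move: vk; rewrite ltr_norml; lra.
Qed.

End IdentityTheorem.

(** * Density of the exponential sums *)

Section Density.
Context {R : realType} {E : normedModType R[i]} {r q s p : R}.
Hypothesis ok : @exponents_ok R r q s p.
Notation qnuc := (quasi_nuclear r q s p).
Notation qnorm := (@qnR R E r q s p).
Notation gnorm := (@ngauge R E r q s p).
Notation gsum := (@gauge_summable R E r q s p).
Notation space := (HNb r q s p E).
Notation norm_le := (@norm_le R E r q s p).
Notation exp_elt := (exp_elt ok).
Implicit Types (g h : seq (R[i] * dual E)) (phi psi : dual E).

(** On the line through a point, an entire function is locally a limit of polynomials. *)
Lemma entire_eq0 (f : E -> R[i]) : entire f -> (forall m x, dhat m f x = 0) ->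
  forall x, f x = 0.
Proof.
move=> ef f0 x; have nx := nrm_ge0 x.
rewrite -[x]scale1r; apply: (@identity_segment R (fun z => f (z *: x))).
  move=> z0; have [P [hP [d d0 dP]]] := ef (z0 *: x).
  have k0 : 0 < d / (nrm x + 1) / 2 by rewrite !divr_gt0//; lra.
  exists (d / (nrm x + 1) / 2) => // e e0; have [N _ /(_ N (leqnn N)) NP] := dP e e0.
  exists (\poly_(i < N) P i x) => z zk; apply/ltW.
  have -> : (\poly_(i < N) P i x).[z] =
      \sum_(m < N) P m ((z0 + z) *: x - z0 *: x).
    rewrite horner_poly; apply: eq_bigr => m _.
    by rewrite -scalerBl addrC addKr (hpoly_scale _ _ (hP m)) mulrC.
  apply: NP; rewrite -scalerBl addrC addKr nrmZ.
  apply: (@le_lt_trans _ _ (d / 2)); last lra.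
  apply: (@le_trans _ _ (d / (nrm x + 1) / 2 * (nrm x + 1))).
    by apply: ler_pM; rewrite ?nrm_ge0//; lra.
  rewrite mulrAC divfK// gt_eqF//; lra.
have [_ [d d0 dP]] := dhat_taylor ef.
exists (d / (nrm x + 1) / 2) => [|z zk]; first by rewrite !divr_gt0//; lra.
apply/nrm_eq0/eqP; rewrite eq_le nrm_ge0 andbT; apply/ler_addgt0Pr => e e0; rewrite add0r.
have [N _ /(_ N (leqnn N) (z *: x))] := dP e e0.
rewrite big1 => [h|m _]; last by rewrite f0 mulr0.
move: h; rewrite !subr0 => h; apply/ltW/h; rewrite nrmZ.
apply: (@le_lt_trans _ _ (d / 2)); last lra.
apply: (@le_trans _ _ (d / (nrm x + 1) / 2 * (nrm x + 1))).
  by apply: ler_pM; rewrite ?nrm_ge0//; lra.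
rewrite mulrAC divfK// gt_eqF//; lra.
Qed.

Lemma norm_le_eq0 (f : space) (rho : R) : 0 < rho ->
  (forall e, 0 < e -> norm_le rho f e) -> forall x, f x = 0.
Proof.
move=> r0 f0; have [ef qf _] := (HNb_setP ok _).1 (HNb_funP f).
have q0 m : qnorm m (dhat m f) = 0.
  apply/eqP; rewrite eq_le qnR_ge0 andbT; apply/ler_addgt0Pr => e e0; rewrite add0r.
  have w0 : 0 < rho ^+ m / m`!%:R by rewrite divr_gt0 ?exprn_gt0// ltr0n fact_gt0.
  have := summable_term m (ltW r0) (fun i => qnR_ge0 i _) (f0 _ (mulr_gt0 w0 e0)).
  by rewrite ler_pM2l.
apply: entire_eq0 => // m x.
have := @hpoly_ball R E m (dhat m f) 0 (qf m).1.
move=> h; apply/nrm_eq0/eqP; rewrite eq_le nrm_ge0 andbT.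
have := h (fun y hy => ltac:(by rewrite -(q0 m) (qnR_ball ok))) x.
by rewrite mul0r.
Qed.

(** Averaging over the rotations of the functionals by roots of unity isolates the part
  of degree [m] among the degrees below [M]. *)
Definition degree_part (M m : nat) (w : R[i]) g : seq (R[i] * dual E) :=
  [seq (M%:R^-1 * (w ^+ (j * m))^-1 * cf.1, w ^+ j *: cf.2) |
    cf : R[i] * dual E <- g, j <- index_iota 0 M].

Lemma power_sum_degree_part M m w g k x : M.-primitive_root w -> (m < M)%N -> (k < M)%N ->
  power_sum (degree_part M m w g) k x = (k == m)%:R * power_sum g k x.
Proof.
move=> wM mM kM; have M0 : M%:R != 0 :> R[i] by rewrite pnatr_eq0; case: M mM {wM kM}.
rewrite /power_sum big_allpairs_dep/= mulr_sumr; apply: eq_bigr => cf _.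
rewrite big_mkord (eq_bigr (fun j : 'I_M => M%:R^-1 * (cf.1 * cf.2 x ^+ k) *
    (w ^+ (j * k) * (w ^+ (j * m))^-1))).
  by rewrite -mulr_sumr (sum_prim_root wM)//; field.
move=> j _; transitivity (M%:R^-1 * (w ^+ (j * m))^-1 * cf.1 * (w ^+ j * cf.2 x) ^+ k) => //.
by rewrite exprMn -exprM; ring.
Qed.

Lemma sum_power_le g : exists C A : R, [/\ 0 <= C, 0 <= A & forall k,
  \sum_(cf <- g) nrm cf.1 * nrm cf.2 ^+ k <= C * A ^+ k].
Proof.
elim: g => [|cf g [C [A [C0 A0 CA]]]].
  by exists 0, 0; split=> // k; rewrite big_nil mul0r.
exists (nrm cf.1 + C), (nrm cf.2 + A).
have [c0 f0] := (nrm_ge0 cf.1, nrm_ge0 cf.2).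
split=> [||k]; [exact: addr_ge0|exact: addr_ge0|].
rewrite big_cons mulrDl; apply: lerD.
  by rewrite ler_wpM2l// lerXn2r ?nnegrE ?addr_ge0// lerDl.
by apply: (le_trans (CA k)); rewrite ler_wpM2l// lerXn2r ?nnegrE ?addr_ge0// lerDr.
Qed.

Lemma ngauge_degree_part M m w g k : M.-primitive_root w ->
  gnorm k (power_sum (degree_part M m w g) k) <= \sum_(cf <- g) nrm cf.1 * nrm cf.2 ^+ k.
Proof.
move=> wM; have M0 := prim_order_gt0 wM.
apply: (le_trans (ngauge_power_sum ok _ _)).
rewrite big_allpairs_dep/=; apply: ler_sum => cf _; rewrite big_mkord.
rewrite (eq_bigr (fun=> M%:R^-1 * (nrm cf.1 * nrm cf.2 ^+ k))).
  rewrite sumr_const card_ord -[leLHS]mulr_natl mulrA divff ?mul1r//.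
  by rewrite pnatr_eq0 -lt0n.
move=> j _; rewrite nrmM nrmM !nrmV (nrm_prim_root _ wM) nrmZ (nrm_prim_root _ wM).
by rewrite invr1 mulr1 mul1r nrm_nat mulrA.
Qed.

(** The polynomial is approximated by a power sum of degree [m]; the averaged
  exponential sum has this part in degree [m], and nothing else below the degree [M],
  beyond which it is negligible. *)
Lemma homogeneous_approx m (P : E -> R[i]) (rho e : R) : qnuc m P -> 0 < rho -> 0 < e ->
  exists g, summable rho (fun k => qnorm k (fun x => (k == m)%:R * P x - power_sum g k x)) e.
Proof.
move=> qP r0 e0; have e2 : 0 < e / 2 by lra.
have w0 : 0 < rho ^+ m / m`!%:R by rewrite divr_gt0 ?exprn_gt0// ltr0n fact_gt0.
have ew : 0 < e / 2 / (rho ^+ m / m`!%:R) by rewrite divr_gt0.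
have [g gP] := qnR_approx_power_sum ok qP ew.
have [C [A [C0 A0 CA]]] := sum_power_le g.
have C1 : 0 < e / 2 / (C + 1) by rewrite divr_gt0//; lra.
have [N NP] := exp_tail_lt (rho * A) C1.
pose M := maxn N m.+1; have mM : (m < M)%N by rewrite leq_maxr.
have [w wM] := @prim_root_exists R M (leq_ltn_trans (leq0n m) mM).
exists (degree_part M m w g).
pose b1 k := (k == m)%:R * (e / 2 / (rho ^+ m / m`!%:R)).
pose b2 k := if (k < M)%N then 0 else C * A ^+ k.
have hb1 : summable rho b1 (e / 2).
  move=> K; rewrite /weighted_sum.
  apply: (@le_trans _ _ (\sum_(k < K) (k == m :> nat)%:R * (e / 2))).
    apply: ler_sum => k _; rewrite /b1; case: eqP => [->|_]; last by rewrite !mul0r mulr0.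
    by rewrite !mul1r mulrC divfK// gt_eqF.
  rewrite -mulr_suml ler_piMl ?(ltW e2)//.
  have [mK|Km] := ltnP m K.
    rewrite (bigD1 (Ordinal mK))//= eqxx big1 ?addr0// => k km.
    by case: eqP => // km'; move/eqP: km; case; exact: val_inj.
  rewrite big1 ?ler01// => k _; case: eqP => // km.
  by have := ltn_ord k; rewrite km ltnNge Km.
have hb2 : summable rho b2 (e / 2).
  apply: (@summable_le _ _ _ b2) => [|//|K]; first exact: ltW.
  apply: (@le_trans _ _ (C * exp_tail (rho * A) M)).
    by apply: summable_exp => //; [exact: ltW|move=> k; rewrite /b2 => ->|
      move=> k; rewrite /b2 ltnNge => ->].
  have := NP M (leq_maxl _ _); rewrite ltr_pdivlMr; last lra.
  have := exp_tail_ge0 M (mulr_ge0 (ltW r0) A0); lra.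
apply: (@summable_le _ _ _ (fun k => b1 k + b2 k)) => [|k|]; first exact: ltW; last first.
  by have := summableD hb1 hb2; rewrite -splitr.
rewrite /b1 /b2; case: (ltnP k M) => kM.
  rewrite addr0; case: (eqVneq k m) => [->|km].
    rewrite mul1r; apply: le_trans gP; rewrite le_eqVlt; apply/orP; left; apply/eqP.
    congr qnorm; apply/funext => x; rewrite power_sum_degree_part// eqxx !mul1r//.
  rewrite mul0r (_ : (fun x => _) = fun=> 0) ?(qnR0 ok)//; apply/funext => x.
  by rewrite power_sum_degree_part// (negbTE km) !mul0r subrr.
have km : (k == m) = false by apply/negP => /eqP km; rewrite km leqNgt mM in kM.
rewrite km mul0r add0r (_ : (fun x => _) = fun x => -1 * power_sum (degree_part M m w g) k x + 0).
  apply: le_trans (CA k); apply: le_trans (ngauge_degree_part m g k wM).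
  apply: le_trans (qnR_le_ngauge ok _); last exact: nuc0_power_sum.
  have := qnR_lin ok (-1) (qnuc_power_sum ok (degree_part M m w g) k) (qnuc0 ok k).
  by rewrite nrmN nrm1 mul1r (qnR0 ok) addr0.
by apply/funext => x; rewrite !mul0r sub0r mulN1r addr0.
Qed.

Lemma weighted_sum_nat (rho : R) (b : nat -> R) M :
  weighted_sum rho b M = \sum_(0 <= m < M) rho ^+ m / m`!%:R * b m.
Proof. by rewrite big_mkord. Qed.

Lemma partial_approx (f : space) (rho e : R) N : 0 < rho -> 0 < e ->
  exists g, summable rho
    (fun k => qnorm k (fun x => (k < N)%N%:R * dhat k f x - power_sum g k x)) e.
Proof.
move=> r0 e0; have [ef qf _] := (HNb_setP ok _).1 (HNb_funP f).
have qb (b : bool) m : qnuc m (fun x => b%:R * dhat m f x).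
  by have := qnuc_lin ok b%:R (qf m) (qnuc0 ok m); under eq_fun do rewrite addr0.
elim: N e e0 => [|N IH] e e0.
  exists [::] => M; rewrite /weighted_sum big1 ?ltW// => m _.
  rewrite (_ : (fun x => _) = fun=> 0) ?(qnR0 ok) ?mulr0//.
  by apply/funext => x; rewrite /power_sum big_nil ltn0 mul0r subrr.
have e2 : 0 < e / 2 by lra.
have [g1 h1] := IH _ e2; have [g2 h2] := homogeneous_approx (qf N) r0 e2.
exists (g1 ++ g2).
have := summableD h1 h2; rewrite -splitr; apply: summable_le => [|k]; first exact: ltW.
pose u x := (k < N)%N%:R * dhat k f x - power_sum g1 k x.
pose v x := (k == N)%:R * dhat N f x - power_sum g2 k x.
rewrite [in leLHS](_ : (fun x => _) = fun x => u x + v x).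
  apply: (qnR_add ok); apply: (qnuc_sub ok); [exact: qb|exact: qnuc_power_sum| |exact: qnuc_power_sum].
  case: eqP => [->|_]; first exact: qb.
  rewrite (_ : (fun x => _) = fun=> 0); first exact: qnuc0.
  by apply/funext => x; rewrite mul0r.
apply/funext => x; rewrite /u /v power_sum_cat ltnS leq_eqVlt.
by case: eqP => [->|_]; rewrite ?ltnn/= ?mul0r ?add0r ?mul1r; ring.
Qed.

(** The Taylor series is truncated, and its terms are approximated one by one. *)
Lemma exp_sum_dense (f : space) (rho e : R) : 0 < rho -> 0 < e ->
  exists g, norm_le rho (fun x => f x - exp_sum g x) e.
Proof.
move=> r0 e0; have [ef qf sf] := (HNb_setP ok _).1 (HNb_funP f).
have e2 : 0 < e / 2 by lra.
have [B hB] := sf rho r0.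
pose S := weighted_sum rho (fun m => qnorm m (dhat m f)).
have Snd M N : (M <= N)%N -> S M <= S N.
  move=> MN; rewrite /S !weighted_sum_nat (big_cat_nat _ MN)//= lerDl; apply: sumr_ge0 => i _.
  by rewrite mulr_ge0 ?weight_ge0 ?qnR_ge0 ?(ltW r0).
have [N NP] := bounded_nd_cauchy e2 Snd hB.
have [g gP] := partial_approx f N r0 e2; exists g.
have tail : summable rho (fun m => (N <= m)%N%:R * qnorm m (dhat m f)) (e / 2).
  move=> M; have [NM|MN] := leqP N M; last first.
    rewrite /weighted_sum big1 ?(ltW e2)// => m _.
    by rewrite leqNgt (ltn_trans (ltn_ord m) MN) mul0r mulr0.
  apply: le_trans (NP M NM); rewrite /S !weighted_sum_nat.
  rewrite [X in _ <= X - _](big_cat_nat _ NM)//= addrAC subrr add0r.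
  rewrite (big_cat_nat _ NM)//= big_nat big1 ?add0r => [|m /andP[_ mN]]; last first.
    by rewrite leqNgt mN mul0r mulr0.
  rewrite le_eqVlt; apply/orP; left; apply/eqP; rewrite !big_nat.
  by apply: eq_bigr => m /andP[-> _]; rewrite mul1r.
have := summableD gP tail; rewrite -splitr; apply: summable_le => [|m]; first exact: ltW.
have [ee ed] := HNb_exp_sum ok g; have [eg _ _] := (HNb_setP ok _).1 ee.
rewrite (_ : (fun x => f x - _) = (fun x => -1 * exp_sum g x + f x)); last first.
  by apply/funext => x; ring.
rewrite dhat_lin// ed.
pose u x := (m < N)%N%:R * dhat m f x - power_sum g m x.
pose v x := (N <= m)%N%:R * dhat m f x + 0.
have qb (b : bool) : qnuc m (fun x => b%:R * dhat m f x + 0).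
  by apply: (qnuc_lin ok) => //; exact: qnuc0.
rewrite [in leLHS](_ : (fun x => _) = fun x => u x + v x).
  apply: (le_trans (qnR_add ok _ _)).
  - apply: (qnuc_sub ok); last exact: qnuc_power_sum.
    by have := qb (m < N)%N; under eq_fun do rewrite addr0.
  - exact: qb.
  rewrite lerD2l; have := qnR_lin ok (N <= m)%N%:R (qf m) (qnuc0 ok m).
  by rewrite (qnR0 ok) addr0 nrm_nat.
apply/funext => x; rewrite /u /v; case: ltnP => _; rewrite ?mul0r ?mul1r; ring.
Qed.

End Density.

(** * Approximation by exponentials of prescribed functionals *)

Section DenseSequences.
Context {R : realType}.

Definition rational_complex (ab : rat * rat) : R[i] :=
  (ratr ab.1)%:C + 'i%C * (ratr ab.2)%:C.

Lemma rational_complex_dense (c : R[i]) (e : R) : 0 < e ->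
  exists ab, nrm (c - rational_complex ab) < e.
Proof.
move=> e0; have e3 : 0 < e / 3 by lra.
have ratP (a : R) : exists x : rat, `|a - ratr x| <= e / 3.
  have [|x] := @rat_in_itvoo R (a - e / 3) a; first lra.
  by rewrite in_itv/= => /andP[x1 x2]; exists x; rewrite ger0_norm; lra.
have [x xP] := ratP (complex.Re c); have [y yP] := ratP (complex.Im c).
exists (x, y); apply: (le_lt_trans (nrm_le_ReIm _)).
have -> : complex.Re (c - rational_complex (x, y)) = complex.Re c - ratr x.
  by case: c {xP yP} => a b /=; ring.
have -> : complex.Im (c - rational_complex (x, y)) = complex.Im c - ratr y.
  by case: c {xP yP} => a b /=; ring.
lra.
Qed.

Lemma dense_sequence (V : normedModType R[i]) : separable V ->
  exists d : nat -> V, forall x e, 0 < e -> exists n, nrm (x - d n) < e.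
Proof.
move=> [D cD dD]; have /countable_injP[h hinj] := cD.
have hex (n : nat) : exists x, (exists2 y, D y & h y = n) -> D x /\ h x = n.
  have [[y Dy hy]|no] := pselect (exists2 y, D y & h y = n); first by exists y.
  by exists 0.
have [f fP] := choice hex; exists f => x e e0.
have oB : open [set y : V | nrm (x - y) < e].
  rewrite openE => y /= xy; apply/nbhs_nrmP; exists (e - nrm (x - y)); first lra.
  move=> z yz /=; have := nrmD (x - y) (y - z).
  by rewrite addrA subrK (nrm_distC y); lra.
have [|y [/= xy Dy]] := dD [set y : V | nrm (x - y) < e] _ oB.
  by exists x; rewrite /= subrr nrm0.
have [Df hf] := fP (h y) (ex_intro2 _ _ y Dy erefl).
by exists (h y); rewrite (_ : f (h y) = y)//; apply: hinj; rewrite ?inE.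
Qed.

End DenseSequences.

Section GaugeApproximation.
Context {R : realType} {E : normedModType R[i]} {r q s p : R}.
Hypothesis ok : @exponents_ok R r q s p.
Notation gnorm := (@ngauge R E r q s p).
Notation gsum := (@gauge_summable R E r q s p).
Notation space := (HNb r q s p E).
Notation norm_le := (@norm_le R E r q s p).
Notation exp_elt := (exp_elt ok).
Notation expseq := (seq (R[i] * dual E)).
Implicit Types (phi psi : dual E) (rho e : R).

Definition gauge_dist rho (g h : expseq) e := gsum rho (g ++ scale_coef (-1) h) e.

Lemma gauge_dist_le rho (g h : expseq) B C : B <= C ->
  gauge_dist rho g h B -> gauge_dist rho g h C.
Proof. by move=> BC gB M; exact: le_trans (gB M) BC. Qed.

Lemma gauge_summable_mono rho (t B : R) (g : expseq) : 0 <= t -> t <= rho ->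
  gsum rho g B -> gsum t g B.
Proof. by move=> t0 tr; apply: summable_mono t0 tr _ => m; exact: ngauge_ge0. Qed.

Lemma gauge_dist_refl rho (g : expseq) e : 0 <= e -> gauge_dist rho g g e.
Proof.
move=> e0 M; rewrite /weighted_sum big1// => m _.
rewrite (_ : power_sum _ m = fun=> 0) ?ngauge0 ?mulr0//.
by apply/funext => x; rewrite power_sum_sub subrr.
Qed.

Lemma gauge_dist_trans rho (g h k : expseq) B C : 0 <= rho ->
  gauge_dist rho g h B -> gauge_dist rho h k C -> gauge_dist rho g k (B + C).
Proof.
move=> r0 gB hC; have := gauge_summable_cat ok r0 gB hC.
by apply: gauge_summable_eq => m x; rewrite !(power_sum_cat, power_sum_scale); ring.
Qed.

Lemma gauge_dist_cat rho (g h g' h' : expseq) B C : 0 <= rho ->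
  gauge_dist rho g g' B -> gauge_dist rho h h' C ->
  gauge_dist rho (g ++ h) (g' ++ h') (B + C).
Proof.
move=> r0 gB hC; have := gauge_summable_cat ok r0 gB hC.
by apply: gauge_summable_eq => m x; rewrite !(power_sum_cat, power_sum_scale); ring.
Qed.

Lemma gauge_summable_scale rho (g : expseq) b B : 0 <= rho ->
  gsum rho g B -> gsum rho (scale_coef b g) (nrm b * B).
Proof.
move=> r0 gB; apply: summable_le r0 _ (summableZ (nrm_ge0 b) gB) => m.
have := ngauge_lin ok b (nuc0_power_sum ok g m) (nuc0_0 ok m).
rewrite (ngauge0 ok) addr0; apply: le_trans; rewrite le_eqVlt; apply/orP; left; apply/eqP.
by congr gnorm; apply/funext => x; rewrite power_sum_scale addr0.
Qed.

Lemma gauge_dist_scale rho (g h : expseq) b B : 0 <= rho ->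
  gauge_dist rho g h B -> gauge_dist rho (scale_coef b g) (scale_coef b h) (nrm b * B).
Proof.
move=> r0 /(gauge_summable_scale b r0); apply: gauge_summable_eq => m x.
by rewrite !(power_sum_cat, power_sum_scale); ring.
Qed.

Lemma gauge_dist_sym rho (g h : expseq) B : 0 <= rho ->
  gauge_dist rho g h B -> gauge_dist rho h g B.
Proof.
move=> r0 /(gauge_summable_scale (-1) r0); rewrite nrmN nrm1 mul1r.
by apply: gauge_summable_eq => m x; rewrite !(power_sum_cat, power_sum_scale); ring.
Qed.

Lemma norm_le_gauge_dist rho (g h : expseq) B : 0 <= rho -> gauge_dist rho g h B ->
  norm_le rho (fun x => exp_sum g x - exp_sum h x) B.
Proof.
move=> r0 /(norm_le_exp_sum ok r0).
by rewrite (_ : exp_sum _ = fun x => exp_sum g x - exp_sum h x)//;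
  apply/funext => x; rewrite exp_sum_sub.
Qed.

Lemma gauge_dist_to_sum rho (g h : expseq) B C : 0 <= rho ->
  gauge_dist rho g h B -> gsum rho h C -> gsum rho g (B + C).
Proof.
move=> r0 gB hC; have := gauge_summable_cat ok r0 gB hC.
by apply: gauge_summable_eq => m x; rewrite !(power_sum_cat, power_sum_scale); ring.
Qed.

(** Approximation for the gauges only involves lists, and it implies approximation for
  all the seminorms. *)
Definition approximable (S : dual E -> Prop) (g : expseq) : Prop :=
  forall rho e, 0 < rho -> 0 < e -> exists g', (forall cf, cf \in g' -> S cf.2) /\
    gauge_dist rho g g' e.

Lemma approximable_list (S : dual E -> Prop) : (forall phi, approximable S [:: (1, phi)]) ->
  forall g, approximable S g.
Proof.
move=> S1; elim=> [|[c phi] g IH] rho e r0 e0.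
  by exists [::]; split=> //; apply: gauge_dist_refl; exact: ltW.
have e2 : 0 < e / 2 by lra.
have c1 : 0 < nrm c + 1 by have := nrm_ge0 c; lra.
have [g1 [S1g h1]] := S1 phi rho (e / 2 / (nrm c + 1)) r0 (divr_gt0 e2 c1).
have [g2 [Sg h2]] := IH rho (e / 2) r0 e2.
exists (scale_coef c g1 ++ g2); split.
  by move=> cf; rewrite mem_cat => /orP[/mapP[cf' /S1g ? ->]//|]; exact: Sg.
have h3 := gauge_dist_cat (ltW r0) (gauge_dist_scale c (ltW r0) h1) h2.
apply: (@gauge_dist_le _ _ _ (nrm c * (e / 2 / (nrm c + 1)) + e / 2)).
  have : nrm c * (e / 2 / (nrm c + 1)) <= e / 2.
    by rewrite mulrCA ler_piMr ?(ltW e2)// ler_pdivrMr; lra.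
  lra.
by move: h3; rewrite /scale_coef/= mulr1.
Qed.

(** Every functional lies on a complex line through [phi0], and its exponential is
  interpolated at nodes on a small circle of this line, which belong to [S]. *)
Lemma absorbing_approximable (S : dual E -> Prop) phi0 :
  (forall psi, exists2 t : R, 0 < t & forall z : R[i], nrm z <= t -> S (phi0 + z *: psi)) ->
  forall g, approximable S g.
Proof.
move=> absS; apply: approximable_list => phi rho e r0 e0.
have [t t0 tS] := absS (phi - phi0).
have b0 : t%:C != 0 by rewrite real_complex_eq0 gt_eqF.
have nb : nrm t%:C = t by rewrite nrm_real gtr0_norm.
have [N NP] := interpolant_lt ok phi0 (phi - phi0) b0 ler01 (ltW r0) e0.
have [w wM] := @prim_root_exists R N.+1 (ltn0Sn N).
exists (interpolant N.+1 w t%:C 1 phi0 (phi - phi0)); split.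
  move=> _ /mapP[j _ ->]/=; apply: tS.
  by rewrite nrmM nb (nrm_prim_root _ wM) mulr1.
apply: gauge_dist_sym; first exact: ltW.
have := NP N.+1 w 1 (leqnSn N) wM; rewrite nrm1 => /(_ (lexx 1)).
have -> : phi0 + 1 *: (phi - phi0) = phi by rewrite scale1r addrC subrK.
by [].
Qed.

(** Both powers are interpolated at the same nodes, and the coefficients of the two
  interpolations differ by at most [nrm z]. *)
Lemma ngauge_power_lipschitz phi psi (z : R[i]) m : nrm psi <= 1 -> nrm z <= 1 ->
  gnorm m (fun x => (phi x + z * psi x) ^+ m - phi x ^+ m)
    <= 2 * nrm z * (2 * (nrm phi + 1)) ^+ m.
Proof.
move=> p1 z1; have n0 := nrm_ge0 phi; have z0 := nrm_ge0 z.
have [w wM] := @prim_root_exists R m.+1 (ltn0Sn m).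
pose M := m.+1; have M0 : 0 < M%:R :> R by rewrite ltr0n.
pose g : expseq := [seq (node_coef M w 1 z j - node_coef M w 1 0 j,
   phi + w ^+ j *: psi) | j <- index_iota 0 M].
have -> : (fun x => (phi x + z * psi x) ^+ m - phi x ^+ m) = power_sum g m.
  apply/funext => x; rewrite -(power_sum_interpolant z phi psi x wM (oner_neq0 _) (ltnSn m)).
  have -> : phi x ^+ m = (phi x + 0 * psi x) ^+ m by rewrite mul0r addr0.
  rewrite -(power_sum_interpolant 0 phi psi x wM (oner_neq0 _) (ltnSn m)).
  rewrite /power_sum !big_map -sumrB; apply: eq_bigr => j _ /=.
  by rewrite mulrBl mul1r.
apply: (le_trans (ngauge_power_sum ok _ _)); rewrite big_map big_mkord/=.
have coef_le (j : nat) : nrm (node_coef M w 1 z j - node_coef M w 1 0 j) <= nrm z.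
  rewrite /node_coef -mulrBr -sumrB nrmM nrmV nrm_nat ler_pdivrMl//.
  apply: (le_trans (nrm_sum _ _ _)); apply: (@le_trans _ _ (\sum_(k < M) nrm z)).
    apply: ler_sum => k _; rewrite -mulrBr nrmM nrmV (nrm_prim_root _ wM) invr1 mul1r.
    rewrite !divr1; case: k => -[|k] kM /=; first by rewrite !expr0 subrr nrm0.
    rewrite expr0n subr0 nrmX exprS ler_piMr// exprn_ile1//.
  by rewrite sumr_const card_ord -[leLHS]mulr_natl.
apply: (@le_trans _ _ (\sum_(j < M) nrm z * (nrm phi + 1) ^+ m)).
  apply: ler_sum => j _; apply: ler_pM; rewrite ?nrm_ge0 ?exprn_ge0 ?nrm_ge0//.
  rewrite lerXn2r ?nnegrE ?nrm_ge0 ?addr_ge0//.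
  by rewrite (le_trans (nrmD _ _))// lerD2l nrmZ (nrm_prim_root _ wM) mul1r.
rewrite sumr_const card_ord -[leLHS]mulr_natl [leRHS](_ : _ =
    2 * 2 ^+ m * (nrm z * (nrm phi + 1) ^+ m)); last by rewrite exprMn; ring.
rewrite ler_wpM2r ?mulr_ge0 ?exprn_ge0 ?addr_ge0// -exprS -natrX ler_nat ltnW//.
exact: ltn_expl.
Qed.

Lemma gauge_dist_near phi rho e : 0 < rho -> 0 < e -> exists2 d : R, 0 < d &
  forall phi', nrm (phi' - phi) <= d -> gauge_dist rho [:: (1, phi')] [:: (1, phi)] e.
Proof.
move=> r0 e0; have n0 := nrm_ge0 phi.
have [T [T0 TE]] : exists T, 0 <= T /\ T = exp_tail (rho * (2 * (nrm phi + 1))) 0.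
  eexists; split; last by [].
  by apply: exp_tail_ge0; rewrite !mulr_ge0 ?addr_ge0// ltW.
have T2 : 0 < 2 * T + 1 by lra.
exists (Num.min 1 (e / (2 * T + 1))); first by rewrite lt_min ltr01 divr_gt0.
move=> phi' pd.
have [z [z0 zE]] : exists z, 0 <= z /\ z = nrm (phi' - phi).
  by exists (nrm (phi' - phi)); split; first exact: nrm_ge0.
have [zN|zn] := eqVneq z 0.
  have -> : phi' = phi by apply/eqP; rewrite -subr_eq0; apply/eqP/nrm_eq0; rewrite -zE.
  by apply: gauge_dist_refl; exact: ltW.
move: pd; rewrite -zE le_min => /andP[z1 zd].
have zC : z%:C != 0 by rewrite real_complex_eq0.
have nz : nrm z%:C = z by rewrite nrm_real ger0_norm.
have psi1 : nrm ((z%:C)^-1 *: (phi' - phi)) <= 1 by rewrite nrmZ nrmV nz -zE mulVf.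
rewrite -nz in z1.
apply: (@gauge_dist_le _ _ _ (2 * z * T)).
  move: zd; rewrite ler_pdivlMr// => zd.
  have -> : 2 * z * T = z * (2 * T) by ring.
  by apply: le_trans zd; rewrite ler_wpM2l// lerDl.
rewrite TE; apply: summable_exp; [exact: ltW| | |by []|].
- by rewrite mulr_ge0// addr_ge0.
- by rewrite mulr_ge0.
move=> m _; rewrite -[in leRHS]nz; apply: le_trans (ngauge_power_lipschitz phi m psi1 z1).
rewrite le_eqVlt; apply/orP; left; apply/eqP; congr gnorm; apply/funext => x.
rewrite power_sum_sub /power_sum !big_seq1 /= !mul1r; congr (_ ^+ _ - _).
transitivity (phi x + z%:C * (z%:C^-1 * (phi' x - phi x))); last by [].
by rewrite mulrA mulfV// mul1r addrC subrK.
Qed.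

Lemma gauge_dist_coef c c' phi rho : 0 <= rho ->
  gauge_dist rho [:: (c, phi)] [:: (c', phi)] (nrm (c - c') * exp_tail (rho * nrm phi) 0).
Proof.
move=> r0; apply: summable_exp; rewrite ?nrm_ge0// => m _.
have -> : power_sum ([:: (c, phi)] ++ scale_coef (-1) [:: (c', phi)]) m =
    power_sum [:: (c - c', phi)] m.
  by apply/funext => x; rewrite power_sum_sub /power_sum !big_seq1/= mulrBl.
by apply: (le_trans (ngauge_power_sum ok _ _)); rewrite big_seq1.
Qed.

Lemma mult_coef_small (u : dual E -> R[i]) (g : expseq) rho e : 0 <= rho -> 0 < e ->
  (forall cf, cf \in g -> nrm (u cf.2) < 1) ->
  exists N, forall n, (N <= n)%N -> gsum rho (mult_coef (fun phi => u phi ^+ n) g) e.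
Proof.
move=> r0; elim: g e => [|cf g IH] e e0 ug.
  exists 0%N => n _ M; rewrite /weighted_sum big1 ?ltW// => m _.
  rewrite (_ : power_sum _ m = fun=> 0) ?ngauge0 ?mulr0//.
  by apply/funext => x; rewrite /power_sum big_nil.
have e2 : 0 < e / 2 by lra.
have [|N1 H1] := IH _ e2; first by move=> cf' cf'g; apply: ug; rewrite inE cf'g orbT.
have u1 : nrm (u cf.2) < 1 by apply: ug; rewrite mem_head.
pose C := nrm cf.1 * exp_tail (rho * nrm cf.2) 0.
have C0 : 0 <= C by rewrite mulr_ge0 ?nrm_ge0// exp_tail_ge0// mulr_ge0 ?nrm_ge0.
have [N2 H2] : exists N, forall n, (N <= n)%N -> nrm (u cf.2) ^+ n * C <= e / 2.
  have h1 : `|nrm (u cf.2)| < 1 by rewrite ger0_norm ?nrm_ge0.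
  have eC : 0 < e / 2 / (C + 1) by rewrite divr_gt0//; lra.
  have /cvgrPdist_lt/(_ _ eC)[N _ NP] := cvg_expr h1.
  exists N => n /NP; rewrite sub0r normrN ger0_norm ?exprn_ge0 ?nrm_ge0//.
  have : 0 <= nrm (u cf.2) ^+ n by rewrite exprn_ge0 ?nrm_ge0.
  rewrite ltr_pdivlMr; last lra.
  set v := nrm _ ^+ n => v0; nra.
exists (maxn N1 N2) => n; rewrite geq_max => /andP[/H1 h1 /H2 h2].
suff h3 : gsum rho [:: (cf.1 * u cf.2 ^+ n, cf.2)] (e / 2).
  by have := gauge_summable_cat ok r0 h3 h1; rewrite -splitr.
have : gsum rho [:: (cf.1 * u cf.2 ^+ n, cf.2)]
    (nrm (cf.1 * u cf.2 ^+ n) * exp_tail (rho * nrm cf.2) 0).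
  apply: summable_exp; rewrite ?nrm_ge0// => m _.
  by apply: (le_trans (ngauge_power_sum ok _ _)); rewrite big_seq1.
move=> h3 M; apply: le_trans (h3 M) _; apply: le_trans h2.
by rewrite nrmM nrmX /C; lra.
Qed.

Lemma term_approx (d : nat -> dual E) c phi rho e :
  (forall psi e', 0 < e' -> exists n, nrm (psi - d n) < e') -> 0 < rho -> 0 < e ->
  exists n ab, gauge_dist rho [:: (c, phi)] [:: (rational_complex ab, d n)] e.
Proof.
move=> dP r0 e0; have e2 : 0 < e / 2 by lra.
have c1 : 0 < nrm c + 1 by have := nrm_ge0 c; lra.
have B1 : nrm c * (e / 2 / (nrm c + 1)) <= e / 2.
  by rewrite mulrCA ler_piMr ?(ltW e2)// ler_pdivrMr; lra.
have [del del0 delP] := gauge_dist_near phi r0 (divr_gt0 e2 c1).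
have [n nP] := dP phi del del0.
have [T [T0 TE]] : exists T, 0 <= T /\ T = exp_tail (rho * nrm (d n)) 0.
  eexists; split; last by [].
  by rewrite exp_tail_ge0// mulr_ge0 ?nrm_ge0// ltW.
have T1 : 0 < T + 1 by rewrite ltr_wpDl.
have [ab abP] := rational_complex_dense c (divr_gt0 e2 T1).
exists n, ab.
have A1 : gauge_dist rho [:: (c, phi)] [:: (c, d n)] (nrm c * (e / 2 / (nrm c + 1))).
  have := delP (d n); rewrite nrm_distC => /(_ (ltW nP)).
  move=> /(gauge_dist_sym (ltW r0))/(gauge_dist_scale c (ltW r0)).
  by rewrite /scale_coef/= mulr1.
have A2 := gauge_dist_coef c (rational_complex ab) (d n) (ltW r0).
apply: gauge_dist_le (gauge_dist_trans (ltW r0) A1 A2).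
rewrite -TE [leRHS]splitr; apply: lerD => //.
move: abP; rewrite ltr_pdivlMr// => /ltW; apply: le_trans.
by rewrite ler_wpM2l ?nrm_ge0// lerDl.
Qed.

(** The coefficients are taken in the rational complex numbers and the functionals in
  a countable dense set. *)
Lemma countable_exp_sums : separable (dual E) -> exists D : nat -> expseq,
  forall g rho e, 0 < rho -> 0 < e -> exists i, gauge_dist rho g (D i) e.
Proof.
move=> /dense_sequence[d dP].
pose decode (l : seq (rat * rat * nat)) : expseq :=
  [seq (rational_complex abn.1, d abn.2) | abn <- l].
exists (fun k => if unpickle k is Some l then decode l else [::]) => g rho e r0 e0.
suff [l lP] : exists l, gauge_dist rho g (decode l) e by exists (pickle l); rewrite pickleK.
elim: g e e0 => [|[c phi] g IH] e e0.
  by exists [::]; apply: gauge_dist_refl; exact: ltW.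
have e2 : 0 < e / 2 by rewrite divr_gt0.
have [l lP] := IH _ e2.
have [n [ab h]] := term_approx c phi dP r0 e2.
exists ((ab, n) :: l); rewrite [e]splitr.
exact: (gauge_dist_cat (ltW r0) h lP).
Qed.

End GaugeApproximation.

(** * The symbol of a convolution operator *)

Section SymbolOfConvolution.
Context {R : realType} {E : normedModType R[i]} {r q s p : R}.
Hypothesis ok : @exponents_ok R r q s p.
Notation space := (HNb r q s p E).
Notation norm_le := (@norm_le R E r q s p).
Notation exp_elt := (exp_elt ok).
Notation approx := (@approximable R E r q s p).
Notation symbol := (symbol ok).
Variable L : space -> space.
Hypothesis cL : convolution_operator L.

(** Exponentials span a dense subspace, so an operator whose symbol is constant is
  a multiple of the identity. *)
Lemma scalar_of_constant_symbol c : (forall phi, symbol L phi = c) -> scalar_operator L.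
Proof.
have [lL conL _] := cL; move=> symc; exists c => f x.
pose u : space := MkHNb (HNb_lin ok (- c) (HNb_funP f) (HNb_funP (L f))).
suff /(_ x) h : forall y, u y = 0.
  by apply/eqP; rewrite -subr_eq0 addrC -mulNr; apply/eqP.
apply: (norm_le_eq0 ok ltr01) => e e0; have e2 : 0 < e / 2 by lra.
have [rho [d [r0 d0 hd]]] := HNb_continuous_bounded ok lL conL ltr01 e2.
have c1 : 0 < nrm c + 1 by have := nrm_ge0 c; lra.
have k0 : 0 < Num.max rho 1 by rewrite lt_max r0.
have dl0 : 0 < Num.min d (e / 2 / (nrm c + 1)) by rewrite lt_min d0 divr_gt0.
have [g hg] := exp_sum_dense ok f k0 dl0.
have hv := HNb_sub ok (HNb_funP f) (HNb_funP (exp_elt g)).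
pose v : space := MkHNb hv.
have v1 : norm_le rho v d.
  apply: (norm_le_trans _ (norm_le_mono (ltW r0) _ hg)); first by rewrite ge_min lexx.
  by rewrite le_max lexx.
have v2 : norm_le 1 v (e / 2 / (nrm c + 1)).
  apply: (norm_le_trans _ (norm_le_mono ler01 _ hg)); first by rewrite ge_min lexx orbT.
  by rewrite le_max lexx orbT.
have := norm_le_lin ok (- c) ler01 hv (HNb_funP (L v)) v2 (hd v v1).
rewrite (_ : (fun x => _) = u); last first.
  apply/funext => y /=; rewrite (HNb_linear_sub (f := f) (g := exp_elt g) lL)//.
  rewrite (convolution_exp_sum ok cL) /=.
  have -> : exp_sum (mult_coef (symbol L) g) y = c * exp_sum g y.
    by rewrite /exp_sum big_map mulr_sumr; apply: eq_bigr => cf _; rewrite symc/=; ring.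
  ring.
apply: norm_le_trans; rewrite nrmN.
have : nrm c * (e / 2 / (nrm c + 1)) <= e / 2.
  by rewrite mulrCA ler_piMr ?(ltW e2)// ler_pdivrMr; lra.
lra.
Qed.

(** A nonconstant symbol is nonconstant on a complex line, so it takes values inside
  and outside the unit disc by Liouville's theorem, and by continuity it does so
  near a point in every direction. *)
Lemma symbol_small_large : ~ scalar_operator L ->
  (forall g, approx (fun phi => nrm (symbol L phi) < 1) g) /\
  (forall g, approx (fun phi => 1 < nrm (symbol L phi)) g).
Proof.
move=> nsc.
have [phi1 [phi2 ne]] : exists phi1 phi2, symbol L phi1 <> symbol L phi2.
  apply: contrapT => no; apply: nsc; apply: (@scalar_of_constant_symbol (symbol L 0)) => phi.
  by apply: contrapT => ne; apply: no; exists phi, 0.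
have [|[z1 h1] [z2 h2]] := @poly_approx_dichotomy R _ 0 1
  (symbol_poly_approx ok cL phi1 (phi2 - phi1)).
  by rewrite scale0r addr0 scale1r addrC subrK.
split.
  apply: (@absorbing_approximable _ _ _ _ _ _ ok _ (phi1 + z1 *: (phi2 - phi1))) => psi.
  set phi0 := phi1 + _ in h1 *.
  have e0 : 0 < (1 - nrm (symbol L phi0)) / 2 by lra.
  have [t t0 ht] := poly_approx_continuous (symbol_poly_approx ok cL phi0 psi) e0.
  exists t => // z /ht; rewrite scale0r addr0.
  have := nrmD (symbol L (phi0 + z *: psi) - symbol L phi0) (symbol L phi0).
  by rewrite subrK; lra.
apply: (@absorbing_approximable _ _ _ _ _ _ ok _ (phi1 + z2 *: (phi2 - phi1))) => psi.
set phi0 := phi1 + _ in h2 *.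
have e0 : 0 < (nrm (symbol L phi0) - 1) / 2 by lra.
have [t t0 ht] := poly_approx_continuous (symbol_poly_approx ok cL phi0 psi) e0.
exists t => // z /ht; rewrite scale0r addr0 nrm_distC.
have := nrmD (symbol L phi0 - symbol L (phi0 + z *: psi)) (symbol L (phi0 + z *: psi)).
by rewrite subrK; lra.
Qed.

End SymbolOfConvolution.

(** * Construction of a hypercyclic vector *)

Section HypercyclicVector.
Context {R : realType} {E : normedModType R[i]} {r q s p : R}.
Hypothesis ok : @exponents_ok R r q s p.
Notation space := (HNb r q s p E).
Notation norm_le := (@norm_le R E r q s p).
Notation gsum := (@gauge_summable R E r q s p).
Notation gdist := (@gauge_dist R E r q s p).
Notation approx := (@approximable R E r q s p).
Notation exp_elt := (exp_elt ok).
Notation symbol := (symbol ok).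
Notation expseq := (seq (R[i] * dual E)).
Variable L : space -> space.
Hypothesis cL : convolution_operator L.

Notation image n g := (mult_coef (fun phi => symbol L phi ^+ n) g).

Definition small_symbol (g : expseq) := forall cf, cf \in g -> nrm (symbol L cf.2) < 1.
Definition large_symbol (g : expseq) := forall cf, cf \in g -> 1 < nrm (symbol L cf.2).

Lemma mult_coef_cat (u : dual E -> R[i]) (g h : expseq) :
  mult_coef u (g ++ h) = mult_coef u g ++ mult_coef u h.
Proof. exact: map_cat. Qed.

Lemma exp_sum_mult_coef_sub (u : dual E -> R[i]) (g h : expseq) x :
  exp_sum (mult_coef u (g ++ scale_coef (-1) h)) x =
  exp_sum (mult_coef u g) x - exp_sum (mult_coef u h) x.
Proof.
rewrite mult_coef_cat exp_sum_cat; congr (_ + _).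
rewrite /exp_sum !big_map -sumrN; apply: eq_bigr => cf _ /=; ring.
Qed.

Lemma iter_bounded n (rho e : R) : 0 < rho -> 0 < e -> exists rho' d : R,
  [/\ 0 < rho', 0 < d & forall f : space, norm_le rho' f d -> norm_le rho (iter n L f) e].
Proof.
have [lL conL _] := cL; apply: (HNb_continuous_bounded ok).
  exact: HNb_linear_iter.
exact: continuous_iter.
Qed.

Lemma image_bounded n (rho e : R) : 0 < rho -> 0 < e -> exists rho' d : R,
  [/\ 0 < rho', 0 < d & forall g, gsum rho' g d -> norm_le rho (exp_sum (image n g)) e].
Proof.
move=> r0 e0; have [rho' [d [r'0 d0 hd]]] := iter_bounded n r0 e0.
exists rho', d; split=> // g gd; have := hd (exp_elt g) (norm_le_exp_sum ok (ltW r'0) gd).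
by rewrite iter_convolution_exp_sum.
Qed.

Lemma image_bounded_all (ns : seq nat) (rho e : R) : 0 < rho -> 0 < e ->
  exists rho' d : R, [/\ 0 < rho', 0 < d & forall n g, n \in ns -> gsum rho' g d ->
    norm_le rho (exp_sum (image n g)) e].
Proof.
move=> r0 e0; elim: ns => [|n ns [r1 [d1 [r10 d10 h1]]]]; first by exists 1, 1; split.
have [r2 [d2 [r20 d20 h2]]] := image_bounded n r0 e0.
exists (Num.max r1 r2), (Num.min d1 d2); split=> [||m g].
- by rewrite lt_max r10.
- by rewrite lt_min d10.
have r1m : r1 <= Num.max r1 r2 by rewrite le_max lexx.
have r2m : r2 <= Num.max r1 r2 by rewrite le_max lexx orbT.
have d1m : Num.min d1 d2 <= d1 by rewrite ge_min lexx.
have d2m : Num.min d1 d2 <= d2 by rewrite ge_min lexx orbT.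
rewrite inE => /predU1P[->|mns] gm.
  apply: h2 => M; apply: le_trans d2m.
  exact: (gauge_summable_mono (ltW r20) r2m gm).
apply: h1 => // M; apply: le_trans d1m.
exact: (gauge_summable_mono (ltW r10) r1m gm).
Qed.

Lemma image_small_all (hist : seq (expseq * nat)) (rho e : R) : 0 < rho -> 0 < e ->
  (forall x, x \in hist -> small_symbol x.1) -> exists N, forall n x, (N <= n)%N ->
    x \in hist -> gsum rho (image n x.1) e.
Proof.
move=> r0 e0; elim: hist => [|y hist IH] hs; first by exists 0%N.
have [|N1 H1] := IH; first by move=> x xh; apply: hs; rewrite inE xh orbT.
have [N2 H2] := mult_coef_small ok (ltW r0) e0 (hs y (mem_head _ _)).
exists (maxn N1 N2) => n x; rewrite geq_max => /andP[n1 n2].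
by rewrite inE => /predU1P[->|]; [exact: H2|exact: H1].
Qed.

(** The new term approximates the inverse image of the target [Y] under a high power of
  the operator. This inverse image is small because the symbols of [Y] are large, so
  the new term does not disturb the images taken before; the earlier terms, whose
  symbols are small, do not disturb the new image if the power is high. *)
Lemma hypercyclic_step (hist : seq (expseq * nat)) (Y : expseq) (K eps : R) :
  (forall g, approx (fun phi => nrm (symbol L phi) < 1) g) ->
  0 < K -> 0 < eps -> (forall x, x \in hist -> small_symbol x.1) -> large_symbol Y ->
  exists gn : expseq * nat, [/\ small_symbol gn.1, gsum K gn.1 eps,
    (forall x, x \in hist -> norm_le K (exp_sum (image x.2 gn.1)) eps),
    norm_le K (fun x => exp_sum (image gn.2 gn.1) x - exp_sum Y x) eps &
    (forall x, x \in hist -> norm_le K (exp_sum (image gn.2 x.1)) eps)].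
Proof.
move=> dense_small K0 e0 hs hY.
have [r1 [d1 [r10 d10 h1]]] := image_bounded_all (map snd hist) K0 e0.
pose K' := Num.max K r1; pose dl := Num.min eps d1.
have KK' : K <= K' by rewrite le_max lexx.
have rK' : r1 <= K' by rewrite le_max lexx orbT.
have K'0 : 0 < K' by exact: lt_le_trans KK'.
have dl0 : 0 < dl by rewrite lt_min e0.
have dle : dl <= eps by rewrite ge_min lexx.
have dld : dl <= d1 by rewrite ge_min lexx orbT.
have dl2 : 0 < dl / 2 by lra.
have [|N1 H1] := @mult_coef_small _ _ _ _ _ _ ok (fun phi => (symbol L phi)^-1) Y
  K' _ (ltW K'0) dl2.
  move=> cf /hY h; rewrite nrmV invf_lt1//; exact: lt_trans h.
have [N2 H2] := image_small_all K0 e0 hs.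
pose n := maxn N1 N2.
have {}H1 := H1 n (leq_maxl _ _).
set Z := mult_coef _ Y in H1.
(* [Z] is the image of [Y] under the right inverse of the [n]-th power. *)
have imZ : image n Z = Y.
  rewrite /Z /mult_coef -map_comp -[RHS]map_id; apply/eq_in_map => -[c phi] /hY/= h.
  congr (_, _); rewrite -mulrA -exprMn mulVf ?expr1n ?mulr1//.
  by apply/eqP => s0; rewrite s0 nrm0 ltr10 in h.
have [r2 [d2 [r20 d20 h2]]] := image_bounded n K0 e0.
pose K2 := Num.max K' r2; pose dl3 := Num.min (dl / 2) d2.
have K20 : 0 < K2 by rewrite lt_max K'0.
have dl30 : 0 < dl3 by rewrite lt_min dl2.
have [g [gs gd]] := dense_small Z K2 dl3 K20 dl30.
have gd1 : gdist K' g Z (dl / 2).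
  apply: gauge_dist_sym => //; first exact: ltW.
  apply: (gauge_dist_le (B := dl3)); first by rewrite ge_min lexx.
  by apply: gauge_summable_mono (ltW K'0) _ gd; rewrite le_max lexx.
have gd2 : gdist r2 g Z d2.
  apply: gauge_dist_sym => //; first exact: ltW.
  apply: (gauge_dist_le (B := dl3)); first by rewrite ge_min lexx orbT.
  by apply: gauge_summable_mono (ltW r20) _ gd; rewrite le_max lexx orbT.
have gK' : gsum K' g dl by have := gauge_dist_to_sum ok (ltW K'0) gd1 H1; rewrite -splitr.
exists (g, n); split=> //=.
- by move=> M; apply: le_trans dle; exact: (gauge_summable_mono (ltW K0) KK' gK').
- move=> x xh; apply: h1; first exact: map_f.
  by move=> M; apply: le_trans dld; exact: (gauge_summable_mono (ltW r10) rK' gK').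
- have := h2 _ gd2; rewrite -{1}imZ.
  by rewrite (_ : exp_sum _ = fun x => exp_sum (image n g) x - exp_sum (image n Z) x)//;
    apply/funext => x; rewrite exp_sum_mult_coef_sub.
- move=> x xh; apply: (norm_le_exp_sum ok (ltW K0)); apply: H2 => //; exact: leq_maxr.
Qed.

Section Construction.
Hypothesis dense_small : forall g, approx (fun phi => nrm (symbol L phi) < 1) g.
Variable Y : nat -> expseq.
Hypothesis largeY : forall k, large_symbol (Y k).

Let half k : R := 2^-1 ^+ k.

Lemma half_gt0 k : 0 < half k.
Proof. by rewrite exprn_gt0// invr_gt0. Qed.

Lemma halfS k : half k = 2 * half k.+1.
Proof. by rewrite /half exprS mulrA divff ?mul1r. Qed.

(* The [k] earlier terms contribute at most [k%:R * eps k] to the [k]-th image. *)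
Let eps k : R := half k / k.+1%:R.

Lemma eps_gt0 k : 0 < eps k.
Proof. by rewrite divr_gt0 ?half_gt0. Qed.

Lemma eps_le k : eps k <= half k.
Proof. by rewrite ler_pdivrMr// ler_peMr ?(ltW (half_gt0 k))// ler1n. Qed.

(** The steps are chosen one after the other, each knowing the list of the previous ones. *)
Lemma hypercyclic_steps : exists X : nat -> expseq * nat, forall k,
  [/\ gsum k.+1%:R (X k).1 (eps k),
    (forall i, (i < k)%N ->
       norm_le k.+1%:R (exp_sum (image (X i).2 (X k).1)) (eps k)),
    norm_le k.+1%:R (fun x => exp_sum (image (X k).2 (X k).1) x - exp_sum (Y k) x) (eps k) &
    (forall i, (i < k)%N ->
       norm_le k.+1%:R (exp_sum (image (X k).2 (X i).1)) (eps k))].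
Proof.
pose good (hist : seq (expseq * nat)) gn := let k := size hist in
  [/\ small_symbol gn.1, gsum k.+1%:R gn.1 (eps k),
    (forall x, x \in hist -> norm_le k.+1%:R (exp_sum (image x.2 gn.1)) (eps k)),
    norm_le k.+1%:R (fun x => exp_sum (image gn.2 gn.1) x - exp_sum (Y k) x) (eps k) &
    (forall x, x \in hist -> norm_le k.+1%:R (exp_sum (image gn.2 x.1)) (eps k))].
have hex hist : exists gn, (forall x, x \in hist -> small_symbol x.1) -> good hist gn.
  have [hs|nhs] := pselect (forall x, x \in hist -> small_symbol x.1); last by exists ([::], 0%N).
  have hY : large_symbol (Y (size hist)) by exact: largeY.
  have [gn gnP] := @hypercyclic_step hist (Y (size hist)) (size hist).+1%:R
    (eps (size hist)) dense_small (ltr0Sn R _) (eps_gt0 _) hs hY.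
  by exists gn.
have [st stP] := choice hex.
pose H := fix H k := if k is j.+1 then rcons (H j) (st (H j)) else [::].
have sizeH k : size (H k) = k by elim: k => //= k IH; rewrite size_rcons IH.
have smallH k x : x \in H k -> small_symbol x.1.
  elim: k x => //= k IH x; rewrite mem_rcons inE => /predU1P[->|]; last exact: IH.
  by have [] := stP (H k) IH.
exists (fun k => st (H k)) => k.
have memH i : (i < k)%N -> st (H i) \in H k.
  elim: k => // k IH; rewrite ltnS leq_eqVlt /= mem_rcons inE => /predU1P[->|ik].
    by rewrite eqxx.
  by rewrite IH ?orbT.
have := stP (H k) (@smallH k); rewrite /good sizeH => -[_ h1 h2 h3 h4].
by split; [exact: h1|move=> i ik; apply: h2; exact: memH|exact: h3|
  move=> i ik; apply: h4; exact: memH].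
Qed.

(** In the image of the sum under the power chosen at step [k], the terms before the
  [k]-th are small by the choice of that power, those after it by their own choice,
  and the [k]-th is close to the target. *)
Lemma orbit_follows : exists f : space, forall k, exists n,
  norm_le k.+1%:R (fun x => iter n L f x - exp_sum (Y k) x) (3 * half k).
Proof.
have [X XP] := hypercyclic_steps.
pose G := fix G k := if k is j.+1 then G j ++ (X j).1 else [::].
have eG k l (rho : R) : 0 <= rho -> rho <= k.+1%:R -> (k <= l)%N ->
    gdist rho (G l) (G k) (2 * half k - 2 * half l).
  move=> r0 rk; elim: l => [|l IH].
    by rewrite leqn0 => /eqP ->; apply: gauge_dist_refl; rewrite // subrr.
  rewrite leq_eqVlt => /predU1P[->|]; first by apply: gauge_dist_refl; rewrite // subrr.
  rewrite ltnS => kl; have [Xl _ _ _] := XP l.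
  have rl : rho <= l.+1%:R by apply: le_trans rk _; rewrite ler_nat.
  have h := gauge_summable_cat ok r0 (IH kl) (gauge_summable_mono r0 rl Xl).
  apply: (gauge_dist_le (B := 2 * half k - 2 * half l + eps l)).
    by have := eps_le l; rewrite (halfS l); lra.
  move: h; apply: gauge_summable_eq => m x.
  have -> : G l.+1 = G l ++ (X l).1 by [].
  by rewrite !(power_sum_cat, power_sum_scale); ring.
have cG : @gauge_cauchy R E r q s p G.
  move=> rho e r0 e0.
  have [N1 hN1] : exists N : nat, rho <= N.+1%:R.
    by exists (Num.truncn rho); apply/ltW; rewrite truncnS_gt.
  have [N2 hN2] : exists N, forall k, (N <= k)%N -> 2 * half k <= e.
    have h1 : `|2^-1 : R| < 1 by rewrite ger0_norm ?invr_ge0// invf_lt1// ltr1n.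
    have e2 : 0 < e / 2 by lra.
    have /cvgrPdist_lt/(_ _ e2)[N _ NP] := cvg_expr h1.
    exists N => k /NP; rewrite sub0r normrN ger0_norm ?exprn_ge0 ?invr_ge0//.
    by rewrite /half; lra.
  exists (maxn N1 N2) => k l; rewrite geq_max => /andP[k1 /hN2 k2] kl.
  apply: (gauge_dist_le (B := 2 * half k - 2 * half l)).
    by have := half_gt0 l; lra.
  apply: eG => //; first exact: ltW.
  by apply: le_trans hN1 _; rewrite ler_nat.
have [f fG] := norm_le_limit ok cG; exists f => k; exists (X k).2.
set n := (X k).2; have k0 : 0 < k.+1%:R :> R by rewrite ltr0n.
have hE (g : expseq) := (HNb_exp_sum ok g).1.
have imG j : exp_sum (image n (G j.+1)) =
    fun x => exp_sum (image n (G j)) x + exp_sum (image n (X j).1) x.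
  by apply/funext => x; rewrite /= mult_coef_cat exp_sum_cat.
have before j : (j <= k)%N -> norm_le k.+1%:R (exp_sum (image n (G j))) (j%:R * eps k).
  elim: j => [_|j IH jk].
    rewrite mul0r; apply: norm_le_zero; rewrite ?(ltW k0)// => x.
    by rewrite /exp_sum big_nil.
  have -> : j.+1%:R * eps k = j%:R * eps k + eps k by rewrite -natr1 mulrDl mul1r.
  rewrite imG; apply: (norm_le_add ok (ltW k0)) => //.
    exact: IH (ltnW jk).
  by have [_ _ _] := XP k; apply.
have after l : (k < l)%N -> norm_le k.+1%:R
    (fun x => exp_sum (image n (G l)) x - exp_sum (Y k) x) (2 * half k - 2 * half l).
  elim: l => // l IH; rewrite ltnS leq_eqVlt => /predU1P[<-|kl].
    have [_ _ h _] := XP k.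
    have := norm_le_add ok (ltW k0) (hE _) (HNb_sub ok (hE _) (hE _)) (before k (leqnn k)) h.
    rewrite imG; have -> : k%:R * eps k + eps k = 2 * half k - 2 * half k.+1.
      have : k.+1%:R * eps k = half k by rewrite /eps mulrC divfK.
      by rewrite -natr1 mulrDl mul1r => ->; have := halfS k; lra.
    by under eq_fun do rewrite addrA.
  have [_ /(_ k kl) h _ _] := XP l.
  have kl1 : k.+1%:R <= l.+1%:R :> R by rewrite ler_nat ltnS ltnW.
  have := norm_le_add ok (ltW k0) (HNb_sub ok (hE _) (hE _)) (hE _) (IH kl)
    (norm_le_mono (ltW k0) kl1 h).
  rewrite imG; under eq_fun do rewrite addrAC.
  by apply: norm_le_trans; have := eps_le l; rewrite (halfS l); lra.
have [rho [d [r0 d0 hd]]] := iter_bounded n k0 (half_gt0 k).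
have [N NP] := fG rho d r0 d0.
pose l := maxn N k.+1; have {}NP := NP l (leq_maxl _ _).
have {}after := after l (leq_maxr _ _).
pose v : space := MkHNb (HNb_sub ok (HNb_funP f) (hE (G l))).
have := hd v NP.
have -> : HNb_fun (iter n L v) = fun x => iter n L f x - exp_sum (image n (G l)) x.
  apply/funext => x; have [lL _ _] := cL.
  rewrite (HNb_linear_sub (f := f) (g := exp_elt (G l)) (HNb_linear_iter n lL))//.
  by rewrite (iter_convolution_exp_sum ok cL).
move=> h; have := norm_le_dist ok (ltW k0) (HNb_funP _) (hE _) (hE _) h after.
by apply: norm_le_trans; have := half_gt0 l; lra.
Qed.

End Construction.

(** The exponents of [2] in the successive integers take every value infinitely often, so
  that each member of the dense family is a target with arbitrarily small errors. *)
Lemma hypercyclic_of_dense_symbols (D : nat -> expseq) :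
  (forall g rho e, 0 < rho -> 0 < e -> exists i, gdist rho g (D i) e) ->
  (forall g, approx (fun phi => nrm (symbol L phi) < 1) g) ->
  (forall g, approx (fun phi => 1 < nrm (symbol L phi)) g) -> hypercyclic L.
Proof.
move=> denseD dense_small dense_large.
pose half k : R := 2^-1 ^+ k.
have h0 k : 0 < half k by rewrite exprn_gt0// invr_gt0.
pose idx k := logn 2 k.+1.
have [Y YP] : exists Y : nat -> expseq, forall k,
    large_symbol (Y k) /\ gdist k.+1%:R (D (idx k)) (Y k) (half k).
  have hex k : exists Yk, large_symbol Yk /\ gdist k.+1%:R (D (idx k)) Yk (half k).
    exact: dense_large (ltr0Sn R k) (h0 k).
  by have [Y YP] := choice hex; exists Y.
have [f fP] := orbit_follows dense_small (fun k => (YP k).1).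
exists f => U [u Uu] oU; have {}oU : HNb_open U by [].
have [t [e [tP e0 eU]]] := oU u Uu.
pose rho := 1 + \sum_(v <- t) `|v|.
have r0 : 0 < rho by rewrite ltr_pwDl// sumr_ge0.
have rt v : v \in t -> v <= rho.
  move=> vt; apply: (le_trans (ler_norm v)).
  by rewrite /rho (big_rem v)//= addrCA lerDl addr_ge0// sumr_ge0.
have e8 : 0 < e / 8 by lra.
have [g hg] := exp_sum_dense ok u r0 e8.
have [i hi] := denseD g rho _ r0 e8.
have [k [ki kr ke]] : exists k, [/\ idx k = i, rho <= k.+1%:R & 4 * half k <= e / 2].
  have [N1 hN1] : exists N : nat, rho <= N.+1%:R.
    by exists (Num.truncn rho); apply/ltW; rewrite truncnS_gt.
  have [N2 hN2] : exists N, forall k, (N <= k)%N -> 4 * half k <= e / 2.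
    have h1 : `|2^-1 : R| < 1 by rewrite ger0_norm ?invr_ge0// invf_lt1// ltr1n.
    have /cvgrPdist_lt/(_ _ e8)[N _ NP] := cvg_expr h1.
    exists N => k /NP; rewrite sub0r normrN ger0_norm ?exprn_ge0 ?invr_ge0//.
    by rewrite /half; lra.
  pose N := maxn N1 N2; pose k := (2 ^ i * N.*2.+1).-1.
  have kS : k.+1 = (2 ^ i * N.*2.+1)%N by rewrite prednK// muln_gt0 expn_gt0.
  have Nk : (N <= k)%N.
    rewrite -ltnS kS (@leq_trans N.*2.+1)//; first by rewrite ltnS -addnn leq_addr.
    by rewrite leq_pmull// expn_gt0.
  exists k; split.
  - rewrite /idx kS lognM ?expn_gt0// pfactorK// lognE/= dvdn2/= odd_double addn0//.
  - by apply: le_trans hN1 _; rewrite ler_nat ltnS (leq_trans _ Nk)// leq_maxl.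
  - by apply: hN2; rewrite (leq_trans _ Nk)// leq_maxr.
have [n hn] := fP k; exists (iter n L f); split; last by exists n.
apply: eU => v vt; have v0 := tP v vt; have hE (h : expseq) := (HNb_exp_sum ok h).1.
apply: (@le_lt_trans _ _ (3 * half k + (half k + (e / 8 + e / 8)))%:E); last first.
  by rewrite lte_fin; lra.
apply: (HNb_seminormP ok _ (ltW v0) (HNb_sub ok (HNb_funP _) (HNb_funP _))).2.
apply: (norm_le_mono (ltW v0) (rt v vt)).
have := YP k; rewrite ki => -[_ hY].
apply: (norm_le_dist ok (ltW r0) (HNb_funP _) (hE (Y k)) (HNb_funP _)).
  exact: norm_le_mono (ltW r0) kr hn.
apply: (norm_le_dist ok (ltW r0) (hE _) (hE (D i)) (HNb_funP _)).
  apply: (norm_le_gauge_dist ok (ltW r0)); apply: (gauge_dist_sym ok (ltW r0)).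
  exact: gauge_summable_mono (ltW r0) kr hY.
apply: (norm_le_dist ok (ltW r0) (hE _) (hE g) (HNb_funP _)).
  by apply: (norm_le_gauge_dist ok (ltW r0)); exact: (gauge_dist_sym ok (ltW r0)).
exact: (norm_le_distC ok (ltW r0) (HNb_funP _) (hE _) hg).
Qed.

End HypercyclicVector.

(** * Conjugate exponents and hypercyclicity of convolution operators *)

Section Exponents.
Context {R : realType}.
Implicit Types (t r q s p : R).

Lemma hoelder_conjugateE t : 1 < t -> hoelder_conjugate t%:E = (t / (t - 1))%:E.
Proof.
move=> t1; have t0 : 0 < t by lra.
by rewrite /hoelder_conjugate/= eqe gt_eqF// inver subr_eq0 gt_eqF// -EFinM.
Qed.

(** The condition on [q] and [p] forces [1 < p], since [1 / p'] vanishes for [p = 1];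
  the finite conjugates are then ordered as [s' <= p' <= q' <= r']. *)
Lemma exponents_ok_of r q s p : 1 < r -> 1 < q -> 1 <= s -> 1 <= p -> r <= q ->
  (hoelder_conjugate s%:E <= hoelder_conjugate p%:E)%E ->
  (1 <= q^-1%:E + (hoelder_conjugate p%:E)^-1)%E -> @exponents_ok R r q s p.
Proof.
move=> r1 q1 s1 p1 rq sp qp.
have p_gt1 : 1 < p.
  rewrite lt_neqAle p1 andbT; apply/negP => /eqP pE; move: qp.
  rewrite -pE hoelder_conjugate1 invey adde0 lee_fin leNgt invf_lt1 ?q1//.
  exact: lt_trans q1.
have s_gt1 : 1 < s.
  rewrite lt_neqAle s1 andbT; apply/negP => /eqP sE; move: sp.
  by rewrite -sE hoelder_conjugate1 hoelder_conjugateE// leye_eq.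
move: sp qp; rewrite !hoelder_conjugateE// lee_fin inver.
have p'0 : 0 < p / (p - 1) by rewrite divr_gt0; lra.
rewrite gt_eqF// -EFinD lee_fin => sp qp.
split; rewrite ?hoelder_conjugateE//=.
- lra.
- by rewrite divr_gt0; lra.
- by field; lra.
- by rewrite divr_gt0; lra.
- rewrite -[leRHS]invrK -[leLHS]invrK lef_pV2 ?posrE ?invr_gt0//; last first.
    by rewrite divr_gt0; lra.
  rewrite [leLHS](_ : _ = 1 - q^-1); first lra.
  by field; lra.
- have E (t : R) : 1 < t -> t / (t - 1) = 1 + (t - 1)^-1 by move=> t1; field; lra.
  by rewrite !E// lerD2l lef_pV2 ?posrE; lra.
Qed.

End Exponents.

Theorem theorem4p11 (R : realType) (E : completeNormedModType R[i])
  (r q s p : R)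
  (r_gt1 : 1 < r) (q_gt1 : 1 < q) (s_ge1 : 1 <= s) (p_ge1 : 1 <= p)
  (r_le_q : r <= q)
  (s'_le_p' : (hoelder_conjugate s%:E <= hoelder_conjugate p%:E)%E)
  (q_p' : forall n : nat, (0 < n)%N ->
     (1 <= q^-1%:E + n%:R%:E * (hoelder_conjugate p%:E)^-1)%E)
  (bapE' : bounded_approximation_property (dual E))
  (sepE' : separable (dual E))
  (L : HNb r q s p E -> HNb r q s p E)
  (convL : convolution_operator L)
  (L_not_scalar : ~ scalar_operator L) :
  hypercyclic L.
Proof.
have qp1 : (1 <= q^-1%:E + (hoelder_conjugate p%:E)^-1)%E.
  by have := q_p' 1%N isT; rewrite mul1e.
have ok := exponents_ok_of r_gt1 q_gt1 s_ge1 p_ge1 r_le_q s'_le_p' qp1.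
have [D denseD] := countable_exp_sums ok sepE'.
have [dense_small dense_large] := symbol_small_large ok convL L_not_scalar.
exact (hypercyclic_of_dense_symbols convL denseD dense_small dense_large).
Qed.
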